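(* The generator $G$ of the minimal semigroup $(Z(t))_{t\ge0}$ is $G=\overline{A+K}$ (the closure of $A+K$ in $\mathcal X$). In particular $(Z(t))_{t\ge0}$ is honest (conservative): $$\int_{\mathbb R^3\times\mathbb R^3}Z(t)f(x,v)\,dx\,dv=\int_{\mathbb R^3\times\mathbb R^3}f(x,v)\,dx\,dv\qquad\text{for all }f\in\mathcal X,\ t\ge0.$$
   Context: Fix masses $m,m_1>0$, a constant restitution coefficient $\epsilon\in(0,1)$, a bulk velocity $u_1\in\mathbb R^3$ and a temperature $\vartheta_1>0$. Let $\mathcal M_1(v)=\big(\frac{m_1}{2\pi\vartheta_1}\big)^{3/2}\exp\big(-\frac{m_1|v-u_1|^2}{2\vartheta_1}\big)$, $\alpha=\frac{m_1}{m+m_1}$, $\beta=\frac{1-\epsilon}{2}$, $\gamma=\alpha\frac{1-\beta}{1-2\beta}$, $\bar\gamma=(1-\alpha)\frac{1-\beta}{1-2\beta}$. For $v,w\in\mathbb R^3$, $n\in\mathbb S^2$, $q=v-w$, let $v_\star=v-2\gamma(q\cdot n)n$, $w_\star=w+2\bar\gamma(q\cdot n)n$, and $\sigma(v)=\int_{\mathbb R^3\times\mathbb S^2}|q\cdot n|\mathcal M_1(w)\,dw\,dn$. Let $\mathcal X=L^1(\mathbb R^3\times\mathbb R^3,dx\otimes dv)$; $T_0f=-v\cdot\nabla_xf$ with $\mathscr D(T_0)=\{f\in\mathcal X:v\cdot\nabla_xf\in\mathcal X\}$; $\Sigma f=-\sigma(v)f$ with $\mathscr D(\Sigma)=\{f\in\mathcal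 X:\sigma f\in\mathcal X\}$; $A=T_0+\Sigma$ on $\mathscr D(A)=\mathscr D(T_0)\cap\mathscr D(\Sigma)$ (it generates the contraction semigroup $V(t)f(x,v)=e^{-\sigma(v)t}f(x-tv,v)$); and $K$, with $\mathscr D(K)=\mathscr D(A)$, is $Kf(x,v)=\epsilon^{-2}\int_{\mathbb R^3\times\mathbb S^2}|q\cdot n|f(x,v_\star)\mathcal M_1(w_\star)\,dw\,dn$. Then $K\ge0$ and $\int(Af+Kf)\,dx\,dv=0$ for $f\in\mathscr D(A)$, $f\ge0$, and by substochastic perturbation theory there is a positive contraction $C_0$-semigroup $(Z(t))_{t\ge0}$ on $\mathcal X$ whose generator $G$ extends $A+K$ and which is minimal: any positive $C_0$-semigroup $(T(t))$ whose generator extends $A+K$ satisfies $T(t)\ge Z(t)$ for all $t\ge0$. *)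

(* Defs.v *)
From HB Require Import structures.
From mathcomp Require Import all_boot all_order all_algebra.
From mathcomp Require Import all_classical all_reals all_analysis.
Set Implicit Arguments. Unset Strict Implicit. Unset Printing Implicit Defensive.
Import Order.TTheory GRing.Theory Num.Theory.
Import numFieldNormedType.Exports.
Local Open Scope classical_set_scope.
Local Open Scope ring_scope.

Section Defs.
Variable R : realType.

Definition vec := (R * R * R)%type.
Definition vadd (a b : vec) : vec :=
  (a.1.1 + b.1.1, a.1.2 + b.1.2, a.2 + b.2).
Definition vscale (s : R) (a : vec) : vec := (s * a.1.1, s * a.1.2, s * a.2).
Definition vsub (a b : vec) : vec := vadd a (vscale (-1) b).
Definition dot (a b : vec) : R := a.1.1 * b.1.1 + a.1.2 * b.1.2 + a.2 * b.2.
Definition vnorm (a : vec) : R := Num.sqrt (dot a a).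
Definition unitv (a : vec) : vec := vscale (vnorm a)^-1 a.

Definition lam3 := ((@lebesgue_measure R) \x (@lebesgue_measure R)
                     \x (@lebesgue_measure R))%E.
Definition lam6 := (lam3 \x lam3)%E.

Definition phase := (vec * vec)%type.
Definition fn := phase -> R.

Definition L1 (f : fn) : Prop := lam6.-integrable setT (EFin \o f).
Definition L1norm (f : fn) : R := fine (\int[lam6]_z (`|f z|)%:E)%E.
Definition L1dist (f g : fn) : R := fine (\int[lam6]_z (`|f z - g z|)%:E)%E.
Definition aeq (f g : fn) : Prop := {ae lam6, forall z, f z = g z}.
Definition aele (f g : fn) : Prop := {ae lam6, forall z, f z <= g z}.
Definition zerof : fn := fun _ => 0.

(* ---------- integration over R^3_w x S^2_n ----------
   Surface measure on S^2 via  int_{S^2} h(n) dn = 3 int_{0<|y|<=1} h(y/|y|) dy. *)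
Definition ballS : set (vec * vec) := [set p | 0 < vnorm p.2 <= 1].
Definition int_R3S2 (h : vec -> vec -> R) : R :=
  3 * fine (\int[(lam3 \x lam3)%E]_(p in ballS) (h p.1 (unitv p.2))%:E)%E.

Variables (m m1 eps th1 : R) (u1 : vec).

Definition M1 (v : vec) : R :=
  (m1 / (2 * pi * th1)) `^ (3 / 2) *
  expR (- (m1 * (vnorm (vsub v u1)) ^+ 2) / (2 * th1)).

Definition alpha : R := m1 / (m + m1).
Definition beta : R := (1 - eps) / 2.
Definition gam : R := alpha * (1 - beta) / (1 - 2 * beta).
Definition gambar : R := (1 - alpha) * (1 - beta) / (1 - 2 * beta).

Definition vstar (v w n : vec) : vec :=
  vsub v (vscale (2 * gam * dot (vsub v w) n) n).
Definition wstar (v w n : vec) : vec :=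
  vadd w (vscale (2 * gambar * dot (vsub v w) n) n).

Definition sigma (v : vec) : R :=
  int_R3S2 (fun w n => `|dot (vsub v w) n| * M1 w).

Definition Kop (f : fn) : fn := fun z =>
  eps ^- 2 * int_R3S2 (fun w n =>
     `|dot (vsub z.2 w) n| * f (z.1, vstar z.2 w n) * M1 (wstar z.2 w n)).

(* ---------- the free streaming operator T0 f = - v . grad_x f ----------
   (distributional sense).  Test functions: continuous, compactly supported,
   continuously differentiable along the free-streaming direction. *)
Definition Dv (phi : fn) (z : phase) : R :=
  'D_1 (fun s : R => phi (vadd z.1 (vscale s z.2), z.2)) 0.

Definition supnorm (z : phase) : R :=
  Num.max (Num.max (Num.max `|z.1.1.1| `|z.1.1.2|) `|z.1.2|)
          (Num.max (Num.max `|z.2.1.1| `|z.2.1.2|) `|z.2.2|).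

Definition test_fn (phi : fn) : Prop :=
  (exists r : R, forall z, r < supnorm z -> phi z = 0) /\
  continuous phi /\
  (forall z : phase,
     derivable (fun s : R => phi (vadd z.1 (vscale s z.2), z.2)) 0 1) /\
  continuous (Dv phi).

Definition T0 (f g : fn) : Prop :=
  L1 f /\ L1 g /\
  forall phi, test_fn phi ->
    (\int[lam6]_z (g z * phi z)%:E = \int[lam6]_z (f z * Dv phi z)%:E)%E.

Definition domA (f : fn) : Prop :=
  L1 f /\ (exists g, T0 f g) /\ L1 (fun z => sigma z.2 * f z).

Definition AK (f g : fn) : Prop :=
  domA f /\ L1 g /\
  exists h, T0 f h /\ aeq g (fun z => h z - sigma z.2 * f z + Kop f z).

Definition AK_closure (f g : fn) : Prop :=
  L1 f /\ L1 g /\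
  exists (fs gs : nat -> fn), (forall n, AK (fs n) (gs n)) /\
    (L1dist (fs n) f @[n --> \oo] --> 0) /\
    (L1dist (gs n) g @[n --> \oo] --> 0).

End Defs.

Section Semigroups.
Variable R : realType.
Definition sgroup := R -> fn R -> fn R.

Definition C0_semigroup (T : sgroup) : Prop :=
  (forall t f, 0 <= t -> L1 f -> L1 (T t f)) /\
  (forall t f g, 0 <= t -> L1 f -> L1 g -> aeq f g -> aeq (T t f) (T t g)) /\
  (forall t (a b : R) f g, 0 <= t -> L1 f -> L1 g ->
     aeq (T t (fun z => a * f z + b * g z))
         (fun z => a * T t f z + b * T t g z)) /\
  (forall t, 0 <= t -> exists C : R,
     forall f, L1 f -> L1norm (T t f) <= C * L1norm f) /\
  (forall f, L1 f -> aeq (T 0 f) f) /\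
  (forall s t f, 0 <= s -> 0 <= t -> L1 f ->
     aeq (T (s + t) f) (T s (T t f))) /\
  (forall f, L1 f -> L1dist (T t f) f @[t --> 0^'+] --> 0).

Definition positive_sg (T : sgroup) : Prop :=
  forall t f, 0 <= t -> L1 f -> aele (@zerof R) f -> aele (@zerof R) (T t f).

Definition contraction_sg (T : sgroup) : Prop :=
  forall t f, 0 <= t -> L1 f -> L1norm (T t f) <= L1norm f.

Definition generator (T : sgroup) (f g : fn R) : Prop :=
  L1 f /\ L1 g /\
  (L1dist (fun z => (T t f z - f z) / t) g @[t --> 0^'+] --> 0).

Definition gen_extends (T : sgroup) (Op : fn R -> fn R -> Prop) : Prop :=
  forall f g, Op f g -> generator T f g.

Definition sg_ge (T Z : sgroup) : Prop :=
  forall t f, 0 <= t -> L1 f -> aele (@zerof R) f -> aele (Z t f) (T t f).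

Definition minimal_sg (Z : sgroup) (Op : fn R -> fn R -> Prop) : Prop :=
  forall T, C0_semigroup T -> positive_sg T -> gen_extends T Op -> sg_ge T Z.
End Semigroups.

(* Main.v *)
(* Contractivity makes a generator dissipative, so [G] is the closure of [A + K] as soon
   as, for some l > 0, the range of [l - A - K] on its domain is dense in L^1; if the range
   is already dense on elements u with [\int (A u + K u) = 0], then [\int G f = 0] on the
   domain of [G], which gives honesty.  Let [S] be the resolvent of [A] at l, the integral
   of [exp (- (l + sigma v) t) f (x - t v, v)] over t > 0.  For f >= 0, [f - K S f] is
   [l u - (A + K) u] with [u = S f], and telescoping shows that [f - (K S)^n f] is in the
   range for all n.  With [W v = 1 + |v|^2] the adjoint of [K] satisfies
   [K^* W <= (sigma + c) W], since energy is dissipated in collisions up to the Maxwellian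
   background.  Hence for l = c + 1 the W-moment of [S (K S)^n f] is bounded by the
   decrease of the W-moment of [(K S)^n f], so it is summable in n.  As [sigma <= C W], the
   norm of [(K S)^n.+1 f], which is the integral of [sigma S (K S)^n f], is summable too
   and tends to 0. *)
Require Import Defs.
From HB Require Import structures.
From mathcomp Require Import all_boot all_order all_algebra.
From mathcomp Require Import all_classical all_reals all_analysis measurable_realfun.
From mathcomp Require Import ring lra.
Import Order.TTheory GRing.Theory Num.Theory.
Import numFieldNormedType.Exports.
Local Open Scope classical_set_scope.
Local Open Scope ring_scope.
Set Implicit Arguments. Unset Strict Implicit. Unset Printing Implicit Defensive.

(** The operators are extended integrals passed through [fine], so they can be trusted only almost
    everywhere. Identities for [K] and the resolvent are proved for nonnegative functions with
    extended real values, where Tonelli applies freely, and are transferred once almost everywhere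
    finiteness is known.

    Together they cancel the eps^-2 in front of [K], so that K^* 1 = sigma, which is conservation of
    mass. The same adjoint, applied to W, evaluates W after an inelastic collision. The energy
    change there is quadratic in the normal relative velocity, with negative leading coefficient
    because 0 < kap < 2, so it is bounded by the background velocity alone. Hence sigma W enters the
    bound on K^* W with coefficient exactly 1; this matters because sigma grows with the speed.

    Finite W-moments are reached by cutting off large velocities, signed functions by splitting into
    positive and negative parts. *)

(** * Sigma-finite products: Lebesgue measure on R^3 and R^6 *)

Section product_sigma_finite.
Local Open Scope ereal_scope.
Context d1 d2 (T1 : measurableType d1) (T2 : measurableType d2) (R : realType).
Variables (m1 : {sigma_finite_measure set T1 -> \bar R})
  (m2 : {sigma_finite_measure set T2 -> \bar R}).

(** Products of two increasing exhaustions: monotonicity puts a point of [F i] and a point of [G j]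
    into the common stage [maxn i j]. *)
Lemma product_measure1_sigma_finite : sigma_finite setT (m1 \x m2).
Proof.
have /sigma_finiteP[F [TF ndF F_fin]] := sigma_finiteT m1.
have /sigma_finiteP[G [TG ndG G_fin]] := sigma_finiteT m2.
exists (fun n => F n `*` G n); last first.
  move=> n; have [mF Foo] := F_fin n; have [mG Goo] := G_fin n.
  split; first exact: measurableX.
  by rewrite product_measure1E// lte_mul_pinfty// ge0_fin_numE.
apply/seteqP; split=> // -[x y] _.
have [i _ Fx] : (\bigcup_n F n) x by rewrite -TF.
have [j _ Gy] : (\bigcup_n G n) y by rewrite -TG.
exists (maxn i j) => //; split => /=.
- by move: Fx; apply/subsetPset/ndF/leq_maxl.
- by move: Gy; apply/subsetPset/ndG/leq_maxr.
Qed.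

End product_sigma_finite.

Section lam_measures.
Variable R : realType.
Local Notation leb := (@lebesgue_measure R).
(** Named so that it can carry measure instances; [lam3] and [lam6] can then in turn be factors in
    Tonelli's theorem. *)
Definition lam2 := (leb \x leb)%E.
Let p2_0 : lam2 set0 = 0%E. Proof. exact: measure0. Qed.
Let p2_ge0 A : (0 <= lam2 A)%E. Proof. exact: measure_ge0. Qed.
Let p2_sigma : semi_sigma_additive lam2.
Proof. exact: measure_semi_sigma_additive. Qed.
HB.instance Definition _ := isMeasure.Build _ _ R lam2 p2_0 p2_ge0 p2_sigma.
Let p2_sfin : sigma_finite setT lam2.
Proof. exact: product_measure1_sigma_finite. Qed.
HB.instance Definition _ := Measure_isSigmaFinite.Build _ _ R lam2 p2_sfin.

Local Notation p3 := (lam2 \x leb)%E.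
Let p3_0 : p3 set0 = 0%E. Proof. exact: measure0. Qed.
Let p3_ge0 A : (0 <= p3 A)%E. Proof. exact: measure_ge0. Qed.
Let p3_sigma : semi_sigma_additive p3.
Proof. exact: measure_semi_sigma_additive. Qed.
HB.instance Definition _ := isMeasure.Build _ _ R (@lam3 R) p3_0 p3_ge0 p3_sigma.
Let p3_sfin : sigma_finite setT p3.
Proof. exact: product_measure1_sigma_finite. Qed.
HB.instance Definition _ := Measure_isSigmaFinite.Build _ _ R (@lam3 R) p3_sfin.

Local Notation p6 := (@lam3 R \x @lam3 R)%E.
Let p6_0 : p6 set0 = 0%E. Proof. exact: measure0. Qed.
Let p6_ge0 A : (0 <= p6 A)%E. Proof. exact: measure_ge0. Qed.
Let p6_sigma : semi_sigma_additive p6.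
Proof. exact: measure_semi_sigma_additive. Qed.
HB.instance Definition _ := isMeasure.Build _ _ R (@lam6 R) p6_0 p6_ge0 p6_sigma.
Let p6_sfin : sigma_finite setT p6.
Proof. exact: product_measure1_sigma_finite. Qed.
HB.instance Definition _ := Measure_isSigmaFinite.Build _ _ R (@lam6 R) p6_sfin.

End lam_measures.

Lemma filterS4 (T : Type) (F : set_system T) {FF : Filter F}
    (P1 P2 P3 P4 Q : set T) :
  (forall x, P1 x -> P2 x -> P3 x -> P4 x -> Q x) ->
  F P1 -> F P2 -> F P3 -> F P4 -> F Q.
Proof.
move=> PQ F1 F2 F3 F4; apply: filterS2 (filterI F1 F2) (filterI F3 F4) => x.
by move=> [? ?] [? ?]; exact: PQ.
Qed.

#[global] Instance lam6_ae_filter (R : realType) :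
  Filter (nbhs (almost_everywhere (@lam6 R))).
Proof. exact: (ae_filter_ringOfSetsType (@lam6 R)). Qed.

(** * The seminorm on L^1 and almost everywhere equality *)

Section L1_space.
Variable R : realType.
Implicit Types f g h : fn R.
Local Notation mu := (@lam6 R).

Lemma L1_measurable f : L1 f -> measurable_fun setT f.
Proof. by move=> /measurable_int/measurable_EFinP. Qed.

Lemma L1_emeasurable f : L1 f -> measurable_fun setT (fun z => (f z)%:E).
Proof. by move=> /measurable_int. Qed.

Lemma L1P f : measurable_fun setT f -> (\int[mu]_z `|f z|%:E < +oo)%E -> L1 f.
Proof. by move=> mf fy; apply/integrableP; split; [exact/measurable_EFinP|]. Qed.

Lemma L1_lt_pinfty f : L1 f -> (\int[mu]_z `|f z|%:E < +oo)%E.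
Proof. by move=> /integrableP[]. Qed.

Lemma L1D f g : L1 f -> L1 g -> L1 (fun z => f z + g z).
Proof. by move=> f1 g1; exact: (integrableD measurableT f1 g1). Qed.

Lemma L1B f g : L1 f -> L1 g -> L1 (fun z => f z - g z).
Proof. by move=> f1 g1; exact: (integrableB measurableT f1 g1). Qed.

Lemma L1Z (k : R) f : L1 f -> L1 (fun z => k * f z).
Proof. by move=> f1; exact: (integrableZl measurableT k f1). Qed.

Lemma L1_normr f : L1 f -> L1 (fun z => `|f z|).
Proof. by move=> f1; exact: (integrable_norm f1). Qed.

Lemma L1norm_ge0 f : 0 <= L1norm f.
Proof. by apply/fine_ge0/integral_ge0 => z _; rewrite lee_fin. Qed.

Lemma L1norm_EFin f : L1 f -> (L1norm f)%:E = (\int[mu]_z `|f z|%:E)%E.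
Proof.
move=> f1; rewrite fineK// ge0_fin_numE; first exact: L1_lt_pinfty.
by apply: integral_ge0 => z _; rewrite lee_fin.
Qed.

Lemma L1norm_le_ae f g : L1 f -> L1 g -> {ae mu, forall z, `|f z| <= `|g z|} ->
  L1norm f <= L1norm g.
Proof.
move=> f1 g1 fg; rewrite -lee_fin !L1norm_EFin//.
apply: ae_ge0_le_integral => //.
- exact: L1_emeasurable (L1_normr f1).
- exact: L1_emeasurable (L1_normr g1).
- by move: fg; apply: filterS => z fgz _; rewrite lee_fin.
Qed.

Lemma L1norm_aeq f g : L1 f -> L1 g -> aeq f g -> L1norm f = L1norm g.
Proof.
move=> f1 g1 fg; apply/eqP; rewrite eq_le !L1norm_le_ae//;
  by move: fg; apply: filterS => z ->.
Qed.

Lemma L1normD f g : L1 f -> L1 g ->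
  L1norm (fun z => f z + g z) <= L1norm f + L1norm g.
Proof.
move=> f1 g1; rewrite /L1norm -/(Rintegral _ _ _) -[X in _ <= X + _]/(Rintegral _ _ _).
rewrite -[X in _ <= _ + X]/(Rintegral _ _ _) -RintegralD//; last 2 first.
- exact: L1_normr.
- exact: L1_normr.
apply: le_Rintegral => //.
- exact/L1_normr/L1D.
- by apply: L1D; exact: L1_normr.
- by move=> z _; exact: ler_normD.
Qed.

Lemma L1normZ (k : R) f : L1 f -> L1norm (fun z => k * f z) = `|k| * L1norm f.
Proof.
move=> f1; rewrite /L1norm -/(Rintegral _ _ _) -[X in _ = _ * X]/(Rintegral _ _ _).
rewrite -RintegralZl//; last exact: L1_normr.
by apply: eq_Rintegral => z _; rewrite normrM.
Qed.

Lemma L1distC f g : L1dist f g = L1dist g f.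
Proof. by congr fine; apply: eq_integral => z _; rewrite distrC. Qed.

Lemma le_L1norm_Rintegral f : L1 f -> `|\int[mu]_z f z| <= L1norm f.
Proof. by move=> f1; exact: le_normr_Rintegral. Qed.

Lemma L1_Rintegral_EFin f : L1 f -> (\int[mu]_z (f z)%:E)%E = (\int[mu]_z f z)%:E.
Proof. by move=> f1; rewrite /Rintegral fineK//; exact: integrable_fin_num. Qed.

Lemma Rintegral_aeq f g : L1 f -> L1 g -> aeq f g ->
  \int[mu]_z f z = \int[mu]_z g z.
Proof.
move=> f1 g1 fg; congr fine; apply: ae_eq_integral => //.
- exact: L1_emeasurable f1.
- exact: L1_emeasurable g1.
- by move: fg; apply: filterS => z -> _.
Qed.

Lemma L1normDae f g h : L1 f -> L1 g -> L1 h -> aeq h (fun z => f z + g z) ->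
  L1norm h <= L1norm f + L1norm g.
Proof.
move=> f1 g1 h1 hfg; rewrite (L1norm_aeq h1 (L1D f1 g1) hfg); exact: L1normD.
Qed.

End L1_space.

(** * Generators of contraction semigroups, handled by finite subdivision of time *)

Section contraction_semigroups.
Variables (R : realType) (Z : sgroup R).
Hypotheses (ZC0 : C0_semigroup Z) (Zcontr : contraction_sg Z).
Implicit Types f g p : fn R.
Local Notation mu := (@lam6 R).

Lemma sg_L1 t f : 0 <= t -> L1 f -> L1 (Z t f).
Proof. by case: ZC0 => + _ => /[apply]; exact. Qed.

Lemma sg_lin t (a b : R) f g : 0 <= t -> L1 f -> L1 g ->
  aeq (Z t (fun z => a * f z + b * g z)) (fun z => a * Z t f z + b * Z t g z).
Proof. by move: ZC0 => [_ [_ [+ _]]] *; exact. Qed.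

Lemma sg0 f : L1 f -> aeq (Z 0 f) f.
Proof. by move: ZC0 => [_ [_ [_ [_ [+ _]]]]] *; exact. Qed.

Lemma sg_add s t f : 0 <= s -> 0 <= t -> L1 f -> aeq (Z (s + t) f) (Z s (Z t f)).
Proof. by move: ZC0 => [_ [_ [_ [_ [_ [+ _]]]]]] *; exact. Qed.

Lemma sg_cvg f : L1 f -> L1dist (Z t f) f @[t --> 0^'+] --> 0.
Proof. by move: ZC0 => [_ [_ [_ [_ [_ [_ +]]]]]] *; exact. Qed.

Lemma sgB t f g : 0 <= t -> L1 f -> L1 g ->
  aeq (Z t (fun z => f z - g z)) (fun z => Z t f z - Z t g z).
Proof.
move=> t0 f1 g1; have := sg_lin 1 (-1) t0 f1 g1.
rewrite (_ : (fun z => 1 * f z + -1 * g z) = (fun z => f z - g z)); last first.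
  by apply/funext => z; rewrite mul1r mulN1r.
by apply: filterS => z ->; rewrite mul1r mulN1r.
Qed.

Lemma sgZ t k f : 0 <= t -> L1 f ->
  aeq (Z t (fun z => k * f z)) (fun z => k * Z t f z).
Proof.
move=> t0 f1; have := sg_lin k 0 t0 f1 f1.
rewrite (_ : (fun z => k * f z + 0 * f z) = (fun z => k * f z)); last first.
  by apply/funext => z; rewrite mul0r addr0.
by apply: filterS => z ->; rewrite mul0r addr0.
Qed.

Lemma sg_dist t f g : 0 <= t -> L1 f -> L1 g -> L1dist (Z t f) (Z t g) <= L1dist f g.
Proof.
move=> t0 f1 g1.
rewrite -[leLHS]/(L1norm (fun z => Z t f z - Z t g z)).
rewrite -(@L1norm_aeq _ (Z t (fun z => f z - g z))); last exact: sgB.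
- by apply: Zcontr => //; exact: L1B.
- by apply: sg_L1 => //; exact: L1B.
- by apply: L1B; exact: sg_L1.
Qed.

Definition diffq t f : fn R := fun z => (Z t f z - f z) / t.

Lemma L1_diffq t f : 0 <= t -> L1 f -> L1 (diffq t f).
Proof.
move=> t0 f1; rewrite (_ : diffq t f = fun z => t^-1 * (Z t f z - f z)).
  by apply/L1Z/L1B => //; exact: sg_L1.
by apply/funext => z; rewrite /diffq mulrC.
Qed.

Lemma generatorB f1 g1 f2 g2 : generator Z f1 g1 -> generator Z f2 g2 ->
  generator Z (fun z => f1 z - f2 z) (fun z => g1 z - g2 z).
Proof.
move=> [Lf1 [Lg1 fg1]] [Lf2 [Lg2 fg2]]; split; first exact: L1B.
split; first exact: L1B.
have : (L1dist (diffq t f1) g1 + L1dist (diffq t f2) g2) @[t --> 0^'+] --> (0 : R).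
  by rewrite -[X in _ --> X]addr0; exact: cvgD.
apply: (squeeze_cvgr _ (cvg_cst 0)); near=> t.
have t0 : 0 <= t by [].
rewrite L1norm_ge0/= [X in _ <= _ + X]L1distC.
have L1 := L1_diffq t0 Lf1; have L2 := L1_diffq t0 Lf2.
have L3 := L1_diffq t0 (L1B Lf1 Lf2).
apply: L1normDae => //.
- exact: L1B.
- exact: L1B.
- by apply: L1B => //; exact: L1B.
have := sgB t0 Lf1 Lf2; apply: filterS => z; rewrite /diffq => ->; ring.
Unshelve. all: by end_near. Qed.

(** [Z s] and [Z t] commute, so the difference quotient of [Z s f] is [Z s] applied to that of [f],
    and contractivity carries the convergence over. *)
Lemma generator_sg s f g : 0 <= s -> generator Z f g -> generator Z (Z s f) (Z s g).
Proof.
move=> s0 [Lf [Lg fg]]; split; first exact: sg_L1.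
split; first exact: sg_L1.
apply: (squeeze_cvgr _ (cvg_cst 0) fg); near=> t.
have t0 : 0 <= t by [].
rewrite L1norm_ge0/=; apply: le_trans (sg_dist s0 (L1_diffq t0 Lf) Lg).
have L1 := L1_diffq t0 Lf.
apply: L1norm_le_ae.
- by apply: L1B; [exact/L1_diffq/sg_L1|exact: sg_L1].
- by apply: L1B; exact: sg_L1.
have := sg_add t0 s0 Lf; have := sg_add s0 t0 Lf; rewrite addrC.
have := sgZ t^-1 s0 (L1B (sg_L1 t0 Lf) Lf); have := sgB s0 (sg_L1 t0 Lf) Lf.
rewrite (_ : (fun z => t^-1 * (Z t f z - f z)) = diffq t f); last first.
  by apply/funext => z; rewrite /diffq mulrC.
apply: filterS4 => z E1 E2 E3 E4.
by rewrite E2 E1 -E3 E4 [X in _ <= `|X - _|]mulrC.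
Unshelve. all: by end_near. Qed.

(** With q the difference quotient at time t, (l + 1/t) f = (l f - g) + (g - q) + Z(t) f / t. The
    last term has norm at most ||f|| / t, which cancels on both sides, and g - q vanishes as t tends
    to 0. *)
Lemma generator_dissipative (l : R) f g : 0 < l -> generator Z f g ->
  l * L1norm f <= L1norm (fun z => l * f z - g z).
Proof.
move=> l0 [Lf [Lg fg]].
have Ll : L1 (fun z => l * f z - g z) by apply: L1B => //; exact: L1Z.
have : (L1norm (fun z => l * f z - g z) + L1dist (diffq t f) g) @[t --> 0^'+] -->
    L1norm (fun z => l * f z - g z).
  by rewrite -[X in _ --> X]addr0; apply: cvgD => //; exact: cvg_cst.
move=> /cvgr_to_ge; apply; near=> t.
have t0 : 0 < t by [].
have Lq := L1_diffq (ltW t0) Lf; have LZ := sg_L1 (ltW t0) Lf.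
have : L1norm (fun z => (l + t^-1) * f z) <=
    L1norm (fun z => l * f z - g z) + L1dist (diffq t f) g + t^-1 * L1norm (Z t f).
  rewrite L1distC -[t^-1]gtr0_norm ?invr_gt0// -L1normZ//.
  apply: le_trans; last by apply: lerD; [exact: L1normD (L1B Lg Lq)|exact: lexx].
  apply: L1normDae.
  - by apply: L1D => //; exact: L1B.
  - exact: L1Z.
  - exact: L1Z.
  - apply: aeW => z; rewrite /diffq gtr0_norm ?invr_gt0//; ring.
rewrite L1normZ// ger0_norm; last by rewrite addr_ge0// ?invr_ge0 ltW.
have := Zcontr (ltW t0) Lf.
rewrite -(ler_pM2l (_ : 0 < t^-1)) ?invr_gt0// mulrDl => H1 H2; lra.
Unshelve. all: by end_near. Qed.

(** Discrete form of Z(t) f - f = integral of Z(s) g over [0, t]: with D the defect of one step, the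
    left-hand function is the sum over i < k of Z(i h) D + h (Z(i h) g - g). *)
Lemma sg_telescope f g h (M : R) k : 0 <= h -> L1 f -> L1 g ->
  (forall i, (i < k)%N -> L1dist (Z (i%:R * h) g) g <= M) ->
  L1norm (fun z => Z (k%:R * h) f z - f z - k%:R * h * g z) <=
  k%:R * (L1norm (fun z => Z h f z - f z - h * g z) + h * M).
Proof.
move=> h0 Lf Lg; have Lhg := L1Z h Lg; have LZ := sg_L1 h0 Lf.
set D := (fun z => Z h f z - f z - h * g z).
have LD : L1 D by apply: L1B => //; exact: L1B.
elim: k => [_|k IH kM].
  rewrite mul0r [leLHS](@L1norm_aeq _ _ (fun z => 0 * f z)).
  - by rewrite L1normZ// normr0 !mul0r.
  - by apply: L1B; [apply: L1B => //; apply: sg_L1; rewrite ?mul0r|exact: L1Z].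
  - exact: L1Z.
  - by have := sg0 Lf; apply: filterS => z; rewrite mul0r => ->; rewrite subrr !mul0r subr0.
have kh0 : 0 <= k%:R * h by rewrite mulr_ge0.
have LZk := sg_L1 kh0.
have Lk : L1 (fun z => Z (k%:R * h) f z - f z - k%:R * h * g z).
  by apply: L1B; [apply: L1B => //; exact: LZk|exact: L1Z].
have Lg' : L1 (fun z => h * (Z (k%:R * h) g z - g z)) by apply/L1Z/L1B => //; exact: LZk.
have {IH} IH := IH (fun i ik => kM i (ltnW ik)).
have : L1norm (fun z => Z (k.+1%:R * h) f z - f z - k.+1%:R * h * g z) <=
   (L1norm (Z (k%:R * h) D) + L1norm (fun z => Z (k%:R * h) f z - f z - k%:R * h * g z)) +
   L1norm (fun z => h * (Z (k%:R * h) g z - g z)).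
  apply: le_trans; last by apply: lerD; [exact: L1normD (LZk _ LD) Lk|exact: lexx].
  apply: L1normDae => //.
  - by apply: L1D => //; exact: LZk.
  - apply: L1B; [apply: L1B => //|exact: L1Z].
    by apply: sg_L1 => //; rewrite mulr_ge0.
  have := sg_add kh0 h0 Lf; rewrite -[X in aeq (Z (_ + X) _) _]mul1r -mulrDl natr1.
  have := sgB kh0 (L1B LZ Lf) Lhg; have := sgB kh0 LZ Lf; have := sgZ h kh0 Lg.
  apply: filterS4 => z E1 E2 E3 E4.
  by rewrite E3 E2 E1 -E4 -natr1; ring.
rewrite L1normZ; last by apply: L1B => //; exact: LZk.
rewrite ger0_norm// => H; apply: (le_trans H).
have := Zcontr kh0 LD; have := ler_wpM2l h0 (kM k (ltnSn k)).
rewrite -natr1 mulrDl mul1r -[X in X <= _ -> _]/(h * L1norm _); lra.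
Qed.

Lemma cvg_at_right0P (F : R -> R) : F h @[h --> 0^'+] --> 0 ->
  forall e : R, 0 < e -> exists2 d, 0 < d & forall h, 0 < h < d -> `|F h| < e.
Proof.
move=> /cvgr0Pnorm_lt F0 e e0; have /nbhs_ballP[d d0 dF] := F0 _ e0.
exists d => // h /andP[h0 hd]; apply: dF => //.
by rewrite /ball/= sub0r normrN gtr0_norm.
Qed.

Lemma subdivide (t d : R) : 0 < t -> 0 < d ->
  exists k, (0 < k)%N /\ 0 < t / k%:R < d.
Proof.
move=> t0 d0; exists (Num.bound (t / d)).+1; split=> //.
rewrite divr_gt0//= ltr_pdivrMr// mulrC -ltr_pdivrMr//.
apply: (lt_le_trans (archi_boundP _)); first by rewrite divr_ge0// ltW.
by rewrite ler_nat.
Qed.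

Lemma L1dist_diffq t f g : 0 < t -> L1 f -> L1 g ->
  L1norm (fun z => Z t f z - f z - t * g z) = t * L1dist (diffq t f) g.
Proof.
move=> t0 Lf Lg; rewrite -[X in _ = X * _](gtr0_norm t0) -L1normZ.
  congr L1norm; apply/funext => z; rewrite /diffq mulrBr; congr (_ - _).
  by rewrite mulrC divfK// gt_eqF.
by apply: L1B => //; exact/L1_diffq/Lf/ltW.
Qed.

(** A mean value inequality: subdividing [0, t] finely makes the one-step defects negligible, and
    only the oscillation of [g] along the semigroup remains. The bound does not involve [f], so it
    is uniform along an approximating sequence. *)
Lemma diffq_le t f g (M : R) : 0 < t -> generator Z f g ->
  (forall s, 0 <= s < t -> L1dist (Z s g) g <= M) -> L1dist (diffq t f) g <= M.
Proof.
move=> t0 [Lf [Lg /cvg_at_right0P fg]] gM; apply/ler_addgt0Pr => e e0.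
have [d d0 dfg] := fg _ e0; have [k [k0 htd]] := subdivide t0 d0.
set h := t / k%:R in htd; have h0 : 0 < h by case/andP: htd.
have kh : k%:R * h = t by rewrite /h mulrC divfK// pnatr_eq0 -lt0n.
have := sg_telescope (M := M) (k := k) (ltW h0) Lf Lg.
rewrite kh L1dist_diffq// L1dist_diffq// => /(_ _)/wrap[].
  move=> i ik; apply: gM; rewrite mulr_ge0 ?ler0n ?(ltW h0)//=.
  by rewrite -kh ltr_pM2r// ltr_nat.
rewrite -mulrDr mulrA kh ler_pM2l// => /le_trans; apply.
have := dfg h htd; rewrite ger0_norm; last exact: L1norm_ge0.
by rewrite -/(diffq h f) addrC => /ltW; rewrite lerD2l.
Qed.

(** At fixed [t] the bound of [diffq_le] for [fs n] passes to the limit in [n]; the time below which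
    it is small depends on [g] only. *)
Lemma generator_closed (fs gs : nat -> fn R) f g :
  (forall n, generator Z (fs n) (gs n)) -> L1 f -> L1 g ->
  L1dist (fs n) f @[n --> \oo] --> 0 -> L1dist (gs n) g @[n --> \oo] --> 0 ->
  generator Z f g.
Proof.
move=> fgs Lf Lg fsf gsg; split=> //; split=> //.
apply/cvgr0Pnorm_le => e e0.
(* Strong continuity is invoked at the limit [g] alone; contractivity moves the estimate to [gs n]
   at the cost of twice their distance. *)
have [d d0 dg] := cvg_at_right0P (sg_cvg Lg) e0.
apply/nbhs_ballP; exists d => //= t; rewrite /ball/= sub0r normrN => td t0.
rewrite gtr0_norm// in td.
rewrite ger0_norm; last exact: L1norm_ge0.
rewrite -/(diffq t f).
have gM n s : 0 <= s < t -> L1dist (Z s (gs n)) (gs n) <= e + 2 * L1dist (gs n) g.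
  move=> /andP[s0 st]; have Lgn := (fgs n).2.1.
  have H1 : L1dist (Z s g) g <= e.
    move: s0; rewrite le_eqVlt => /predU1P[<-|s0].
      rewrite -[leLHS]/(L1norm (fun z => Z 0 g z - g z)).
      rewrite (@L1norm_aeq _ _ (fun z => 0 * g z)).
      - by rewrite L1normZ// normr0 mul0r ltW.
      - by apply: L1B => //; exact: sg_L1.
      - exact: L1Z.
      - by apply: filterS (sg0 Lg) => z ->; rewrite subrr mul0r.
    have := dg s; rewrite s0 (lt_trans st td) => /(_ isT).
    by rewrite ger0_norm ?L1norm_ge0// => /ltW.
  have H2 := sg_dist s0 Lgn Lg.
  have LZg := sg_L1 s0 Lg; have LZgn := sg_L1 s0 Lgn.
  have : L1dist (Z s (gs n)) (gs n) <=
      L1dist (Z s (gs n)) (Z s g) + L1dist (Z s g) g + L1dist g (gs n).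
    apply: (le_trans (@L1normDae _ (fun z => Z s (gs n) z - g z)
      (fun z => g z - gs n z) _ _ _ _ _)); [exact: L1B..| |].
      by apply: aeW => z; ring.
    rewrite lerD2r; apply: L1normDae; [exact: L1B..|].
    by apply: aeW => z; ring.
  rewrite (L1distC g); lra.
have key n : L1dist (diffq t f) g <=
    2 / t * L1dist (fs n) f + e + 3 * L1dist (gs n) g.
  have [Lfn [Lgn _]] := fgs n.
  have Lq := L1_diffq (ltW t0) Lf; have Lqn := L1_diffq (ltW t0) Lfn.
  have H1 := diffq_le t0 (fgs n) (gM n).
  have LZf := sg_L1 (ltW t0) Lf; have LZfn := sg_L1 (ltW t0) Lfn.
  (* The factor [2 / t] is harmless, since [t] stays fixed while [n] tends to infinity. *)
  have H2 : L1dist (diffq t f) (diffq t (fs n)) <= 2 / t * L1dist (fs n) f.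
    have := sg_dist (ltW t0) Lfn Lf => H.
    have : L1norm (fun z => t^-1 * ((Z t f z - Z t (fs n) z) + (fs n z - f z))) <=
        t^-1 * (L1dist (Z t f) (Z t (fs n)) + L1dist (fs n) f).
      rewrite L1normZ; last by apply: L1D; exact: L1B.
      rewrite gtr0_norm ?invr_gt0// ler_pM2l ?invr_gt0//.
      by apply: L1normD; exact: L1B.
    have -> : L1dist (diffq t f) (diffq t (fs n)) =
        L1norm (fun z => t^-1 * ((Z t f z - Z t (fs n) z) + (fs n z - f z))).
      by congr L1norm; apply/funext => z; rewrite /diffq; ring.
    move=> /le_trans; apply; rewrite (mulrC 2) -mulrA ler_pM2l ?invr_gt0//.
    rewrite (L1distC (Z t f)); lra.
  have : L1dist (diffq t f) g <= L1dist (diffq t f) (diffq t (fs n)) +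
      L1dist (diffq t (fs n)) (gs n) + L1dist (gs n) g.
    apply: (le_trans (@L1normDae _ (fun z => diffq t f z - gs n z)
      (fun z => gs n z - g z) _ _ _ _ _)); [exact: L1B..| |].
      by apply: aeW => z; ring.
    rewrite lerD2r; apply: L1normDae; [exact: L1B..|].
    by apply: aeW => z; ring.
  lra.
have : (2 / t * L1dist (fs n) f + e + 3 * L1dist (gs n) g) @[n --> \oo] -->
    2 / t * 0 + e + 3 * 0.
  apply: cvgD; last exact: cvgMr.
  by apply: cvgD; [exact: cvgMr|exact: cvg_cst].
rewrite !mulr0 add0r addr0.
by move=> /cvgr_to_ge; apply; apply: nearW.
Qed.

(** Infinitesimal conservation of mass; [Rintegral_generator] provides it once dense range is
    available. *)
Hypothesis Rintegral_image0 :
  forall f g, generator Z f g -> \int[mu]_z g z = 0.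

(** Over one step of length h the mass changes only by the defect, because Z(i h) g is again an
    image of the generator and has integral 0. The k = t / h defects add up to at most t times the
    distance from the difference quotient at h to [g]. *)
Lemma generator_Rintegral_sg t f g : 0 <= t -> generator Z f g ->
  \int[mu]_z Z t f z = \int[mu]_z f z.
Proof.
move=> t0 fgZ; have [Lf [Lg /cvg_at_right0P fg]] := fgZ.
move: t0; rewrite le_eqVlt => /predU1P[<-|t0].
  by apply: Rintegral_aeq => //; [exact: sg_L1|exact: sg0].
apply/eqP; rewrite -subr_eq0 -normr_eq0 eq_le normr_ge0 andbT.
apply/ler_addgt0Pr => e e0; rewrite add0r.
have et0 : 0 < e / t by rewrite divr_gt0.
have [d d0 dfg] := fg _ et0; have [k [k0 htd]] := subdivide t0 d0.
set h := t / k%:R in htd; have h0 : 0 < h by case/andP: htd.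
have kh : k%:R * h = t by rewrite /h mulrC divfK// pnatr_eq0 -lt0n.
have H i : `|\int[mu]_z Z (i%:R * h) f z - \int[mu]_z f z| <=
    i%:R * (h * L1dist (diffq h f) g).
  rewrite -L1dist_diffq//.
  elim: i => [|i IH].
    rewrite !mul0r (Rintegral_aeq (sg_L1 _ Lf) Lf (sg0 Lf))//.
    by rewrite subrr normr0.
  have ih0 : 0 <= i%:R * h by rewrite mulr_ge0// ltW.
  have Lhg := L1Z h Lg; have LZ := sg_L1 (ltW h0) Lf.
  set D := (fun z => Z h f z - f z - h * g z) in IH *.
  have LD : L1 D by apply: L1B => //; exact: L1B.
  have LZi p : L1 p -> L1 (Z (i%:R * h) p) by exact: sg_L1.
  have -> : \int[mu]_z Z (i.+1%:R * h) f z =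
      \int[mu]_z (Z (i%:R * h) D z + Z (i%:R * h) f z + h * Z (i%:R * h) g z).
    apply: Rintegral_aeq.
    - by apply: sg_L1 => //; rewrite mulr_ge0// ltW.
    - by apply: L1D; [apply: L1D; exact: LZi|exact/L1Z/LZi].
    have := sg_add ih0 (ltW h0) Lf; rewrite -[X in aeq (Z (_ + X) _) _]mul1r -mulrDl natr1.
    have := sgB ih0 (L1B LZ Lf) Lhg; have := sgB ih0 LZ Lf; have := sgZ h ih0 Lg.
    apply: filterS4 => z E1 E2 E3 E4.
    by rewrite E3 E2 E1 -E4; ring.
  rewrite RintegralD//; [|by apply: L1D; exact: LZi|exact/L1Z/LZi].
  rewrite RintegralD//; [|exact: LZi..].
  rewrite RintegralZl//; last exact: LZi.
  rewrite (Rintegral_image0 (generator_sg ih0 fgZ)) mulr0 addr0.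
  rewrite -addrA -natr1 mulrDl mul1r addrC.
  apply: (le_trans (ler_normD _ _)); apply: lerD; first exact: IH.
  apply: (le_trans (le_L1norm_Rintegral (LZi _ LD))).
  by apply: Zcontr.
have := H k; rewrite kh mulrA kh => /le_trans; apply.
have := dfg h htd; rewrite ger0_norm ?L1norm_ge0// -/(diffq h f).
by rewrite ltr_pdivlMr// mulrC => /ltW.
Qed.

Lemma generator_Rintegral_sg_image t f g : 0 <= t -> generator Z f g ->
  \int[mu]_z Z t g z = 0.
Proof. by move=> t0 fg; apply: Rintegral_image0 (generator_sg t0 fg). Qed.

End contraction_semigroups.

(** * Consequences of dense range: the closure and honesty *)

Section dense_range.
Variables (R : realType) (Z : sgroup R).
Hypotheses (ZC0 : C0_semigroup Z) (Zcontr : contraction_sg Z).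
Variables (Op : fn R -> fn R -> Prop) (l : R).
Hypotheses (l0 : 0 < l) (Zext : gen_extends Z Op).
Local Notation mu := (@lam6 R).
Hypothesis dense_range : forall p, L1 p -> forall e : R, 0 < e ->
  exists u g, [/\ Op u g, \int[mu]_z g z = 0 &
    L1norm (fun z => l * u z - g z - p z) < e].

(** Dense range is applied to l f - g; dissipativity of the generator at u - f brings u close to f,
    and the residual then brings h close to g. *)
Lemma generator_approx f g : generator Z f g -> forall e : R, 0 < e ->
  exists u h, [/\ Op u h, \int[mu]_z h z = 0, L1dist u f < e & L1dist h g < e].
Proof.
move=> fg e e0; have [Lf [Lg _]] := fg.
(* The bound [l * e] absorbs the factor [l] of dissipativity; [e / 2] serves because h - g is l (u -
   f) minus the residual, each of norm below [d]. *)
pose d := Num.min (l * e) (e / 2).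
have d0 : 0 < d by rewrite lt_min mulr_gt0//= divr_gt0.
have Lp : L1 (fun z => l * f z - g z) by apply: L1B => //; exact: L1Z.
have [u [h [uh h0 dist_d]]] := dense_range Lp d0; exists u, h.
have uhZ := Zext uh; have [Lu [Lh _]] := uhZ.
have Llu := L1Z l Lu; have Llf := L1Z l Lf.
have := generator_dissipative ZC0 Zcontr l0 (generatorB ZC0 uhZ fg).
set N1 := L1norm (fun z => l * (u z - f z) - _).
have -> : N1 = L1norm (fun z => l * u z - h z - (l * f z - g z)).
  by congr L1norm; apply/funext => z; ring.
rewrite -/(L1dist u f) => H.
have {}H := le_lt_trans H dist_d.
have H1 : L1dist u f < e.
  by move: H; rewrite lt_min (ltr_pM2l l0) => /andP[].
split=> //.
have : L1dist h g <= L1norm (fun z => l * (u z - f z)) +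
    L1norm (fun z => -1 * (l * u z - h z - (l * f z - g z))).
  apply: L1normDae.
  - by apply: L1Z; exact: L1B.
  - by apply: L1Z; apply: L1B => //; exact: L1B.
  - exact: L1B.
  - by apply: aeW => z; ring.
rewrite L1normZ; last exact: L1B.
rewrite L1normZ; last by apply: L1B => //; exact: L1B.
rewrite normrN1 mul1r gtr0_norm// -/(L1dist u f).
have : d <= e / 2 by rewrite ge_min lexx orbT.
move: H dist_d; lra.
Qed.

Lemma generator_closure f g : generator Z f g ->
  exists fs gs : nat -> fn R, (forall n, Op (fs n) (gs n)) /\
    (L1dist (fs n) f @[n --> \oo] --> 0) /\ (L1dist (gs n) g @[n --> \oo] --> 0).
Proof.
move=> fg.
have /choice[F FP] : forall n : nat, exists u : fn R * fn R,
    [/\ Op u.1 u.2, L1dist u.1 f <= n.+1%:R^-1 & L1dist u.2 g <= n.+1%:R^-1].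
  move=> n; have := generator_approx fg (e := n.+1%:R^-1).
  by move=> /(_ (ltac:(by rewrite invr_gt0)))[u [h [? _ /ltW ? /ltW ?]]]; exists (u, h).
exists (fun n => (F n).1), (fun n => (F n).2); split; first by move=> n; case: (FP n).
by split; apply: (squeeze_cvgr _ (cvg_cst 0) cvg_harmonic); apply: nearW => n;
  rewrite L1norm_ge0/=; case: (FP n).
Qed.

Lemma Rintegral_generator f g : generator Z f g -> \int[mu]_z g z = 0.
Proof.
move=> fg; have [_ [Lg _]] := fg.
apply/eqP; rewrite -normr_eq0 eq_le normr_ge0 andbT.
apply/ler_addgt0Pr => e e0; rewrite add0r.
have [u [h [uh h0 _ hg]]] := generator_approx fg e0.
have [_ [Lh _]] := Zext uh.
rewrite -[X in `|X|]subr0 -h0 -RintegralB//.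
apply: (le_trans (le_L1norm_Rintegral (L1B Lg Lh))).
by rewrite -[leLHS]/(L1dist g h) L1distC ltW.
Qed.

(** For q = l u - g the mass is preserved: that of [u] is, and both [g] and [Z t g] have mass 0.
    Such q are dense, and [Z t] is a contraction. *)
Lemma honest t p : 0 <= t -> L1 p -> \int[mu]_z Z t p z = \int[mu]_z p z.
Proof.
move=> t0 Lp; apply/eqP; rewrite -subr_eq0 -normr_eq0 eq_le normr_ge0 andbT.
apply/ler_addgt0Pr => e e0; rewrite add0r.
have e20 : 0 < e / 2 by rewrite divr_gt0.
have [u [g [ug g0 dist_e]]] := dense_range Lp e20.
have ugZ := Zext ug; have [Lu [Lg _]] := ugZ.
have Llu := L1Z l Lu.
set q := fun z => l * u z - g z.
have Lq : L1 q by exact: L1B.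
have int_q : \int[mu]_z Z t q z = \int[mu]_z q z.
  transitivity (\int[mu]_z (l * Z t u z - Z t g z)).
    apply: Rintegral_aeq; first exact: sg_L1.
      by apply: L1B; [apply/L1Z|]; exact: sg_L1.
    have := sgB ZC0 t0 Llu Lg; have := sgZ ZC0 l t0 Lu.
    by apply: filterS2 => z -> ->.
  rewrite RintegralB//; [|exact/L1Z/sg_L1|exact: sg_L1].
  rewrite RintegralZl//; last exact: sg_L1.
  rewrite (generator_Rintegral_sg_image ZC0 Zcontr Rintegral_generator t0 ugZ).
  rewrite (generator_Rintegral_sg ZC0 Zcontr Rintegral_generator t0 ugZ).
  by rewrite RintegralB// RintegralZl// g0.
have LZp := sg_L1 ZC0 t0 Lp; have LZq := sg_L1 ZC0 t0 Lq.
have -> : \int[mu]_z Z t p z - \int[mu]_z p z =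
    \int[mu]_z (Z t p z - Z t q z) + \int[mu]_z (q z - p z).
  have -> : \int[mu]_z (q z - p z) = \int[mu]_z q z - \int[mu]_z p z.
    exact: (RintegralB measurableT Lq Lp).
  by rewrite (RintegralB measurableT LZp LZq) int_q addrA subrK.
apply: (le_trans (ler_normD _ _)).
have H1 : `|\int[mu]_z (Z t p z - Z t q z)| <= L1dist (Z t p) (Z t q).
  exact: le_L1norm_Rintegral (L1B LZp LZq).
have H2 : `|\int[mu]_z (q z - p z)| <= L1dist q p.
  exact: le_L1norm_Rintegral (L1B Lq Lp).
have H3 := sg_dist ZC0 Zcontr t0 Lp Lq; rewrite (L1distC p) in H3.
have H4 : L1dist q p < e / 2 by [].
move: H1 H2 H3 H4; lra.
Qed.

End dense_range.

(** * Vector operations: measurability and elementary algebra *)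

Section vector_measurability.
Variable R : realType.
Context d (T : measurableType d).
Implicit Types f g : T -> vec R.

Lemma measurable_vec (a b c : T -> R) : measurable_fun setT a ->
  measurable_fun setT b -> measurable_fun setT c ->
  measurable_fun setT (fun x => (a x, b x, c x)).
Proof. by move=> ma mb mc; do 2 apply: measurable_fun_pair => //. Qed.

Lemma measurable_coord1 f : measurable_fun setT f ->
  measurable_fun setT (fun x => (f x).1.1).
Proof. by move=> mf; do 2 apply: measurableT_comp => //. Qed.

Lemma measurable_coord2 f : measurable_fun setT f ->
  measurable_fun setT (fun x => (f x).1.2).
Proof. by move=> mf; do 2 apply: measurableT_comp => //. Qed.

Lemma measurable_coord3 f : measurable_fun setT f ->
  measurable_fun setT (fun x => (f x).2).
Proof. by move=> mf; apply: measurableT_comp => //. Qed.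

Lemma measurable_vadd f g : measurable_fun setT f -> measurable_fun setT g ->
  measurable_fun setT (fun x => vadd (f x) (g x)).
Proof.
move=> mf mg; apply: measurable_vec; apply: measurable_funD.
- exact: measurable_coord1.
- exact: measurable_coord1.
- exact: measurable_coord2.
- exact: measurable_coord2.
- exact: measurable_coord3.
- exact: measurable_coord3.
Qed.

Lemma measurable_vscale (s : T -> R) f : measurable_fun setT s ->
  measurable_fun setT f -> measurable_fun setT (fun x => vscale (s x) (f x)).
Proof.
move=> ms mf; apply: measurable_vec; apply: measurable_funM => //.
- exact: measurable_coord1.
- exact: measurable_coord2.
- exact: measurable_coord3.
Qed.

Lemma measurable_vsub f g : measurable_fun setT f -> measurable_fun setT g ->
  measurable_fun setT (fun x => vsub (f x) (g x)).
Proof.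
by move=> mf mg; apply: measurable_vadd => //; apply: measurable_vscale.
Qed.

Lemma measurable_dot f g : measurable_fun setT f -> measurable_fun setT g ->
  measurable_fun setT (fun x => dot (f x) (g x)).
Proof.
move=> mf mg; apply: measurable_funD; first apply: measurable_funD;
  apply: measurable_funM.
- exact: measurable_coord1.
- exact: measurable_coord1.
- exact: measurable_coord2.
- exact: measurable_coord2.
- exact: measurable_coord3.
- exact: measurable_coord3.
Qed.

End vector_measurability.

Section vector_algebra.
Variable R : realType.
Implicit Types u v w n : vec R.

Lemma dot_ge0 v : 0 <= dot v v.
Proof. by rewrite /dot -!expr2 !addr_ge0 ?sqr_ge0. Qed.

Lemma sqr_vnorm v : vnorm v ^+ 2 = dot v v.
Proof. by rewrite sqr_sqrtr ?dot_ge0. Qed.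

Lemma vnorm_ge0 v : 0 <= vnorm v.
Proof. exact: sqrtr_ge0. Qed.

Lemma dot_unitv v : 0 < vnorm v -> dot (unitv v) (unitv v) = 1.
Proof.
move=> v0; have : vnorm v ^+ 2 / vnorm v ^+ 2 = 1 by rewrite divff// expf_neq0 ?gt_eqF.
rewrite {1}sqr_vnorm /unitv; case: v v0 => [[a b] c] v0 <-; rewrite /dot/=.
by field; rewrite gt_eqF.
Qed.

Lemma CauchySchwarz_dot u v : dot u v ^+ 2 <= dot u u * dot v v.
Proof.
case: u => [[a b] c]; case: v => [[x y] z]; rewrite /dot/= -subr_ge0.
have -> : (a * a + b * b + c * c) * (x * x + y * y + z * z) -
    (a * x + b * y + c * z) ^+ 2 =
    (a * y - b * x) ^+ 2 + (a * z - c * x) ^+ 2 + (b * z - c * y) ^+ 2 by ring.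
by rewrite !addr_ge0 ?sqr_ge0.
Qed.

End vector_algebra.

Ltac vec_eq := rewrite /vstar /wstar /vsub /vadd /vscale /dot/=;
  repeat match goal with v : vec _ |- context [?w] =>
    constr_eq v w; case: v => [[? ?] ?] /= end.

Section measurable_unit_vectors.
Variable R : realType.
Context d (T : measurableType d).

Lemma measurable_vnorm (f : T -> vec R) : measurable_fun setT f ->
  measurable_fun setT (fun x => vnorm (f x)).
Proof.
(* Square roots, and inverses further on, are written as real powers, which are measurable on the
   whole line. *)
move=> mf; rewrite (_ : (fun _ => _) = fun x => dot (f x) (f x) `^ 2^-1).
  apply: (measurableT_comp (measurable_powR _)).
  exact: (measurable_dot mf mf).
by apply/funext => x; rewrite powR12_sqrt// dot_ge0.
Qed.

Lemma measurable_unitv (f : T -> vec R) : measurable_fun setT f ->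
  measurable_fun setT (fun x => unitv (f x)).
Proof.
move=> mf; apply: measurable_vscale => //.
rewrite (_ : (fun _ => _) = fun x => vnorm (f x) `^ (-1)).
  apply: (measurableT_comp (measurable_powR _)); exact: measurable_vnorm.
by apply/funext => x; rewrite powR_inv1// vnorm_ge0.
Qed.

End measurable_unit_vectors.

Lemma measurable_fun_integral d d' (T : measurableType d) (T' : measurableType d')
    (R : realType) (m : {sigma_finite_measure set T' -> \bar R})
    (f : T -> T' -> \bar R) :
  measurable_fun setT (fun p : T * T' => f p.1 p.2) ->
  (forall x y, 0 <= f x y)%E -> measurable_fun setT (fun x => \int[m]_y f x y)%E.
Proof.
move=> mf f0.
exact: (measurable_fun_fubini_tonelli_F (fun p : T * T' => f p.1 p.2)).
Qed.

(** Syntax-directed measurability: each clause removes one head symbol, and measurable functions in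
    the context are the leaves. Integrals leave the nonnegativity of their integrand as a side
    goal. *)
Ltac mfun1 := cbv beta; lazymatch goal with
  | |- measurable_fun _ (fun x => x) => exact: measurable_id
  | |- measurable_fun _ (fun x => integral _ _ (@?f x)) =>
      apply: (@measurable_fun_integral _ _ _ _ _ _ f)
  | |- measurable_fun _ (fun x => (@?f x, @?g x)) =>
      apply: (measurable_fun_pair (f := f) (g := g))
  | |- measurable_fun _ (fun x => fst (@?f x)) =>
      apply: (measurableT_comp measurable_fst (g := f))
  | |- measurable_fun _ (fun x => snd (@?f x)) =>
      apply: (measurableT_comp measurable_snd (g := f))
  | |- measurable_fun _ (fun x => EFin (@?f x)) =>
      apply/(measurable_EFinP setT f)
  | |- measurable_fun _ (fun x => vadd (@?f x) (@?g x)) =>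
      apply: (measurable_vadd (f := f) (g := g))
  | |- measurable_fun _ (fun x => vsub (@?f x) (@?g x)) =>
      apply: (measurable_vsub (f := f) (g := g))
  | |- measurable_fun _ (fun x => vscale (@?f x) (@?g x)) =>
      apply: (measurable_vscale (s := f) (f := g))
  | |- measurable_fun _ (fun x => dot (@?f x) (@?g x)) =>
      apply: (measurable_dot (f := f) (g := g))
  | |- measurable_fun _ (fun x => unitv (@?f x)) =>
      apply: (measurable_unitv (f := f))
  | |- measurable_fun _ (fun x => vnorm (@?f x)) =>
      apply: (measurable_vnorm (f := f))
  | |- measurable_fun _ (fun x => vstar _ _ _ (@?f x) (@?g x) (@?h x)) => rewrite /vstar
  | |- measurable_fun _ (fun x => wstar _ _ _ (@?f x) (@?g x) (@?h x)) => rewrite /wstar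
  | |- measurable_fun _ (fun x => Num.norm (@?f x)) =>
      apply: (measurableT_comp (@normr_measurable _ setT) (g := f))
  | |- measurable_fun _ (fun x => expR (@?f x)) =>
      apply: (measurableT_comp (@measurable_expR _) (g := f))
  | |- measurable_fun _ (fun x => (@?f x) ^+ ?k) =>
      apply: (measurable_funX k (f := f))
  | |- measurable_fun _ (fun x => (@?f x + @?g x)%R) =>
      apply: (measurable_funD (f := f) (g := g))
  | |- measurable_fun _ (fun x => (@?f x * @?g x)%R) =>
      apply: (measurable_funM (f := f) (g := g))
  | |- measurable_fun _ (fun x => (- @?f x)%R) => apply: (measurable_funN (f := f))
  | H : measurable_fun setT ?F |- measurable_fun _ ?F => exact: H
  | H : measurable_fun setT ?F |- measurable_fun _ (fun x => ?F (@?g x)) =>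
      apply: (measurableT_comp H (g := g))
  | _ => exact: measurable_cst
  end.

Ltac mfun := rewrite /comp; repeat (mfun1 => /=).

(** * Affine changes of variables on the line and in R^3 *)

Section scaled_pushforward.
Context d d' (T1 : measurableType d) (T2 : measurableType d') (R : realType).

(** The measure structure depends on the measurability proof; the existential hides this behind a
    plain measure and an equation. *)
Lemma pushforward_measure (m : {measure set T1 -> \bar R}) (f : T1 -> T2) :
  measurable_fun setT f ->
  exists m' : {measure set T2 -> \bar R}, forall A, m' A = pushforward m f A.
Proof. by move=> mf; eexists => A; reflexivity.
Unshelve. exact: mf. Qed.

Lemma mscale_measure (m : {measure set T1 -> \bar R}) (k : {nonneg R}) :
  exists m' : {measure set T1 -> \bar R}, forall A, m' A = mscale k m A.
Proof. by eexists => A; reflexivity. Qed.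

End scaled_pushforward.

Section lebesgue_affine.
Variable R : realType.
Local Notation leb := (@lebesgue_measure R).
Local Notation mR := (measurableTypeR R).
Local Open Scope ereal_scope.
Implicit Types g : R -> \bar R.

(** The scaled pushforward gives half-open intervals their length, and this determines Lebesgue
    measure. *)
Lemma lebesgue_measure_affine (k d : R) (A : set R) : (0 < k)%R -> measurable A ->
  leb A = k%:E * leb ((fun x : R => k * x + d)%R @^-1` A).
Proof.
move=> k0 mA.
have mphi : measurable_fun (T := mR) (U := mR) setT (fun x => k * x + d)%R.
  by apply: measurable_funD => //; exact: measurable_funM.
have [m mE] := pushforward_measure leb mphi.
have [m' m'E] := mscale_measure m (NngNum (ltW k0)).
suff -> : leb A = m' A by rewrite m'E /mscale mE.
apply: lebesgue_measure_unique => // _ [[a b]] _ <-.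
rewrite m'E /mscale mE /pushforward/=.
rewrite [X in _ * leb X](_ : _ = `](a - d) / k, (b - d) / k]%classic)%R; last first.
  apply/seteqP; split => x /=; rewrite !in_itv/= ltr_pdivrMr// ler_pdivlMr//;
  by rewrite ltrBlDr lerBrDr (mulrC x).
rewrite !lebesgue_measure_itv/= !lte_fin ltr_pM2r ?invr_gt0// ltrD2r.
case: ifPn => _; last by rewrite mule0.
rewrite -!EFinB -EFinM; congr EFin; field; lra.
Qed.

Lemma integral_affine_pos (k d : R) g : (0 < k)%R -> measurable_fun setT g ->
  (forall x, 0 <= g x) -> \int[leb]_x g (k * x + d)%R = k^-1%:E * \int[leb]_x g x.
Proof.
move=> k0 mg g0.
have mphi : measurable_fun (T := mR) (U := mR) setT (fun x => k * x + d)%R.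
  by apply: measurable_funD => //; exact: measurable_funM.
have [m mE] := pushforward_measure leb mphi.
have [m' m'E] := mscale_measure m (NngNum (ltW k0)).
have -> : \int[leb]_x g (k * x + d)%R = \int[m]_x g x.
  rewrite -[LHS](@ge0_integral_pushforward _ _ _ _ _ _ mphi leb setT g)//.
  by apply: eq_measure_integral => A mA _; rewrite mE.
have <- : \int[mscale (NngNum (ltW k0)) m]_x g x = \int[leb]_x g x.
  apply: eq_measure_integral => A mA _.
  transitivity (k%:E * m A); first by [].
  by rewrite mE; apply/esym; exact: lebesgue_measure_affine.
by rewrite ge0_integral_mscale//= muleA -EFinM mulVf ?gt_eqF// mul1e.
Qed.

Lemma integral_opp g : measurable_fun setT g -> (forall x, 0 <= g x) ->
  \int[leb]_x g (- x)%R = \int[leb]_x g x.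
Proof.
move=> mg g0.
have mphi : measurable_fun (T := mR) (U := mR) setT (fun x => - x)%R.
  by apply: measurable_funN => //.
rewrite -[LHS](@ge0_integral_pushforward _ _ _ _ _ _ mphi leb setT g)//.
by apply: eq_measure_integral => A mA _; exact: lebesgue_measureN.
Qed.

Lemma integral_affine (k d : R) g : (k != 0)%R -> measurable_fun setT g ->
  (forall x, 0 <= g x) ->
  \int[leb]_x g (k * x + d)%R = (`|k|^-1)%:E * \int[leb]_x g x.
Proof.
move=> kn0 mg g0; have [k0|k0] := ltP 0%R k.
  by rewrite gtr0_norm//; exact: integral_affine_pos.
have {kn0}k0 : (k < 0)%R by rewrite lt_neqAle kn0.
rewrite ltr0_norm// -(integral_affine_pos d (k := - k) _ mg g0) ?oppr_gt0//.
rewrite -[RHS]integral_opp//.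
- by apply: eq_integral => x _; rewrite mulrNN.
- apply: measurableT_comp => //.
  by apply: measurable_funD => //; exact: measurable_funM.
Qed.

Lemma integral_shift (d : R) g : measurable_fun setT g -> (forall x, 0 <= g x) ->
  \int[leb]_x g (x + d)%R = \int[leb]_x g x.
Proof.
move=> mg g0; have := @integral_affine 1 d g (oner_neq0 _) mg g0.
by rewrite normr1 invr1 mul1e => <-; apply: eq_integral => x _; rewrite mul1r.
Qed.

End lebesgue_affine.

Section lam3_change_of_variables.
Variable R : realType.
Local Notation leb := (@lebesgue_measure R).
Local Notation mu3 := (@lam3 R).
Local Open Scope ereal_scope.
Implicit Types (g : vec R -> \bar R) (n : vec R).

Lemma lam3_tonelli g : measurable_fun setT g -> (forall v, 0 <= g v) ->
  \int[mu3]_v g v = \int[leb]_x \int[leb]_y \int[leb]_z g (x, y, z).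
Proof.
move=> mg g0; rewrite (fubini_tonelli1 (m1 := @lam2 R))// fubini_tonelli1//.
- exact: measurable_fun_fubini_tonelli_F.
- by move=> z; apply: integral_ge0.
Qed.

Lemma lam3_tonelli_rev g : measurable_fun setT g -> (forall v, 0 <= g v) ->
  \int[mu3]_v g v = \int[leb]_z \int[leb]_y \int[leb]_x g (x, y, z).
Proof.
move=> mg g0; rewrite (fubini_tonelli2 (m1 := @lam2 R))//.
apply: eq_integral => z _; rewrite /fubini_G /lam2 fubini_tonelli2//.
by apply: measurableT_comp => //; mfun.
Qed.

Lemma lam3_shift g (a : vec R) : measurable_fun setT g -> (forall v, 0 <= g v) ->
  \int[mu3]_v g (vadd v a) = \int[mu3]_v g v.
Proof.
move=> mg g0.
have mga : measurable_fun setT (fun v => g (vadd v a)) by mfun.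
rewrite (lam3_tonelli mga (fun=> g0 _)) (lam3_tonelli mg g0) /vadd/=.
transitivity (\int[leb]_x \int[leb]_y \int[leb]_z g (x + a.1.1, y + a.1.2, z)%R).
  apply: eq_integral => x _; apply: eq_integral => y _.
  rewrite (integral_shift a.2 (g := fun z => g (x + a.1.1, y + a.1.2, z)%R))//.
  by mfun.
transitivity (\int[leb]_x \int[leb]_y \int[leb]_z g (x + a.1.1, y, z)%R).
  apply: eq_integral => x _.
  rewrite (integral_shift a.1.2
    (g := fun y => \int[leb]_z g (x + a.1.1, y, z)%R))//.
    by mfun.
  by move=> y; apply: integral_ge0.
rewrite (integral_shift a.1.1
  (g := fun x => \int[leb]_y \int[leb]_z g (x, y, z)))//.
- by mfun => // x y; apply: integral_ge0.
- by move=> x; apply: integral_ge0 => y _; apply: integral_ge0.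
Qed.

(** The first coordinate is integrated innermost, so that for frozen y and z the map is affine on
    the line. *)
Lemma lam3_shear g (k : R) (phi : R * R -> R) : (k != 0)%R ->
  measurable_fun setT g -> (forall v, 0 <= g v) -> measurable_fun setT phi ->
  \int[mu3]_v g (k * v.1.1 + phi (v.1.2, v.2), v.1.2, v.2)%R =
  (`|k|^-1)%:E * \int[mu3]_v g v.
Proof.
move=> k0 mg g0 mphi.
have mgk : measurable_fun setT
    (fun v : vec R => g (k * v.1.1 + phi (v.1.2, v.2), v.1.2, v.2)%R) by mfun.
rewrite (lam3_tonelli_rev mgk (fun=> g0 _)) (lam3_tonelli_rev mg g0) /=.
have mG : measurable_fun setT (fun p : R * R => \int[leb]_x g (x, p.2, p.1)).
  by mfun.
have G0 z y : 0 <= \int[leb]_x g (x, y, z) by apply: integral_ge0.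
rewrite -ge0_integralZl//; last 2 first.
- by mfun => // x y; apply: integral_ge0.
- by move=> z _; apply: integral_ge0.
apply: eq_integral => z _; rewrite -ge0_integralZl//; last first.
  by apply: (measurableT_comp mG (g := fun y => (z, y))); mfun.
apply: eq_integral => y _.
by rewrite (integral_affine _ (g := fun x => g (x, y, z)))//; mfun.
Qed.

Lemma lam3_opp g : measurable_fun setT g -> (forall v, 0 <= g v) ->
  \int[mu3]_v g (vscale (-1)%R v) = \int[mu3]_v g v.
Proof.
move=> mg g0.
have mgN : measurable_fun setT (fun v => g (vscale (-1)%R v)) by mfun.
rewrite (lam3_tonelli mgN (fun=> g0 _)) (lam3_tonelli mg g0) /vscale/=.
transitivity (\int[leb]_x \int[leb]_y \int[leb]_z g (- x, - y, z)%R).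
  apply: eq_integral => x _; apply: eq_integral => y _.
  rewrite -(integral_opp (g := fun z => g (- x, - y, z)%R))//.
    by apply: eq_integral => z _; rewrite !mulN1r.
  by mfun.
transitivity (\int[leb]_x \int[leb]_y \int[leb]_z g (- x, y, z)%R).
  apply: eq_integral => x _.
  rewrite (integral_opp (g := fun y => \int[leb]_z g (- x, y, z)%R))//.
    by mfun.
  by move=> y; apply: integral_ge0.
rewrite (integral_opp (g := fun x => \int[leb]_y \int[leb]_z g (x, y, z)))//.
- by mfun => // x y; apply: integral_ge0.
- by move=> x; apply: integral_ge0 => y _; apply: integral_ge0.
Qed.

Lemma lam3_vsub g (a : vec R) : measurable_fun setT g -> (forall v, 0 <= g v) ->
  \int[mu3]_v g (vsub a v) = \int[mu3]_v g v.
Proof.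
move=> mg g0; rewrite -(lam3_shift a mg g0).
have mga : measurable_fun setT (fun v => g (vadd v a)) by mfun.
rewrite -[RHS](lam3_opp mga (fun=> g0 _)).
by apply: eq_integral => -[[x y] z] _; congr g; vec_eq; congr (_, _, _); ring.
Qed.

(** The first coordinate is integrated outermost: while it is frozen the other two are merely
    translated, and it is rescaled at the end. *)
Lemma lam3_diag_shear g (k b c : R) : (k != 0)%R -> measurable_fun setT g ->
  (forall v, 0 <= g v) ->
  \int[mu3]_v g (k * v.1.1, v.1.2 + b * v.1.1, v.2 + c * v.1.1)%R =
  (`|k|^-1)%:E * \int[mu3]_v g v.
Proof.
move=> k0 mg g0.
have mgD : measurable_fun setT
    (fun v : vec R => g (k * v.1.1, v.1.2 + b * v.1.1, v.2 + c * v.1.1)%R) by mfun.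
rewrite (lam3_tonelli mgD (fun=> g0 _)) (lam3_tonelli mg g0) /=.
transitivity (\int[leb]_x \int[leb]_y \int[leb]_z g (k * x, y + b * x, z)%R).
  apply: eq_integral => x _; apply: eq_integral => y _.
  rewrite (integral_shift (c * x) (g := fun z => g (k * x, y + b * x, z)%R))//.
  by mfun.
transitivity (\int[leb]_x \int[leb]_y \int[leb]_z g (k * x, y, z)%R).
  apply: eq_integral => x _.
  rewrite (integral_shift (b * x) (g := fun y => \int[leb]_z g (k * x, y, z)%R))//.
    by mfun.
  by move=> y; apply: integral_ge0.
have mG : measurable_fun setT (fun x : R => \int[leb]_y \int[leb]_z g (x, y, z)).
  by mfun => // x y; apply: integral_ge0.
have G0 x : 0 <= \int[leb]_y \int[leb]_z g (x, y, z).
  by apply: integral_ge0 => y _; apply: integral_ge0.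
rewrite -(integral_affine 0 k0 mG G0).
by apply: eq_integral => x _; rewrite addr0.
Qed.

(* Conjugating by q |-> (q . n, q_2, q_3) turns q - c (q . n) n into a
   triangular map. *)
Lemma lam3_reflection g n (c : R) : dot n n = 1%R -> (n.1.1 != 0)%R -> (c != 1)%R ->
  measurable_fun setT g -> (forall v, 0 <= g v) ->
  \int[mu3]_q g (vsub q (vscale (c * dot q n)%R n)) =
  (`|1 - c|^-1)%:E * \int[mu3]_q g q.
Proof.
case: n => -[n1 n2] n3; rewrite /dot/= => n_unit n10 c1 mg g0.
(* [g] composed with the inverse of the conjugating map. Its factor |n1| cancels against that of the
   forward map, leaving only the triangular factor 1 - c. *)
pose g' (v : vec R) := g (n1^-1 * v.1.1 + - (n1^-1 * (n2 * v.1.2 + n3 * v.2)), v.1.2, v.2)%R.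
have mg' : measurable_fun setT g' by rewrite /g'; mfun.
have g'0 v : 0 <= g' v by exact: g0.
have n1V : (n1^-1 != 0)%R by rewrite invr_eq0.
have mphi1 : measurable_fun setT
    (fun p : R * R => - (n1^-1 * (n2 * p.1 + n3 * p.2)))%R by mfun.
have mphi2 : measurable_fun setT (fun p : R * R => n2 * p.1 + n3 * p.2)%R by mfun.
have g'E : \int[mu3]_v g' v = `|n1|%:E * \int[mu3]_v g v.
  by rewrite (lam3_shear n1V mg g0 mphi1) normfV invrK.
pose D (v : vec R) := g' ((1 - c) * v.1.1, v.1.2 + - (c * n2) * v.1.1,
  v.2 + - (c * n3) * v.1.1)%R.
have mD : measurable_fun setT D by rewrite /D; mfun.
have c0 : (1 - c != 0)%R by rewrite subr_eq0 eq_sym.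
have := lam3_shear n10 mD (fun=> g'0 _) mphi2.
rewrite (lam3_diag_shear _ _ c0 mg' g'0) g'E.
rewrite muleCA (muleA _ `|n1|%:E) -EFinM mulVf ?normr_eq0// mul1e => <-.
apply: eq_integral => -[[x y] z] _; rewrite /D /g'; congr g.
rewrite /vsub /vadd /vscale/=.
have -> : (n1^-1 * ((1 - c) * (n1 * x + (n2 * y + n3 * z))) +
    - (n1^-1 * (n2 * (y + - (c * n2) * (n1 * x + (n2 * y + n3 * z))) +
     n3 * (z + - (c * n3) * (n1 * x + (n2 * y + n3 * z)))))
  = x - c * (x * n1 + y * n2 + z * n3) * ((1 - n2 * n2 - n3 * n3) / n1))%R.
  by field.
have -> : (1 - n2 * n2 - n3 * n3 = n1 * n1)%R by rewrite -n_unit; ring.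
by rewrite mulfK//; congr (_, _, _); ring.
Qed.

End lam3_change_of_variables.

Lemma tonelli_swap d d' (T : measurableType d) (T' : measurableType d')
    (R : realType) (mu : {sigma_finite_measure set T -> \bar R})
    (nu : {sigma_finite_measure set T' -> \bar R}) (f : T -> T' -> \bar R) :
  measurable_fun setT (fun p : T * T' => f p.1 p.2) ->
  (forall x y, 0 <= f x y)%E ->
  (\int[mu]_x \int[nu]_y f x y = \int[nu]_y \int[mu]_x f x y)%E.
Proof.
by move=> mf f0; exact: (fubini_tonelli (fun p : T * T' => f p.1 p.2)).
Qed.

(** * Geometry of inelastic collisions *)

Section collisions.
Variables (R : realType) (m m1 eps th1 : R) (u1 : vec R).
Hypotheses (m_gt0 : 0 < m) (m1_gt0 : 0 < m1) (eps_gt0 : 0 < eps)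
  (eps_lt1 : eps < 1) (th1_gt0 : 0 < th1).
Implicit Types (v w n y : vec R).
Local Notation mu3 := (@lam3 R).
Local Notation mu6 := (@lam6 R).
Local Notation vstar := (vstar m m1 eps).
Local Notation wstar := (wstar m m1 eps).
Local Notation M1 := (M1 m1 th1 u1).

(** The masses drop out because the two weights add up to 1, and (1 - beta) / (1 - 2 beta) = (1 +
    eps) / (2 eps). The starred normal relative velocity is therefore 1 - (1 + eps) / eps = - 1 /
    eps times the original one. *)
Lemma gamD_gambar : 2 * (gam m m1 eps + gambar m m1 eps) = (1 + eps) / eps.
Proof.
rewrite /gam /gambar /alpha /beta; field.
by rewrite !gt_eqF//= addr_gt0.
Qed.

(* With q' = v_* - w_*, the collision rule is inverted by v = v_* - kap (q' . n) n. *)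
Definition kap : R := 2 * gam m m1 eps * eps.

(** A mass ratio below 1 times a factor below 2: the origin of 0 < kap < 2. *)
Lemma kapE : kap = m1 / (m + m1) * (1 + eps).
Proof.
rewrite /kap /gam /alpha /beta; field.
by rewrite opprB addrCA subrr addr0 !gt_eqF//= addr_gt0.
Qed.

Lemma kap_gt0 : 0 < kap.
Proof. by rewrite kapE mulr_gt0 ?divr_gt0// addr_gt0. Qed.

Lemma kap_lt2 : kap < 2.
Proof.
rewrite kapE mulrAC ltr_pdivrMr ?addr_gt0//.
have : m1 * eps < m1 * 1 by rewrite ltr_pM2l.
move: m_gt0; lra.
Qed.

Lemma vsub_vscaleK (r : R) v n : vsub (vsub v (vscale r n)) (vscale (- r) n) = v.
Proof. by vec_eq; congr (_, _, _); ring. Qed.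

Lemma vsub_vsub v w : vsub v (vsub v w) = w.
Proof. by vec_eq; congr (_, _, _); ring. Qed.

Lemma vaddK v w : vsub (vadd v w) w = v.
Proof. by vec_eq; congr (_, _, _); ring. Qed.

Lemma vsub_shift_star (a b : R) v q n :
  vadd (vsub (vadd v (vscale a n)) q) (vscale b n) =
  vsub v (vsub q (vscale (a + b) n)).
Proof. by vec_eq; congr (_, _, _); ring. Qed.

(** Velocity with which the test particle leaves the inelastic collision that [v] and [w] enter; the
    adjoint of the gain operator evaluates its argument there. *)
Definition vpre v w n : vec R := vsub v (vscale (kap * dot (vsub v w) n) n).

Lemma dot_star v w n : dot n n = 1 ->
  dot (vsub (vstar v w n) (wstar v w n)) n = - (dot (vsub v w) n / eps).
Proof.
move=> n1; set s := dot (vsub v w) n.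
have -> : dot (vsub (vstar v w n) (wstar v w n)) n =
    s - 2 * (gam m m1 eps + gambar m m1 eps) * s * dot n n.
  rewrite /Defs.vstar /Defs.wstar -/s; have -> : s = dot (vsub v w) n by [].
  rewrite /vsub /vadd /vscale /dot/=; ring.
by rewrite gamD_gambar n1; field; rewrite gt_eqF.
Qed.

Lemma vpre_star v w n : dot n n = 1 -> vpre (vstar v w n) (wstar v w n) n = v.
Proof.
move=> n1; rewrite /vpre dot_star// /kap /Defs.vstar.
set s := dot (vsub v w) n.
have -> : 2 * gam m m1 eps * eps * - (s / eps) = - (2 * gam m m1 eps * s).
  by field; rewrite gt_eqF.
exact: vsub_vscaleK.
Qed.

(** In the variables v and q = v - w, a translation of v depending on q alone leaves the map q -> q
    - c (q . n) n, of determinant 1 - c = - 1 / eps. The condition on the first coordinate of n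
    comes from the conjugation in [lam3_reflection]. *)
Lemma collision_change_of_variables (h : vec R -> vec R -> \bar R) n :
  dot n n = 1 -> n.1.1 != 0 ->
  measurable_fun setT (fun p : vec R * vec R => h p.1 p.2) ->
  (forall v w, 0 <= h v w)%E ->
  (\int[mu3]_v \int[mu3]_w h (vstar v w n) (wstar v w n) =
   eps%:E * \int[mu3]_v \int[mu3]_w h v w)%E.
Proof.
move=> n1 n10 mh h0; pose c := 2 * (gam m m1 eps + gambar m m1 eps).
have c1 : 1 - c = - eps^-1 by rewrite /c gamD_gambar; field; rewrite gt_eqF.
have cn1 : c != 1.
  by rewrite -subr_eq0 -opprB c1 opprK invr_eq0 gt_eqF.
pose r q : vec R := vscale (2 * gam m m1 eps * dot q n) n.
pose rb q : vec R := vscale (2 * gambar m m1 eps * dot q n) n.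
have mh2 d (T : measurableType d) (a b : T -> vec R) : measurable_fun setT a ->
    measurable_fun setT b -> measurable_fun setT (fun x => h (a x) (b x)).
  move=> ma mb; apply: (measurableT_comp mh (g := fun x => (a x, b x))).
  exact: measurable_fun_pair.
transitivity (\int[mu3]_v \int[mu3]_q h (vsub v (r q)) (vadd (vsub v q) (rb q)))%E.
  apply: eq_integral => v _.
  have mF : measurable_fun setT (fun w => h (vstar v w n) (wstar v w n)).
    by apply: mh2; mfun.
  rewrite -(lam3_vsub v mF (fun=> h0 _ _)); apply: eq_integral => q _.
  by rewrite /Defs.vstar /Defs.wstar vsub_vsub.
have mF1 : measurable_fun setT (fun p : vec R * vec R =>
    (fun v q => h (vsub v (r q)) (vadd (vsub v q) (rb q))) p.1 p.2).
  by apply: mh2; rewrite /r /rb; mfun.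
etransitivity; first exact: (tonelli_swap mu3 mu3 mF1 (fun _ _ => h0 _ _)).
transitivity (\int[mu3]_q \int[mu3]_v h v (vsub v (vsub q (vscale (c * dot q n) n))))%E.
  apply: eq_integral => q _.
  have mF : measurable_fun setT (fun v => h (vsub v (r q)) (vadd (vsub v q) (rb q))).
    by apply: mh2; mfun.
  rewrite -(lam3_shift (r q) mF (fun=> h0 _ _)); apply: eq_integral => v _.
  rewrite vaddK.
  rewrite /r /rb vsub_shift_star; congr (h _ (vsub _ (vsub _ (vscale _ _)))).
  by rewrite -mulrDl -mulrDr.
have mF2 : measurable_fun setT (fun p : vec R * vec R =>
    (fun q v => h v (vsub v (vsub q (vscale (c * dot q n) n)))) p.1 p.2).
  by apply: mh2; mfun.
etransitivity; first exact: (tonelli_swap mu3 mu3 mF2 (fun _ _ => h0 _ _)).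
have inner (v : vec R) : (\int[mu3]_q h v (vsub v (vsub q (vscale (c * dot q n) n))) =
    eps%:E * \int[mu3]_w h v w)%E.
  have mF : measurable_fun setT (fun q => h v (vsub v q)).
    apply: (mh2 _ _ (fun=> v) (vsub v)); first exact: measurable_cst.
    by apply: (measurable_vsub (f := fun=> v) (g := id));
      [exact: measurable_cst|exact: measurable_id].
  have mF' : measurable_fun setT (fun w => h v w).
    by apply: (mh2 _ _ (fun=> v) id); [exact: measurable_cst|exact: measurable_id].
  rewrite (lam3_reflection n1 n10 cn1 mF (fun=> h0 _ _)).
  by rewrite (lam3_vsub v mF' (h0 v)) c1 normrN gtr0_norm ?invr_gt0// invrK.
have mF3 : measurable_fun setT (fun v => \int[mu3]_w h v w)%E by mfun.
rewrite -ge0_integralZl//; [|by move=> v _; apply: integral_ge0|by rewrite lee_fin ltW].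
by apply: eq_integral => v _; exact: inner.
Qed.

End collisions.

(** * Tonelli on phase space and integration over the normals *)

Section ge0_scaling.
Context d (T : measurableType d) (R : realType) (mu : {measure set T -> \bar R}).
Local Open Scope ereal_scope.

Lemma ge0_mule_integral (k : R) (g : T -> \bar R) : (0 <= k)%R ->
  measurable_fun setT g -> (forall x, 0 <= g x) ->
  k%:E * \int[mu]_x g x = \int[mu]_x (k%:E * g x).
Proof. by move=> k0 mg g0; rewrite ge0_integralZl. Qed.

Lemma ge0_mule_integral_EFin (k : R) (g : T -> R) : (0 <= k)%R ->
  measurable_fun setT g -> (forall x, 0 <= g x)%R ->
  k%:E * \int[mu]_x (g x)%:E = \int[mu]_x (k * g x)%:E.
Proof.
by move=> k0 mg g0; rewrite ge0_mule_integral//; exact/measurable_EFinP.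
Qed.

End ge0_scaling.

Section phase_tonelli.
Variable R : realType.
Local Notation mu3 := (@lam3 R).
Local Notation mu6 := (@lam6 R).
Local Open Scope ereal_scope.

Lemma lam6_tonelli (g : phase R -> \bar R) : measurable_fun setT g ->
  (forall z, 0 <= g z) -> \int[mu6]_z g z = \int[mu3]_x \int[mu3]_v g (x, v).
Proof. by move=> mg g0; exact: (fubini_tonelli1 (m1 := mu3) (m2 := mu3)). Qed.

Lemma lam6_tonelli_rev (g : phase R -> \bar R) : measurable_fun setT g ->
  (forall z, 0 <= g z) -> \int[mu6]_z g z = \int[mu3]_v \int[mu3]_x g (x, v).
Proof. by move=> mg g0; exact: (fubini_tonelli2 (m1 := mu3) (m2 := mu3)). Qed.

(** The order is dictated by the collision map: position x and normal parameter y stay outside, and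
    the pair (v, w) which it transforms is innermost. *)
Lemma phase_tonelli4 (G : phase R -> phase R -> R) :
  measurable_fun setT (fun zp : phase R * phase R => G zp.1 zp.2) ->
  (forall z p, 0 <= G z p)%R ->
  \int[mu6]_z \int[mu6]_p (G z p)%:E =
  \int[mu3]_x \int[mu3]_y \int[mu3]_v \int[mu3]_w (G (x, v) (w, y))%:E.
Proof.
move=> mG G0; have E0 z p : 0 <= (G z p)%:E by rewrite lee_fin.
have mz : measurable_fun setT (fun z => \int[mu6]_p (G z p)%:E).
  by mfun => //; apply: (measurableT_comp mG (g := fun p => (p.1, p.2))); mfun.
rewrite (lam6_tonelli mz); last by move=> z; apply: integral_ge0.
have H (x : vec R) : \int[mu3]_v \int[mu6]_p (G (x, v) p)%:E =
    \int[mu3]_y \int[mu3]_v \int[mu3]_w (G (x, v) (w, y))%:E.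
  transitivity (\int[mu3]_v \int[mu3]_y \int[mu3]_w (G (x, v) (w, y))%:E).
    apply: eq_integral => v _; apply: (lam6_tonelli_rev (g := fun p => (G (x, v) p)%:E)) => //.
    mfun1; exact: (measurableT_comp mG (pair1_measurable _)).
  apply: (tonelli_swap mu3 mu3 (f := fun v y => \int[mu3]_w (G (x, v) (w, y))%:E)).
    mfun => //.
    by apply: (measurableT_comp mG
      (g := fun q : vec R * vec R * vec R => ((x, q.1.1), (q.2, q.1.2)))); mfun.
  by move=> v y; apply: integral_ge0.
by apply: eq_integral => x _; exact: H.
Qed.

Lemma lam3_box (A B C : set R) : measurable A -> measurable B -> measurable C ->
  mu3 (A `*` B `*` C) =
  @lebesgue_measure R A * @lebesgue_measure R B * @lebesgue_measure R C.
Proof.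
move=> mA mB mC.
transitivity ((@lam2 R \x @lebesgue_measure R) (A `*` B `*` C)); first by [].
rewrite product_measure1E//; last exact: measurableX.
congr (_ * _).
exact: (product_measure1E (@lebesgue_measure R) (@lebesgue_measure R)).
Qed.

(** These are the normals that the collision change of variables leaves out. *)
Lemma lam3_null_plane : mu3 [set y | y.1.1 = 0%R] = 0.
Proof.
have -> : [set y : vec R | y.1.1 = 0%R] = ([set 0%R] `*` setT) `*` setT.
  by apply/seteqP; split => -[[a b] c] //= [[]].
by rewrite lam3_box// lebesgue_measure_set1 !mul0e.
Qed.

End phase_tonelli.

Section unit_ball.
Variable R : realType.
Implicit Type y : vec R.
Local Notation mu3 := (@lam3 R).

(** A factor of the integrand instead of a domain of integration, so that integrals over background
    velocities and normals run over all of [lam6]. *)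
Definition chi y : R := \1_[set y : vec R | 0 < vnorm y <= 1] y.

Lemma chi01 y : (chi y = 1 /\ 0 < vnorm y <= 1) \/ chi y = 0.
Proof.
rewrite /chi indicE; case: (boolP (y \in _)) => [/set_mem yB|_]; first by left.
by right.
Qed.

Lemma chi_ge0 y : 0 <= chi y.
Proof. by have [[->]|->] := chi01 y. Qed.

Lemma measurable_chi : measurable_fun setT chi.
Proof.
have mnorm : measurable_fun setT (fun y : vec R => vnorm y) by mfun.
apply/measurable_indicP.
rewrite (_ : [set y | _] = (fun y : vec R => vnorm y) @^-1` `]0, 1]%classic).
  by rewrite -[X in measurable X]setTI; apply: mnorm.
by apply/seteqP; split => y /=; rewrite in_itv/=.
Qed.

(** The ball lies in the cube [-1, 1]^3. *)
Lemma integral_chi_lty : (\int[mu3]_y (chi y)%:E < +oo)%E.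
Proof.
pose B : set (vec R) := (`[-1, 1]%classic `*` `[-1, 1]%classic) `*` `[-1, 1]%classic.
have mB : measurable B by apply: measurableX => //; exact: measurableX.
apply: (@le_lt_trans _ _ (\int[mu3]_y (\1_B y)%:E)%E); last first.
  rewrite integral_indic// setIT.
  rewrite -[X in (X < _)%E]/(mu3 B) lam3_box// lebesgue_measure_itv/= lte_fin.
  by case: ifPn => _; rewrite -?EFinB -?EFinM ?mule0 ltry.
apply: ge0_le_integral => //.
- by move=> y _; rewrite lee_fin chi_ge0.
- by apply/measurable_EFinP; exact: measurable_chi.
- by apply/measurable_EFinP; exact: measurable_indic.
move=> y _; rewrite lee_fin; have [[-> /andP[_ y1]]|->] := chi01 y; last first.
  by rewrite indicE ler0n.
have {}y1 : dot y y <= 1.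
  by rewrite -sqr_vnorm expr_le1// vnorm_ge0.
rewrite indicE mem_set//; case: y y1 => [[a b] c]; rewrite /dot/= => abc.
have := sqr_ge0 a; have := sqr_ge0 b; have := sqr_ge0 c.
rewrite !expr2 => a2 b2 c2.
by split => /=; [split => /=|]; rewrite in_itv/= -ler_norml -(@expr_le1 _ 2)//
  real_normK ?num_real// expr2; lra.
Qed.

End unit_ball.

(** * The gain operator and its adjoint *)

Section gain_adjoint.
Variables (R : realType) (m m1 eps th1 : R) (u1 : vec R).
Hypotheses (m_gt0 : 0 < m) (m1_gt0 : 0 < m1) (eps_gt0 : 0 < eps)
  (eps_lt1 : eps < 1) (th1_gt0 : 0 < th1).
Implicit Types (v w n y : vec R) (F : vec R -> R) (f : fn R).
Local Notation mu3 := (@lam3 R).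
Local Notation mu6 := (@lam6 R).
Local Notation vstar := (vstar m m1 eps).
Local Notation wstar := (wstar m m1 eps).
Local Notation vback := (vpre m m1 eps).
Local Notation M1 := (M1 m1 th1 u1).
Local Notation sigma := (sigma m1 th1 u1).
Local Notation Kop := (Kop m m1 eps th1 u1).

Lemma M1_ge0 v : 0 <= M1 v.
Proof. by rewrite /Defs.M1 mulr_ge0 ?powR_ge0 ?expR_ge0. Qed.

Lemma measurable_M1 : measurable_fun setT M1.
Proof. rewrite /Defs.M1; mfun. Qed.

(* Up to constants [IK] is the gain operator at fixed x and [ID] is its adjoint; the
   normals n run over [unitv y] with y in the punctured unit ball, of indicator [chi]. *)
Definition gain f (z p : phase R) : R :=
  chi p.2 * (`|dot (vsub z.2 p.1) (unitv p.2)| *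
    f (z.1, vstar z.2 p.1 (unitv p.2)) * M1 (wstar z.2 p.1 (unitv p.2))).

Definition dual F v (p : phase R) : R :=
  chi p.2 * (`|dot (vsub v p.1) (unitv p.2)| *
    F (vback v p.1 (unitv p.2)) * M1 p.1).

Definition IK f (z : phase R) : \bar R := (\int[mu6]_p (gain f z p)%:E)%E.

Definition ID F v : \bar R := (\int[mu6]_p (dual F v p)%:E)%E.

Lemma int_R3S2E (h : vec R -> vec R -> R) :
  int_R3S2 h = 3 * fine (\int[mu6]_p (chi p.2 * h p.1 (unitv p.2))%:E)%E.
Proof.
rewrite /int_R3S2 integral_mkcond; congr (3 * fine _).
apply: eq_integral => p _; rewrite patchE /chi indicE.
have -> : (p \in ballS (R := R)) = (p.2 \in [set y : vec R | 0 < vnorm y <= 1]).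
  by apply/idP/idP => /set_mem ?; apply/mem_set.
by case: ifPn => _; rewrite ?mul1r ?mul0r.
Qed.

(** Where [IK f z] is infinite, [fine] makes [Kop f z] equal to 0. Identities are therefore proved
    for [IK] and transferred where it is finite. *)
Lemma KopE f z : Kop f z = eps ^- 2 * (3 * fine (IK f z)).
Proof. by rewrite /Defs.Kop int_R3S2E. Qed.

Lemma sigmaE v : sigma v = 3 * fine (ID (fun=> 1) v).
Proof.
rewrite /Defs.sigma int_R3S2E; congr (3 * fine _).
by apply: eq_integral => p _; rewrite /dual mulr1.
Qed.

Lemma gain_ge0 f z p : (forall z, 0 <= f z) -> 0 <= gain f z p.
Proof.
move=> f0; apply: mulr_ge0; first exact: chi_ge0.
by apply: mulr_ge0; [apply: mulr_ge0|exact: M1_ge0].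
Qed.

Lemma dual_ge0 F v p : (forall v, 0 <= F v) -> 0 <= dual F v p.
Proof.
move=> F0; apply: mulr_ge0; first exact: chi_ge0.
by apply: mulr_ge0; [apply: mulr_ge0|exact: M1_ge0].
Qed.

Lemma measurable_gain f : measurable_fun setT f ->
  measurable_fun setT (fun zp : phase R * phase R => gain f zp.1 zp.2).
Proof.
move=> mf; rewrite /gain; have mM := measurable_M1; have mc := @measurable_chi R.
by mfun.
Qed.

Lemma measurable_dual F : measurable_fun setT F ->
  measurable_fun setT (fun vp : vec R * phase R => dual F vp.1 vp.2).
Proof.
move=> mF; rewrite /dual /vpre; have mM := measurable_M1.
by have mc := @measurable_chi R; mfun.
Qed.

Lemma measurable_IK f : measurable_fun setT f -> (forall z, 0 <= f z) ->
  measurable_fun setT (IK f).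
Proof.
move=> mf f0; rewrite /IK.
apply: (@measurable_fun_integral _ _ _ _ _ mu6 (fun z p => (gain f z p)%:E)).
  by apply/measurable_EFinP; exact: measurable_gain.
by move=> z p; rewrite lee_fin gain_ge0.
Qed.

Lemma measurable_ID F : measurable_fun setT F -> (forall v, 0 <= F v) ->
  measurable_fun setT (ID F).
Proof.
move=> mF F0; rewrite /ID.
apply: (@measurable_fun_integral _ _ _ _ _ mu6 (fun v p => (dual F v p)%:E)).
  by apply/measurable_EFinP; exact: measurable_dual.
by move=> z p; rewrite lee_fin dual_ge0.
Qed.

Lemma IK_ge0 f z : (forall z, 0 <= f z) -> (0 <= IK f z)%E.
Proof. by move=> f0; apply: integral_ge0 => p _; rewrite lee_fin gain_ge0. Qed.

Lemma ID_ge0 F v : (forall v, 0 <= F v) -> (0 <= ID F v)%E.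
Proof. by move=> F0; apply: integral_ge0 => p _; rewrite lee_fin dual_ge0. Qed.

Lemma gain_adjoint F f : measurable_fun setT F -> (forall v, 0 <= F v) ->
  measurable_fun setT f -> (forall z, 0 <= f z) ->
  (\int[mu6]_z ((F z.2)%:E * IK f z) =
   (eps ^+ 2)%:E * \int[mu6]_z ((f z)%:E * ID F z.2))%E.
Proof.
move=> mF F0 mf f0.
have mg := measurable_gain mf; have md := measurable_dual mF.
have mM := measurable_M1.
have mg1 (z : phase R) : measurable_fun setT (gain f z).
  exact: (measurableT_comp mg (pair1_measurable z)).
have md1 (v : vec R) : measurable_fun setT (dual F v).
  exact: (measurableT_comp md (pair1_measurable v)).
have g0 z p := @gain_ge0 f z p f0; have d0 v p := @dual_ge0 F v p F0.
have mID := measurable_ID mF F0.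
transitivity (\int[mu6]_z \int[mu6]_p (F z.2 * gain f z p)%:E)%E.
  apply: eq_integral => z _.
  exact: (ge0_mule_integral_EFin mu6 (F0 _) (mg1 z) (g0 z)).
transitivity (\int[mu6]_z \int[mu6]_p (eps ^+ 2 * (f z * dual F z.2 p))%:E)%E; last first.
  have mfD : measurable_fun setT (fun z : phase R => (f z)%:E * ID F z.2)%E.
    apply: emeasurable_funM; first exact/measurable_EFinP.
    exact: (measurableT_comp mID measurable_snd).
  have fD0 z : (0 <= (f z)%:E * ID F z.2)%E by rewrite mule_ge0 ?lee_fin ?ID_ge0.
  rewrite (ge0_mule_integral mu6 (sqr_ge0 eps) mfD fD0).
  apply: eq_integral => z _.
  have mfd : measurable_fun setT (fun p => f z * dual F z.2 p).
    by apply: measurable_funM.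
  rewrite /ID (ge0_mule_integral_EFin mu6 (f0 z) (md1 z.2) (d0 z.2)).
  rewrite (ge0_mule_integral_EFin mu6 (sqr_ge0 eps) mfd)// => p.
  exact: mulr_ge0.
have mG1 : measurable_fun setT (fun zp : phase R * phase R =>
    (fun z p => F z.2 * gain f z p) zp.1 zp.2).
  by apply: measurable_funM => //; mfun.
have mG2 : measurable_fun setT (fun zp : phase R * phase R =>
    (fun z p => eps ^+ 2 * (f z * dual F z.2 p)) zp.1 zp.2).
  do 2 apply: measurable_funM => //; first by mfun.
  by apply: (measurableT_comp md (g := fun q : phase R * phase R => (q.1.2, q.2))); mfun.
have G1_0 (z p : phase R) : 0 <= F z.2 * gain f z p := mulr_ge0 (F0 _) (g0 _ _).
have G2_0 (z p : phase R) : 0 <= eps ^+ 2 * (f z * dual F z.2 p) :=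
  mulr_ge0 (sqr_ge0 _) (mulr_ge0 (f0 _) (d0 _ _)).
rewrite (phase_tonelli4 mG1 G1_0) (phase_tonelli4 mG2 G2_0).
suff key (x : vec R) : (\int[mu3]_y \int[mu3]_v \int[mu3]_w (F v * gain f (x, v) (w, y))%:E =
    \int[mu3]_y \int[mu3]_v \int[mu3]_w (eps ^+ 2 * (f (x, v) * dual F v (w, y)))%:E)%E.
  by apply: eq_integral => x _; exact: key.
have mH (G : phase R -> phase R -> R) :
    measurable_fun setT (fun zp : phase R * phase R => G zp.1 zp.2) ->
    (forall z p, 0 <= G z p) ->
    measurable_fun setT (fun y => \int[mu3]_v \int[mu3]_w (G (x, v) (w, y))%:E)%E.
  move=> mG G0; mfun => //; last by move=> *; apply: integral_ge0 => *; rewrite lee_fin.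
    by apply: (measurableT_comp mG
      (g := fun q : vec R * vec R * vec R => ((x, q.1.2), (q.2, q.1.1)))); mfun.
  by move=> *; rewrite lee_fin.
apply: ge0_ae_eq_integral => //.
- exact: (mH _ mG1 G1_0).
- exact: (mH _ mG2 G2_0).
- move=> y _; apply: integral_ge0 => v _; apply: integral_ge0 => w _.
  by rewrite lee_fin; exact: (G1_0 (x, v) (w, y)).
- move=> y _; apply: integral_ge0 => v _; apply: integral_ge0 => w _.
  by rewrite lee_fin; exact: (G2_0 (x, v) (w, y)).
(* Outside this plane [unitv y] has nonzero first coordinate, as the change of variables demands;
   where [chi] is 0 both sides vanish. *)
exists [set y | y.1.1 = 0]; split; [|exact: lam3_null_plane|].
  have mc : measurable_fun setT (fun y : vec R => y.1.1) by mfun.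
  by rewrite -[X in measurable X]setTI; exact: (mc measurableT [set 0]).
move=> y /= /not_implyP[_ neq]; apply: contrapT => /eqP y10; apply: neq.
have [[chi1 /andP[y0 _]]|chi0] := chi01 y; last first.
  by apply: eq_integral => v _; apply: eq_integral => w _;
    rewrite /gain /dual chi0 !mul0r !mulr0.
set n := unitv y; have n1 : dot n n = 1 by exact: dot_unitv.
have n10 : n.1.1 != 0.
  by apply: mulf_neq0 => //; rewrite invr_eq0 gt_eqF.
(* The factor [eps] offsets the 1 / eps of [dot_star], so that [h] at the starred velocities is
   exactly the gain integrand. *)
pose h v w := (F (vback v w n) * (eps * `|dot (vsub v w) n|) * f (x, v) * M1 w)%:E.
have mh : measurable_fun setT (fun p : vec R * vec R => h p.1 p.2).
  by rewrite /h /vpre; mfun.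
have h0 v w : (0 <= h v w)%E.
  rewrite lee_fin; apply: mulr_ge0; last exact: M1_ge0.
  apply: mulr_ge0; last exact: f0.
  by apply: mulr_ge0; [exact: F0|rewrite mulr_ge0// ltW].
have := collision_change_of_variables m_gt0 m1_gt0 eps_gt0 n1 n10 mh h0.
have mh1 : measurable_fun setT (fun v => \int[mu3]_w h v w)%E.
  exact: (@measurable_fun_integral _ _ _ _ _ mu3 h).
have ih0 v : (0 <= \int[mu3]_w h v w)%E by exact: integral_ge0.
rewrite (ge0_mule_integral mu3 (ltW eps_gt0) mh1 ih0).
set L := (LHS in LHS = _ -> _); set L' := (RHS in _ = RHS -> _).
have -> : L = (\int[mu3]_v \int[mu3]_w (F v * gain f (x, v) (w, y))%:E)%E.
  apply: eq_integral => v _; apply: eq_integral => w _.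
  rewrite /h /gain/= chi1 mul1r -/n vpre_star// dot_star// normrN normrM.
  have -> : `|eps^-1| = eps^-1 by rewrite gtr0_norm ?invr_gt0.
  by congr EFin; field; rewrite gt_eqF.
have -> // : L' = (\int[mu3]_v \int[mu3]_w (eps ^+ 2 * (f (x, v) * dual F v (w, y)))%:E)%E.
apply: eq_integral => v _.
have mhv : measurable_fun setT (h v) by exact: (measurableT_comp mh (pair1_measurable v)).
rewrite (ge0_mule_integral mu3 (ltW eps_gt0) mhv (h0 v)).
apply: eq_integral => w _; rewrite /h -EFinM /dual/= chi1 mul1r -/n; congr EFin.
ring.
Qed.

End gain_adjoint.

(** * The energy weight: collision estimate and Gaussian moment *)

Section drift.
Variables (R : realType) (m m1 eps th1 : R) (u1 : vec R).
Hypotheses (m_gt0 : 0 < m) (m1_gt0 : 0 < m1) (eps_gt0 : 0 < eps)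
  (eps_lt1 : eps < 1) (th1_gt0 : 0 < th1).
Implicit Types (v w n y : vec R) (F : vec R -> R) (f : fn R).
Local Notation mu3 := (@lam3 R).
Local Notation mu6 := (@lam6 R).
Local Notation vback := (vpre m m1 eps).
Local Notation M1 := (M1 m1 th1 u1).
Local Notation sigma := (sigma m1 th1 u1).
Local Notation Kop := (Kop m m1 eps th1 u1).
Local Notation dual := (dual m m1 eps th1 u1).
Local Notation ID := (ID m m1 eps th1 u1).
Local Notation IK := (IK m m1 eps th1 u1).
Local Notation gain := (gain m m1 eps th1 u1).
Local Notation kap := (kap m m1 eps).

Definition W v : R := 1 + dot v v.

Lemma W_ge1 v : 1 <= W v.
Proof. by rewrite lerDl dot_ge0. Qed.

Lemma W_ge0 v : 0 <= W v.
Proof. exact: le_trans ler01 (W_ge1 v). Qed.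

Lemma measurable_W : measurable_fun setT W.
Proof. by rewrite /W; mfun. Qed.

Lemma sqr_dot_unit_le v n : dot n n = 1 -> dot v n ^+ 2 <= dot v v.
Proof. by move=> n1; have := CauchySchwarz_dot v n; rewrite n1 mulr1. Qed.

Lemma dot_vsub_le v w : dot (vsub v w) (vsub v w) <= 2 * dot v v + 2 * dot w w.
Proof.
case: v => [[a b] c]; case: w => [[x y] z].
rewrite /vsub /vadd /vscale /dot/= -subr_ge0.
set X := (X in 0 <= X).
have -> : X = (a + x) ^+ 2 + (b + y) ^+ 2 + (c + z) ^+ 2 by rewrite /X; ring.
by rewrite !addr_ge0 ?sqr_ge0.
Qed.

(** A crude bound in product form: it separates v from w, so integration against the Maxwellian
    leaves a multiple of [W v]. It rests on |s| <= 1 + s^2. *)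
Lemma relative_speed_le v w n : dot n n = 1 ->
  `|dot (vsub v w) n| <= 2 * W v * W w.
Proof.
move=> n1; set s := dot _ n.
have s2 : s ^+ 2 <= 2 * dot v v + 2 * dot w w.
  exact: le_trans (sqr_dot_unit_le _ n1) (dot_vsub_le v w).
have : `|s| <= 1 + s ^+ 2.
  rewrite -real_normK ?num_real//; have := sqr_ge0 (`|s| - 1); nra.
have v0 := dot_ge0 v; have w0 := dot_ge0 w; have := mulr_ge0 v0 w0.
rewrite /W; move: (dot v v) (dot w w) s2 v0 w0 => V U; nra.
Qed.

(** The maximum over s of - 2 kap s (s + t) + kap^2 s^2 is kap / (2 - kap) times t^2, by completing
    the square. *)
Definition dissipation : R := kap / (2 - kap).

Lemma dissipation_ge0 : 0 <= dissipation.
Proof.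
by rewrite divr_ge0 ?subr_ge0 ?ltW ?kap_gt0 ?kap_lt2.
Qed.

(* The cross term of the energy balance is absorbed by the energy lost in the
   collision, because 0 < kap < 2. *)
Lemma W_vpre_le v w n : dot n n = 1 ->
  W (vback v w n) <= W v + dissipation * dot w n ^+ 2.
Proof.
move=> n1; have k0 : 0 < kap by exact: kap_gt0.
have k2 : 0 < 2 - kap by rewrite subr_gt0; exact: kap_lt2.
set s := dot (vsub v w) n; set t := dot w n.
have vn : dot v n = s + t.
  by rewrite /s /t /vsub /vadd /vscale /dot/=; ring.
have -> : W (vback v w n) = W v - 2 * kap * s * (s + t) + kap ^+ 2 * s ^+ 2 * dot n n.
  rewrite -vn /W /vpre -/s; move: s vn => s _.
  rewrite /vsub /vadd /vscale /dot/=; ring.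
rewrite n1 -subr_ge0.
have -> : W v + dissipation * t ^+ 2 -
    (W v - 2 * kap * s * (s + t) + kap ^+ 2 * s ^+ 2 * 1) =
    kap * (2 - kap) * (s + t / (2 - kap)) ^+ 2.
  by rewrite /dissipation; field; rewrite gt_eqF.
exact: mulr_ge0 (mulr_ge0 (ltW k0) (ltW k2)) (sqr_ge0 _).
Qed.

Lemma measurable_WM : measurable_fun setT (fun w => W w ^+ 2 * M1 w).
Proof.
by have mW := measurable_W; have mM := measurable_M1 m1 th1 u1; mfun.
Qed.

(** Half of the Gaussian exponent pays for the polynomial weight; the other half is, up to a
    constant, a product of three normal densities centred at [u1], whose integral is 1. *)
Lemma gaussian_moment : (\int[mu3]_w (W w ^+ 2 * M1 w)%:E < +oo)%E.
Proof.
pose a := m1 / (2 * th1); have a0 : 0 < a by rewrite divr_gt0// mulr_gt0.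
(* Twice the variance of the Maxwellian: the product density decays like exp (- a X / 2), against
   exp (- a X) for [M1]. *)
pose s := Num.sqrt a^-1; have s0 : 0 < s by rewrite sqrtr_gt0 invr_gt0.
have s2 : s ^+ 2 = a^-1 by rewrite sqr_sqrtr// invr_ge0 ltW.
pose N (i : R) (x : R) := normal_pdf i s x.
pose G w := N u1.1.1 w.1.1 * N u1.1.2 w.1.2 * N u1.2 w.2.
have mN i : measurable_fun setT (N i) by exact: measurable_normal_pdf.
have N0 i x : 0 <= N i x by exact: normal_pdf_ge0.
have intN i : (\int[@lebesgue_measure R]_x (N i x)%:E = 1)%E.
  by apply: integral_normal_pdf; rewrite gt_eqF.
have mG : measurable_fun setT G.
  have m1' := mN u1.1.1; have m2' := mN u1.1.2; have m3' := mN u1.2.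
  by rewrite /G; mfun.
have G0 w : 0 <= G w by rewrite /G !mulr_ge0.
have intG : (\int[mu3]_w (G w)%:E = 1)%E.
  have scale (k i : R) : 0 <= k ->
      (\int[@lebesgue_measure R]_x (k * N i x)%:E = k%:E)%E.
    move=> k0; transitivity (k%:E * \int[@lebesgue_measure R]_x (N i x)%:E)%E.
      exact/esym/(ge0_mule_integral_EFin (@lebesgue_measure R) k0 (mN i) (N0 i)).
    by rewrite intN mule1.
  have mGE : measurable_fun setT (fun w => (G w)%:E) by exact/measurable_EFinP.
  rewrite (lam3_tonelli mGE); last by move=> w; rewrite lee_fin.
  rewrite -[RHS](intN u1.1.1); apply: eq_integral => x _.
  rewrite -[RHS](scale _ u1.1.2 (N0 _ _)); apply: eq_integral => y _.
  exact: (scale _ _ (mulr_ge0 (N0 _ _) (N0 _ _))).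
pose c := m1 / (2 * pi * th1); pose c0 := c `^ (3 / 2).
pose pk := normal_peak s; have pk0 : 0 < pk by rewrite normal_peak_gt0// gt_eqF.
(* From |w|^2 <= 2 |w - u1|^2 + 2 |u1|^2: the summand 8 / a times a X / 4 supplies the term 2 X. *)
pose D := 1 + 2 * dot u1 u1 + 8 / a.
have c00 : 0 <= c0 by exact: powR_ge0.
have D0 : 0 < D.
  have : 0 < 8 / a by rewrite divr_gt0.
  by have := dot_ge0 u1; rewrite /D; lra.
pose C := c0 * D ^+ 2 / pk ^+ 3.
have C0 : 0 <= C.
  by rewrite divr_ge0 ?exprn_ge0 ?(ltW pk0)// mulr_ge0// sqr_ge0.
suff bound w : W w ^+ 2 * M1 w <= C * G w.
  apply: (@le_lt_trans _ _ (\int[mu3]_w (C * G w)%:E)%E).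
    apply: ge0_le_integral => //.
    - by move=> w _; rewrite lee_fin mulr_ge0 ?sqr_ge0 ?M1_ge0.
    - by apply/measurable_EFinP; exact: measurable_WM.
    - by apply/measurable_EFinP; apply: measurable_funM.
    - by move=> w _; rewrite lee_fin.
  apply: (@le_lt_trans _ _ (C%:E * \int[mu3]_w (G w)%:E)%E).
    by rewrite (ge0_mule_integral_EFin mu3 C0 mG G0).
  by rewrite intG mule1 ltry.
set X := dot (vsub w u1) (vsub w u1); have X0 : 0 <= X by exact: dot_ge0.
have M1E : M1 w = c0 * expR (- (a * X)).
  rewrite /Defs.M1 -/c -/c0 sqr_vnorm -/X; congr (_ * expR _).
  by rewrite /a mulNr mulrAC.
have GE : G w = pk ^+ 3 * expR (- (a * X / 2)).
  have NE i x : N i x = pk * expR (- (x - i) ^+ 2 / (a^-1 *+ 2)).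
    by rewrite /N normal_pdfE ?gt_eqF// /normal_fun s2.
  rewrite /G !NE.
  have -> : - (a * X / 2) = - (w.1.1 - u1.1.1) ^+ 2 / (a^-1 *+ 2) +
      - (w.1.2 - u1.1.2) ^+ 2 / (a^-1 *+ 2) + - (w.2 - u1.2) ^+ 2 / (a^-1 *+ 2).
    rewrite /X /vsub /vadd /vscale /dot/= -mulr_natr; field; lra.
  by rewrite !expRD; ring.
have WX : W w <= D * (1 + a * X / 4).
  have : W w <= 1 + (2 * X + 2 * dot u1 u1).
    rewrite lerD2l; have := dot_vsub_le (vsub w u1) (vscale (-1) u1).
    have -> : vsub (vsub w u1) (vscale (-1) u1) = w.
      by rewrite /vsub /vadd /vscale/=; case: w {X X0 M1E GE} => [[? ?] ?] /=;
        congr (_, _, _); ring.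
    have -> : dot (vscale (-1) u1) (vscale (-1) u1) = dot u1 u1.
      by rewrite /vscale /dot/=; ring.
    by [].
  move=> /le_trans; apply; rewrite /D.
  have aX : 0 <= a * X by rewrite mulr_ge0// ltW.
  have u0 := dot_ge0 u1.
  have -> : (1 + 2 * dot u1 u1 + 8 / a) * (1 + a * X / 4) =
     1 + 2 * dot u1 u1 + 8 / a + (1 + 2 * dot u1 u1) * (a * X) / 4 + 2 * X.
    by field; rewrite gt_eqF.
  have : 0 <= 8 / a by rewrite divr_ge0// ltW.
  have : 0 <= (1 + 2 * dot u1 u1) * (a * X) / 4.
    by rewrite divr_ge0// mulr_ge0// addr_ge0// mulr_ge0.
  lra.
have W2 : W w ^+ 2 <= D ^+ 2 * expR (a * X / 2).
  have aX : 0 <= a * X / 4 by rewrite divr_ge0// mulr_ge0// ltW.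
  have H : 1 + a * X / 4 <= expR (a * X / 4) by exact: expR_ge1Dx.
  have -> : expR (a * X / 2) = expR (a * X / 4) ^+ 2.
    by rewrite expr2 -expRD; congr expR; field.
  rewrite -exprMn; apply: lerXn2r; rewrite ?nnegrE ?W_ge0//.
    by rewrite mulr_ge0 ?expR_ge0// ltW.
  by apply: (le_trans WX); rewrite ler_pM2l.
rewrite M1E GE /C.
have -> : c0 * D ^+ 2 / pk ^+ 3 * (pk ^+ 3 * expR (- (a * X / 2))) =
    c0 * (D ^+ 2 * expR (a * X / 2)) * expR (- (a * X)).
  have -> : expR (- (a * X / 2)) = expR (a * X / 2) * expR (- (a * X)).
    by rewrite -expRD; congr expR; field.
  by field; rewrite gt_eqF.
rewrite mulrCA mulrA; apply: ler_wpM2r; first exact: expR_ge0.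
by apply: ler_wpM2l.
Qed.

(** The weight is squared because one factor [W w] bounds the relative speed and a second one the
    energy received from the background particle. *)
Definition moment : \bar R := (\int[mu6]_p (chi p.2 * (W p.1 ^+ 2 * M1 p.1))%:E)%E.

Lemma moment_fin_num : moment \is a fin_num.
Proof.
have mWM := measurable_WM; have mc := @measurable_chi R.
have WM0 w : 0 <= W w ^+ 2 * M1 w by rewrite mulr_ge0 ?sqr_ge0 ?M1_ge0.
rewrite ge0_fin_numE; last first.
  by apply: integral_ge0 => p _; rewrite lee_fin mulr_ge0 ?chi_ge0.
rewrite /moment lam6_tonelli; last 2 first.
- mfun1; apply: measurable_funM; first by mfun.
  exact: (measurableT_comp mWM measurable_fst).
- by move=> p; rewrite lee_fin mulr_ge0 ?chi_ge0.
rewrite (_ : integral _ _ _ =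
    \int[mu3]_w ((W w ^+ 2 * M1 w)%:E * \int[mu3]_y (chi y)%:E))%E; last first.
  apply: eq_integral => w _.
  transitivity (\int[mu3]_y (W w ^+ 2 * M1 w * chi y)%:E)%E.
    by apply: eq_integral => y _; rewrite mulrC.
  exact/esym/(ge0_mule_integral_EFin mu3 (WM0 w) mc (@chi_ge0 R)).
have b0 : (0 <= \int[mu3]_y (chi y)%:E)%E.
  by apply: integral_ge0 => y _; rewrite lee_fin chi_ge0.
have bE : (\int[mu3]_y (chi y)%:E)%E = (fine (\int[mu3]_y (chi y)%:E)%E)%:E.
  by rewrite fineK// ge0_fin_numE// integral_chi_lty.
rewrite bE; set b := fine _; have {}b0 : 0 <= b by exact: fine_ge0.
apply: (@le_lt_trans _ _ (b%:E * \int[mu3]_w (W w ^+ 2 * M1 w)%:E)%E).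
  rewrite (ge0_mule_integral_EFin mu3 b0 mWM WM0).
  by under [leRHS]eq_integral do rewrite mulrC EFinM.
by rewrite lte_mul_pinfty// ?lee_fin// ?fin_numE// gaussian_moment.
Qed.

End drift.

(** * Mass balance, drift inequality and linearity of [K] *)

Section gain_operator.
Variables (R : realType) (m m1 eps th1 : R) (u1 : vec R).
Hypotheses (m_gt0 : 0 < m) (m1_gt0 : 0 < m1) (eps_gt0 : 0 < eps)
  (eps_lt1 : eps < 1) (th1_gt0 : 0 < th1).
Implicit Types (v w n y : vec R) (F : vec R -> R) (f : fn R).
Local Notation mu3 := (@lam3 R).
Local Notation mu6 := (@lam6 R).
Local Notation M1 := (M1 m1 th1 u1).
Local Notation sigma := (sigma m1 th1 u1).
Local Notation Kop := (Kop m m1 eps th1 u1).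
Local Notation dualK := (dual m m1 eps th1 u1).
Local Notation IDK := (ID m m1 eps th1 u1).
Local Notation IKK := (IK m m1 eps th1 u1).
Local Notation gainK := (gain m m1 eps th1 u1).
Local Notation moment := (moment m1 th1 u1).
Local Notation dissipation := (dissipation m m1 eps).

Let cM : R := fine moment.

Let momentE : moment = cM%:E.
Proof. by rewrite /cM fineK// moment_fin_num. Qed.

Let mom_ge0 (p : phase R) : 0 <= chi p.2 * (W p.1 ^+ 2 * M1 p.1).
Proof.
apply: mulr_ge0; first exact: chi_ge0.
by apply: mulr_ge0; [exact: sqr_ge0|exact: M1_ge0].
Qed.

Let cM_ge0 : 0 <= cM.
Proof. by apply/fine_ge0/integral_ge0 => p _; rewrite lee_fin. Qed.

Let measurable_mom : measurable_fun setT
  (fun p : phase R => chi p.2 * (W p.1 ^+ 2 * M1 p.1)).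
Proof.
have mWM := measurable_WM m1 th1 u1; have mc := @measurable_chi R.
apply: measurable_funM; first by mfun.
exact: (measurableT_comp mWM measurable_fst).
Qed.

Let scaled_moment (k : R) : 0 <= k ->
  (\int[mu6]_p (k * (chi p.2 * (W p.1 ^+ 2 * M1 p.1)))%:E = (k * cM)%:E)%E.
Proof.
by move=> k0; rewrite EFinM -momentE;
  exact/esym/(ge0_mule_integral_EFin mu6 k0 measurable_mom mom_ge0).
Qed.

Let dual1_le v p :
  dualK (fun=> 1%R) v p <= 2 * W v * (chi p.2 * (W p.1 ^+ 2 * M1 p.1)).
Proof.
rewrite /dual; have [[chi1 /andP[y0 _]]|->] := chi01 p.2; last by rewrite !mul0r mulr0.
rewrite chi1 !mul1r mulr1 mulrA; apply: ler_wpM2r; first exact: M1_ge0.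
apply: (le_trans (relative_speed_le v p.1 (dot_unitv y0))).
have := W_ge1 p.1; have := W_ge0 v; move: (W v) (W p.1) => a b a0 b1.
have b1' : 0 <= b - 1 by rewrite subr_ge0.
have := mulr_ge0 a0 (mulr_ge0 (le_trans ler01 b1) b1'); rewrite expr2; lra.
Qed.

Let dualW_le v p : dualK (@W R) v p <= W v * dualK (fun=> 1%R) v p +
  dissipation * 2 * W v * (chi p.2 * (W p.1 ^+ 2 * M1 p.1)).
Proof.
rewrite /dual; have [[chi1 /andP[y0 _]]|->] := chi01 p.2; last by rewrite !mul0r !mulr0 addr0.
rewrite chi1 !mul1r mulr1.
have n1 := dot_unitv y0; set n := unitv p.2 in n1 *.
have H1 := W_vpre_le m_gt0 m1_gt0 eps_gt0 eps_lt1 v p.1 n1.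
have H2 : dot p.1 n ^+ 2 <= W p.1.
  by apply: (le_trans (sqr_dot_unit_le _ n1)); rewrite lerDr.
have H3 := relative_speed_le v p.1 n1.
have d0 := dissipation_ge0 m_gt0 m1_gt0 eps_gt0 eps_lt1.
have Wv := W_ge0 v; have Ww := W_ge0 p.1; have M0 := M1_ge0 m1 th1 u1 p.1.
move: (M1 p.1) M0 => M M0.
rewrite !mulrA -mulrDl; apply: ler_wpM2r => //.
set s := `|_| in H3 *; have s0 : 0 <= s by exact: normr_ge0.
apply: (@le_trans _ _ (s * (W v + dissipation * W p.1))).
  apply: ler_wpM2l => //; apply: (le_trans H1).
  by rewrite lerD2l; exact: ler_wpM2l.
have := ler_wpM2r (mulr_ge0 d0 Ww) H3.
have E (A B D r : R) : r * (D * B) <= 2 * A * B * (D * B) ->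
    r * (A + D * B) <= A * r + D * 2 * A * B * B by move=> H; lra.
exact: E.
Qed.

Let measurable_dual1 v F : measurable_fun setT F -> measurable_fun setT (dualK F v).
Proof.
move=> mF; exact: (measurableT_comp (measurable_dual m m1 eps th1 u1 mF) (pair1_measurable v)).
Qed.

Let ID1_le v : (IDK (fun=> 1%R) v <= (2 * W v * cM)%:E)%E.
Proof.
rewrite -scaled_moment; last by rewrite mulr_ge0// W_ge0.
apply: ge0_le_integral; first exact: measurableT.
- by move=> p _; rewrite lee_fin dual_ge0.
- by apply/measurable_EFinP; apply: measurable_dual1; exact: measurable_cst.
- by apply/measurable_EFinP; apply: measurable_funM.
- by move=> p _; rewrite lee_fin.
Qed.

(** The Gaussian moment makes the integral finite, so [fine] loses nothing in the definition of
    [sigma]. *)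
Lemma sigma_EFin v : (sigma v)%:E = (3%:E * IDK (fun=> 1%R) v)%E.
Proof.
rewrite (sigmaE m m1 eps) EFinM fineK// ge0_fin_numE; last exact: ID_ge0.
by apply: (le_lt_trans (ID1_le v)); rewrite ltry.
Qed.

Lemma sigma_ge0 v : 0 <= sigma v.
Proof.
by rewrite -lee_fin sigma_EFin mule_ge0// ?lee_fin// ID_ge0.
Qed.

Lemma sigma_le v : sigma v <= 6 * cM * W v.
Proof.
rewrite -lee_fin sigma_EFin.
apply: (@le_trans _ _ (3%:E * (2 * W v * cM)%:E)%E).
  by apply: lee_wpmul2l => //; rewrite lee_fin.
by rewrite -EFinM lee_fin; lra.
Qed.

Lemma measurable_sigma : measurable_fun setT sigma.
Proof.
rewrite (_ : sigma = fun v => 3 * fine (IDK (fun=> 1%R) v)); last first.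
  by apply/funext => v; exact: sigmaE.
apply: measurable_funM; first exact: measurable_cst.
apply: (measurableT_comp (@fine_measurable R setT measurableT)).
exact: measurable_ID.
Qed.

(** The term sigma W appears with coefficient exactly 1, and the remainder is a constant multiple of
    W. In that constant, 6 is the sphere normalisation 3 times the 2 of [relative_speed_le]. *)
Lemma ID_W_le v :
  (3%:E * IDK (@W R) v <= ((sigma v + 6 * dissipation * cM) * W v)%:E)%E.
Proof.
have mW := @measurable_W R; have W0 := @W_ge0 R.
have d0 := dissipation_ge0 m_gt0 m1_gt0 eps_gt0 eps_lt1.
have k0 : 0 <= dissipation * 2 * W v by apply: mulr_ge0 => //; exact: mulr_ge0.
have H : (IDK (@W R) v <= (W v)%:E * IDK (fun=> 1%R) v + (dissipation * 2 * W v * cM)%:E)%E.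
  rewrite -scaled_moment//.
  have md1 : measurable_fun setT (dualK (fun=> 1%R) v).
    by apply: measurable_dual1; exact: measurable_cst.
  have d10 p : 0 <= dualK (fun=> 1%R) v p by exact: dual_ge0.
  rewrite /ID (ge0_mule_integral_EFin mu6 (W0 v) md1 d10) -ge0_integralD//; last 4 first.
  - by move=> p _; rewrite lee_fin mulr_ge0.
  - by apply/measurable_EFinP; apply: measurable_funM.
  - by move=> p _; rewrite lee_fin; exact: mulr_ge0 k0 (mom_ge0 _).
  - by apply/measurable_EFinP; apply: measurable_funM.
  apply: ge0_le_integral; first exact: measurableT.
  - by move=> p _; rewrite lee_fin dual_ge0.
  - by apply/measurable_EFinP; exact: measurable_dual1.
  - apply/measurable_EFinP; apply: measurable_funD; exact: measurable_funM.
  - by move=> p _; rewrite -EFinD lee_fin dualW_le.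
apply: (@le_trans _ _ (3%:E * ((W v)%:E * IDK (fun=> 1%R) v +
    (dissipation * 2 * W v * cM)%:E))%E).
  by apply: lee_wpmul2l => //; rewrite lee_fin.
rewrite ge0_muleDr; [|by rewrite mule_ge0 ?lee_fin ?ID_ge0|by rewrite lee_fin mulr_ge0].
rewrite muleCA -sigma_EFin -!EFinM -EFinD lee_fin; lra.
Qed.

Lemma Kop_ge0 f z : (forall z, 0 <= f z) -> 0 <= Kop f z.
Proof.
move=> f0; rewrite KopE; apply: mulr_ge0; first by rewrite invr_ge0 sqr_ge0.
by apply: mulr_ge0; [by []|apply/fine_ge0; exact: IK_ge0].
Qed.

Lemma measurable_Kop f : measurable_fun setT f -> (forall z, 0 <= f z) ->
  measurable_fun setT (Kop f).
Proof.
move=> mf f0; rewrite (_ : Kop f = fun z => eps ^- 2 * (3 * fine (IKK f z))); last first.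
  by apply/funext => z; exact: KopE.
do 2 (apply: measurable_funM; first exact: measurable_cst).
apply: (measurableT_comp (@fine_measurable R setT measurableT)).
exact: measurable_IK.
Qed.

Let ec0 : 0 <= 3 * eps ^- 2. Proof. by rewrite mulr_ge0// invr_ge0 sqr_ge0. Qed.

(** The prefactor eps^-2 of [K] cancels the eps^2 of the adjoint relation. Taking F = 1 gives mass
    balance, F = W the drift inequality. *)
Lemma gain_adjoint_sigma F f : measurable_fun setT F -> (forall v, 0 <= F v) ->
  measurable_fun setT f -> (forall z, 0 <= f z) ->
  ((3 * eps ^- 2)%:E * \int[mu6]_z ((F z.2)%:E * IKK f z) =
   3%:E * \int[mu6]_z ((f z)%:E * IDK F z.2))%E.
Proof.
move=> mF F0 mf f0; have E := gain_adjoint th1 u1 m_gt0 m1_gt0 eps_gt0 mF F0 mf f0.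
rewrite [X in (_ * X)%E = _]E.
by rewrite muleA -EFinM divfK// expf_neq0// gt_eqF.
Qed.

Lemma integral_IK f : measurable_fun setT f -> (forall z, 0 <= f z) ->
  ((3 * eps ^- 2)%:E * \int[mu6]_z IKK f z = \int[mu6]_z (sigma z.2 * f z)%:E)%E.
Proof.
move=> mf f0; have m1c : measurable_fun setT (fun _ : vec R => 1 : R) by exact: measurable_cst.
rewrite (_ : integral _ _ _ = \int[mu6]_z (((fun=> 1%R) z.2 : R)%:E * IKK f z))%E; last first.
  by apply: eq_integral => z _; rewrite mul1e.
rewrite (gain_adjoint_sigma m1c (fun=> ler01) mf f0).
have mID : measurable_fun setT (fun z : phase R => (f z)%:E * IDK (fun=> 1%R) z.2)%E.
  apply: emeasurable_funM; first exact/measurable_EFinP.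
  apply: (measurableT_comp (measurable_ID m m1 eps th1 u1 m1c (fun=> ler01))).
  exact: measurable_snd.
have ID0 (z : phase R) : (0 <= (f z)%:E * IDK (fun=> 1%R) z.2)%E.
  by rewrite mule_ge0 ?lee_fin ?ID_ge0.
have h3 : (0 : R) <= 3 by [].
rewrite (ge0_mule_integral mu6 h3 mID ID0).
by apply: eq_integral => z _; rewrite muleCA -sigma_EFin -EFinM mulrC.
Qed.

Lemma IK_ae_fin f : measurable_fun setT f -> (forall z, 0 <= f z) ->
  (\int[mu6]_z (sigma z.2 * f z)%:E < +oo)%E ->
  {ae mu6, forall z, IKK f z \is a fin_num}.
Proof.
move=> mf f0 fy; have mI := measurable_IK m m1 eps th1 u1 mf f0.
have I0 z : (0 <= IKK f z)%E by exact: IK_ge0.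
have iI : mu6.-integrable setT (IKK f).
  apply/integrableP; split => //.
  under eq_integral do rewrite gee0_abs//.
  rewrite ltey; apply: contraTneq fy => Iy; rewrite -(integral_IK mf f0) Iy.
  by rewrite gt0_muley ?ltxx// lte_fin mulr_gt0// invr_gt0 exprn_gt0.
by have := integrable_ae measurableT iI; apply: filterS => z; exact.
Qed.

Lemma integral_Kop f : measurable_fun setT f -> (forall z, 0 <= f z) ->
  (\int[mu6]_z (sigma z.2 * f z)%:E < +oo)%E ->
  (\int[mu6]_z (Kop f z)%:E = \int[mu6]_z (sigma z.2 * f z)%:E)%E.
Proof.
move=> mf f0 fy; rewrite -(integral_IK mf f0).
have mI := measurable_IK m m1 eps th1 u1 mf f0.
have I0 z : (0 <= IKK f z)%E by exact: IK_ge0.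
rewrite (ge0_mule_integral mu6 ec0 mI I0).
apply: ge0_ae_eq_integral; first exact: measurableT.
- by apply/measurable_EFinP; exact: measurable_Kop.
- by apply: emeasurable_funM => //; exact: measurable_cst.
- by move=> z _; rewrite lee_fin Kop_ge0.
- by move=> z _; rewrite mule_ge0// lee_fin.
have := IK_ae_fin mf f0 fy; apply: filterS => z Iz _.
by rewrite KopE mulrCA mulrA !EFinM fineK.
Qed.

Lemma integral_W_Kop_le f : measurable_fun setT f -> (forall z, 0 <= f z) ->
  (\int[mu6]_z (W z.2 * Kop f z)%:E <=
   \int[mu6]_z ((sigma z.2 + 6 * dissipation * cM) * W z.2 * f z)%:E)%E.
Proof.
move=> mf f0; have mI := measurable_IK m m1 eps th1 u1 mf f0.
have I0 z : (0 <= IKK f z)%E by exact: IK_ge0.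
have mW := @measurable_W R; have W0 := @W_ge0 R.
have mW2 : measurable_fun setT (fun z : phase R => W z.2) by mfun.
have msg := measurable_sigma.
have mWI : measurable_fun setT (fun z : phase R => (W z.2)%:E * IKK f z)%E.
  by apply: emeasurable_funM => //; exact/measurable_EFinP.
have WI0 z : (0 <= (W z.2)%:E * IKK f z)%E by rewrite mule_ge0// lee_fin.
have c0 : 0 <= 6 * dissipation * cM.
  by do 2 apply: mulr_ge0 => //; exact: dissipation_ge0.
apply: (@le_trans _ _ ((3 * eps ^- 2)%:E * \int[mu6]_z ((W z.2)%:E * IKK f z))%E).
  rewrite (ge0_mule_integral mu6 ec0 mWI WI0).
  apply: ge0_le_integral; first exact: measurableT.
  - by move=> z _; rewrite lee_fin mulr_ge0// Kop_ge0.
  - by apply/measurable_EFinP; apply: measurable_funM => //; exact: measurable_Kop.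
  - by apply: emeasurable_funM => //; exact: measurable_cst.
  move=> z _; rewrite EFinM muleCA; apply: lee_wpmul2l; first by rewrite lee_fin.
  rewrite KopE mulrCA mulrA EFinM; apply: lee_wpmul2l; first by rewrite lee_fin.
  (* Where [IKK f z] is infinite, [fine] returns 0, which stays below it. *)
  by case: (IKK f z) (I0 z) => //= r _; rewrite leey.
rewrite (gain_adjoint_sigma mW W0 mf f0).
have mID : measurable_fun setT (fun z : phase R => (f z)%:E * IDK (@W R) z.2)%E.
  apply: emeasurable_funM; first exact/measurable_EFinP.
  apply: (measurableT_comp (measurable_ID m m1 eps th1 u1 mW W0)).
  exact: measurable_snd.
have ID0 (z : phase R) : (0 <= (f z)%:E * IDK (@W R) z.2)%E.
  by rewrite mule_ge0 ?lee_fin ?ID_ge0.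
have h3 : (0 : R) <= 3 by [].
rewrite (ge0_mule_integral mu6 h3 mID ID0).
apply: ge0_le_integral; first exact: measurableT.
- by move=> z _; rewrite mule_ge0// lee_fin.
- by apply: emeasurable_funM => //; exact: measurable_cst.
- apply/measurable_EFinP; mfun.
move=> z _; rewrite muleCA (mulrC _ (f z)) [leRHS]EFinM.
by apply: lee_wpmul2l; [rewrite lee_fin|exact: ID_W_le].
Qed.

(** Additivity requires the collision integral to converge absolutely. This holds almost everywhere,
    because integrability of sigma |f| makes the gain of |f| finite almost everywhere. *)
Lemma Kop_linear (a b : R) f1 f2 : L1 f1 -> L1 f2 ->
  L1 (fun z => sigma z.2 * f1 z) -> L1 (fun z => sigma z.2 * f2 z) ->
  aeq (Kop (fun z => a * f1 z + b * f2 z)) (fun z => a * Kop f1 z + b * Kop f2 z).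
Proof.
have gain_int f : L1 f -> L1 (fun z => sigma z.2 * f z) ->
    {ae mu6, forall z, mu6.-integrable setT (fun p => (gainK f z p)%:E)}.
  move=> Lf Lsf; have mf := L1_measurable Lf.
  have mnf : measurable_fun setT (fun z => `|f z|) by mfun.
  have := @IK_ae_fin (fun z => `|f z|) mnf (fun=> normr_ge0 _).
  have -> : (\int[mu6]_z (sigma z.2 * `|f z|)%:E =
      \int[mu6]_z `|sigma z.2 * f z|%:E)%E.
    by apply: eq_integral => z _; rewrite normrM (ger0_norm (sigma_ge0 _)).
  move=> /(_ (L1_lt_pinfty Lsf)); apply: filterS => z.
  rewrite ge0_fin_numE; last exact: IK_ge0.
  move=> IKy; apply/integrableP; split.
    apply/measurable_EFinP.
    exact: (measurableT_comp (measurable_gain m m1 eps th1 u1 mf) (pair1_measurable z)).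
  rewrite (_ : integral _ _ _ = IKK (fun z => `|f z|) z)//.
  apply: eq_integral => p _; rewrite /gain.
  have := M1_ge0 m1 th1 u1 (wstar m m1 eps z.2 p.1 (unitv p.2)).
  move: (M1 _) => M M0; rewrite abse_EFin !normrM normr_id.
  by rewrite (ger0_norm (chi_ge0 _)) (ger0_norm M0).
move=> L1f L2f L1s L2s; have := gain_int _ L1f L1s; have := gain_int _ L2f L2s.
apply: filterS2 => z i2 i1; rewrite !KopE.
have -> : fine (IKK (fun z => a * f1 z + b * f2 z) z) =
    a * fine (IKK f1 z) + b * fine (IKK f2 z).
  rewrite /IK -!/(Rintegral _ _ _) -(RintegralZl _ measurableT i1).
  rewrite -(RintegralZl _ measurableT i2) -RintegralD//.
  - by apply: eq_Rintegral => p _; rewrite /gain; ring.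
  - exact: (integrableZl measurableT a i1).
  - exact: (integrableZl measurableT b i2).
ring.
Qed.

End gain_operator.

(** * Borel measurability of continuous functions on phase space *)

Section countable_base.

(** The neighbourhood filters are an explicit argument, so that nested pairs are reached by repeated
    use of product filters. *)
Definition countable_base (T : Type) (nb : T -> set_system T) (M : set (set T)) :=
  exists (I : countType) (b : I -> set T), (forall i, M (b i)) /\
    forall x U, nb x U -> exists2 i, b i x & b i `<=` U.

Lemma countable_base_prod (T1 T2 : Type) (nb1 : T1 -> set_system T1)
    (nb2 : T2 -> set_system T2) M1 M2 (M : set (set (T1 * T2))) :
  (forall A B, M1 A -> M2 B -> M (A `*` B)) ->
  countable_base nb1 M1 -> countable_base nb2 M2 ->
  countable_base (fun x => filter_prod (nb1 x.1) (nb2 x.2)) M.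
Proof.
move=> M12 [I1 [b1 [Mb1 base1]]] [I2 [b2 [Mb2 base2]]].
exists (I1 * I2)%type, (fun i => b1 i.1 `*` b2 i.2); split.
  by move=> i; exact: M12.
move=> [x y] U [[A B] /= [nA nB] AB].
have [i b1x b1A] := base1 _ _ nA; have [j b2y b2B] := base2 _ _ nB.
by exists (i, j) => // -[x' y'] [/= b1x' b2y']; apply: AB; split; [exact: b1A|exact: b2B].
Qed.

Lemma countable_base_real (R : realType) :
  countable_base (fun x : R => nbhs x) (fun A => measurable A).
Proof.
exists (rat * rat)%type, (fun i => `]ratr i.1, ratr i.2[%classic : set R); split => //.
move=> x U /nbhs_ballP[e /= e0 eU].
have xe1 : x - e < x by rewrite ltrBlDr ltrDl.
have xe2 : x < x + e by rewrite ltrDl.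
have [p] := rat_in_itvoo xe1; have [q] := rat_in_itvoo xe2.
rewrite !in_itv/= => /andP[xq qe] /andP[ep px].
exists (p, q); first by rewrite /= in_itv/= px xq.
move=> y /=; rewrite in_itv/= => /andP[py yq]; apply: eU.
by rewrite /ball/= ltr_distlC (lt_trans ep py) (lt_trans yq qe).
Qed.

Lemma countable_base_measurable d (T : measurableType d) (R : realType)
    (nb : T -> set_system T) (f : T -> R) :
  countable_base nb measurable ->
  (forall x U, nbhs (f x) U -> nb x (f @^-1` U)) -> measurable_fun setT f.
Proof.
move=> [I [b [mb base]]] cf; apply: (measurability _ (RGenOpens.measurableE R)).
move=> _ [_ [l [r ->] <-]]; rewrite setTI.
set P := f @^-1` _.
(* Base sets not contained in [P] are replaced by [set0], which keeps the union indexed by the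
   countable type [I]. *)
have -> : P = \bigcup_i (if `[< b i `<=` P >] then b i else set0).
  apply/seteqP; split => x.
    move=> Px; have [|i bix biP] := base x P.
      by apply: cf; apply: open_nbhs_nbhs; split => //; exact: interval_open.
    by exists i => //; case: asboolP.
  by move=> [i _]; case: asboolP => // biP bix; exact: biP.
apply: countable_bigcupT_measurable => [|i]; first exact: countableP.
by case: ifP.
Qed.

Lemma continuous_phase_measurable (R : realType) (f : fn R) :
  continuous f -> measurable_fun setT f.
Proof.
move=> cf; suff base : countable_base (fun z : phase R => nbhs z) (fun A => measurable A).
  by apply: (countable_base_measurable base) => z U; exact: cf.
have BR := countable_base_real R.
have B3 : countable_base (fun v : vec R => nbhs v) (fun A => measurable A).
  apply: (@countable_base_prod _ _ (fun v : R * R => nbhs v) (fun v : R => nbhs v)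
    (fun A => measurable A) (fun A => measurable A)) => //.
    by move=> A B mA mB; exact: measurableX.
  apply: (@countable_base_prod _ _ (fun v : R => nbhs v) (fun v : R => nbhs v)
    (fun A => measurable A) (fun A => measurable A)) => //.
  by move=> A B mA mB; exact: measurableX.
apply: (@countable_base_prod _ _ (fun v : vec R => nbhs v) (fun v : vec R => nbhs v)
    (fun A => measurable A) (fun A => measurable A)) => //.
by move=> A B mA mB; exact: measurableX.
Qed.

End countable_base.

(** * Test functions along free-streaming characteristics *)

Section test_functions.
Variable R : realType.
Implicit Types (phi : fn R) (z : phase R).

Definition line z (s : R) : phase R := (vadd z.1 (vscale s z.2), z.2).

Lemma line_add z s h : line (line z s) h = line z (s + h).
Proof.
by rewrite /line /vadd /vscale/=; congr (_, _, _, _); ring.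
Qed.

Lemma continuous_line z : continuous (line z).
Proof.
move=> s; have c (a b : R) : (a + r * b) @[r --> s] --> a + s * b.
  by apply: cvgD; [exact: cvg_cst|apply: cvgM; [exact: cvg_id|exact: cvg_cst]].
rewrite /continuous_at /line /vadd /vscale/=.
apply: (@cvg_pair _ _ _ (nbhs s) (nbhs _) (nbhs _)); last exact: cvg_cst.
apply: (@cvg_pair _ _ _ (nbhs s) (nbhs _) (nbhs _)); last exact: c.
by apply: (@cvg_pair _ _ _ (nbhs s) (nbhs _) (nbhs _)); exact: c.
Qed.

(** Shows that a test function vanishes on a whole piece of the line through a point outside its
    box, hence that its streaming derivative vanishes there too. *)
Lemma supnorm_gt z (r : R) : r < supnorm z ->
  \forall s \near (0 : R), r < supnorm (line z s).
Proof.
have c (a b : R) : r < `|a| -> \forall s \near (0 : R), r < `|a + s * b|.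
  move=> ra; have : `|a + s * b| @[s --> (0 : R)] --> `|a|.
    rewrite -{2}[a]addr0 -[X in a + X](mul0r b); apply: cvg_norm.
    by apply: cvgD; [exact: cvg_cst|apply: cvgM; [exact: cvg_id|exact: cvg_cst]].
  by move=> ab; exact: (@cvgr_gt _ _ (nbhs (0 : R)) _ (fun s => `|a + s * b|) _ ab _ ra).
rewrite /supnorm !lt_max => /orP[/orP[/orP[]|]|/orP[/orP[]|]] rz.
- by apply: (@filterS _ (nbhs (0 : R)) _ _ _ _ (c _ z.2.1.1 rz)) => s rs; rewrite !lt_max rs.
- by apply: (@filterS _ (nbhs (0 : R)) _ _ _ _ (c _ z.2.1.2 rz)) => s rs; rewrite !lt_max rs ?orbT.
- by apply: (@filterS _ (nbhs (0 : R)) _ _ _ _ (c _ z.2.2 rz)) => s rs; rewrite !lt_max rs ?orbT.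
- by apply: (@nearW _ (nbhs (0 : R))) => s; rewrite !lt_max/= rz ?orbT.
- by apply: (@nearW _ (nbhs (0 : R))) => s; rewrite !lt_max/= rz ?orbT.
- by apply: (@nearW _ (nbhs (0 : R))) => s; rewrite !lt_max/= rz ?orbT.
Qed.

Lemma Dv_supp phi (r : R) : (forall z, r < supnorm z -> phi z = 0) ->
  forall z, r < supnorm z -> Dv phi z = 0.
Proof.
move=> phi0 z rz; rewrite /Dv (@near_eq_derive _ _ _ _ (cst 0)); first exact: derive_cst.
by apply: (@filterS _ (nbhs (0 : R)) _ _ _ _ (supnorm_gt rz)) => s; exact: phi0.
Qed.

Lemma compact_supp_bounded (g : fn R) (r : R) : continuous g ->
  (forall z, r < supnorm z -> g z = 0) -> exists M : R, forall z, `|g z| <= M.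
Proof.
move=> cg g0; pose I := `[- r, r]%classic : set R.
pose B3 : set (vec R) := (I `*` I) `*` I; pose B := B3 `*` B3.
have cI : compact I by exact: segment_compact.
have cB3 : compact B3 by do 2 (apply: compact_setX => //).
have cB : compact B by exact: compact_setX.
have cgB : compact (g @` B) by apply: continuous_compact => //; exact: continuous_subspaceT.
have [M [_ gM]] := compact_bounded cgB; exists (Num.max 0 (M + 1)) => z.
have [rz|zr] := ltP r (supnorm z); first by rewrite g0// normr0 le_max lexx.
rewrite le_max; apply/orP; right.
apply: (gM (M + 1)); first by rewrite ltrDl.
exists z => //; move: zr; rewrite /supnorm !ge_max.
move=> /andP[/andP[/andP[h1 h2] h3] /andP[/andP[h4 h5] h6]].
by do !split; rewrite /= /I /= in_itv/= -ler_norml.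
Qed.

Lemma test_fn_bounded phi : test_fn phi ->
  exists M : R, [/\ 0 < M, (forall z, `|phi z| <= M) & forall z, `|Dv phi z| <= M].
Proof.
move=> [[r phi0] [cphi [_ cD]]].
have [M1 h1] := compact_supp_bounded cphi phi0.
have [M2 h2] := compact_supp_bounded cD (Dv_supp phi0).
exists (`|M1| + `|M2| + 1); split.
- by rewrite ltr_wpDl// addr_ge0.
- move=> z; apply: (le_trans (h1 z)); apply: (le_trans (ler_norm _)).
  by rewrite -addrA lerDl addr_ge0.
- move=> z; apply: (le_trans (h2 z)); apply: (le_trans (ler_norm _)).
  by rewrite addrAC lerDr addr_ge0.
Qed.

(** Differentiability of a test function is postulated at parameter 0 of each line; restarting the
    line at [line z s] gives it at every parameter. *)
Lemma is_derive_line phi z (s : R) : test_fn phi ->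
  is_derive s (1 : R) (fun t : R => phi (line z t)) (Dv phi (line z s)).
Proof.
move=> [_ [_ [dphi _]]].
pose g (h : R) := phi (line (line z s) h).
have dg : is_derive (s - s) 1 g (Dv phi (line z s)).
  by rewrite subrr; apply: DeriveDef; [exact: dphi|].
have ds : is_derive s 1 (fun t : R => t - s) 1.
  by apply: is_derive_eq; rewrite subr0.
have := @is_derive1_comp R g (fun t => t - s) s _ _ dg ds; rewrite mulr1.
rewrite (_ : g \o _ = (fun t => phi (line z t)))//.
by apply/funext => t; rewrite /g /= line_add addrCA subrr addr0.
Qed.

(** The cutoff sits in the kernel, so that time integrals run over the whole line and can be
    exchanged with those over phase space. *)
Definition expdec (k t : R) : R := \1_(`[0, +oo[%classic) t * expR (- (k * t)).

Lemma expdec_ge0 k t : 0 <= expdec k t.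
Proof. by rewrite mulr_ge0 ?expR_ge0// indicE ler0n. Qed.

Lemma integral_expdec (k : R) (g : R -> R) :
  (\int[@lebesgue_measure R]_t (expdec k t * g t)%:E =
   \int[@lebesgue_measure R]_(t in `[0%R, +oo[) (expR (- (k * t)) * g t)%:E)%E.
Proof.
rewrite [RHS]integral_mkcond; apply: eq_integral => t _.
by rewrite patchE /expdec indicE; case: ifPn => _; rewrite ?mul1r ?mul0r.
Qed.

Lemma integral_expdec1 (k : R) : 0 < k ->
  (\int[@lebesgue_measure R]_t (k * expdec k t)%:E = 1)%E.
Proof.
move=> k0; rewrite -(integral_exponential_pdf k0); apply: eq_integral => t _.
rewrite /exponential_pdf patchE /expdec indicE.
by case: ifPn => _; rewrite ?mul1r ?mul0r ?mulr0 ?mulNr.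
Qed.

Lemma cvg_expR_opp (k : R) : 0 < k -> expR (- (k * t)) @[t --> +oo] --> 0.
Proof.
move=> k0; apply: (@cvg_comp _ _ _ _ (fun x => expR (- x)) _ (pinfty_nbhs R)).
  exact: gt0_cvgMry.
exact: cvgr_expR.
Qed.

(* The integrand is minus the derivative of
   [expR (- (k * t)) * (phi + M + M / k)] along the characteristic; the shift by M
   makes it nonnegative. *)
Lemma integral_characteristic phi z (k M : R) : test_fn phi -> 0 < k ->
  (forall z, `|phi z| <= M) -> (forall z, `|Dv phi z| <= M) ->
  (\int[@lebesgue_measure R]_t (expdec k t *
     (k * (phi (line z t) + M) + (M - Dv phi (line z t))))%:E =
   (phi z + M + M / k)%:E)%E.
Proof.
move=> tphi k0 phiM DM; rewrite integral_expdec.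
have [_ [cphi [_ cD]]] := tphi.
pose c := M + M / k.
pose F (t : R) := - (expR (- (k * t)) * (phi (line z t) + c)).
have dE (t : R) : is_derive t 1 (fun t => expR (- (k * t))) (- k * expR (- (k * t))).
  have dk : is_derive t 1 (fun t : R => - (k * t)) (- k).
    by apply: is_derive_eq; rewrite /GRing.scale/=; ring.
  by have := @is_derive1_comp R expR (fun t => - (k * t)) t _ _ (is_derive_expR _) dk;
      rewrite mulrC.
have dF (t : R) : is_derive t 1 F
    (expR (- (k * t)) * (k * (phi (line z t) + M) + (M - Dv phi (line z t)))).
  have d1 := dE t; have d2 := is_derive_line z t tphi.
  by apply: is_derive_eq; rewrite /c /GRing.scale/=; field; rewrite gt_eqF.
have cE (t : R) : expR (- (k * s)) @[s --> t] --> expR (- (k * t)).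
  apply: (@cvg_comp _ _ _ (fun s : R => - (k * s)) expR); last exact: continuous_expR.
  by apply: cvgN; apply: cvgM; [exact: cvg_cst|exact: cvg_id].
rewrite (@ge0_continuous_FTC2y _ _ F 0 0).
- rewrite -EFinB; congr EFin; rewrite /F mulr0 oppr0 expR0 mul1r sub0r opprK /c.
  have -> : line z 0 = z.
    by rewrite /line /vadd /vscale; case: z {F dF dE} => [[[? ?] ?] [[? ?] ?]]/=;
      rewrite !mul0r !addr0.
  by rewrite addrA.
- move=> t _; rewrite mulr_ge0 ?expR_ge0// addr_ge0//.
    rewrite mulr_ge0 ?(ltW k0)//; have := phiM (line z t); rewrite ler_norml => /andP[+ _].
    by rewrite lerNl -subr_ge0 opprK addrC.
  by rewrite subr_ge0 (le_trans (ler_norm _)).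
- apply: continuous_subspaceT => t.
  have cl := @continuous_line z t.
  apply: cvgM.
    exact: cE.
  apply: cvgD.
    apply: cvgM; first exact: cvg_cst.
    apply: cvgD; last exact: cvg_cst.
    exact: (@cvg_comp _ _ _ (line z) phi _ _ _ cl (cphi (line z t))).
  apply: cvgB; first exact: cvg_cst.
  exact: (@cvg_comp _ _ _ (line z) (Dv phi) _ _ _ cl (cD (line z t))).
- rewrite -oppr0; apply: cvgN.
  have c1 := cvg_expR_opp k0.
  have c2 : expR (- (k * t)) * (M + c) @[t --> +oo] --> 0.
    by rewrite -[X in _ --> X](mul0r (M + c)); apply: cvgM => //; exact: cvg_cst.
  have c3 : - (expR (- (k * t)) * (M + `|c|)) @[t --> +oo] --> 0.
    rewrite -oppr0; apply: cvgN.
    by rewrite -[X in _ --> X](mul0r (M + `|c|)); apply: cvgM => //; exact: cvg_cst.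
  have c4 : (expR (- (k * t)) * (M + `|c|)) @[t --> +oo] --> 0.
    by rewrite -[X in _ --> X](mul0r (M + `|c|)); apply: cvgM => //; exact: cvg_cst.
  apply: (squeeze_cvgr _ c3 c4); apply: nearW => t.
  rewrite -mulrN !(ler_pM2l (expR_gt0 _)) -ler_norml.
  by apply: (le_trans (ler_normD _ _)); rewrite lerD2r.
- by move=> t _; have [] := dF t.
- apply: cvg_at_right_filter.
  apply: cvgN; apply: cvgM; first exact: cE.
  apply: cvgD; last exact: cvg_cst.
  exact: (@cvg_comp _ _ _ (line z) phi _ _ _ (@continuous_line z 0) (cphi (line z 0))).
- by move=> t _; rewrite derive1E; have [_ ->] := dF t.
Qed.

End test_functions.

(** * The resolvent of streaming with absorption *)

Section resolvent.
Variables (R : realType) (sg : vec R -> R) (l : R).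
Hypotheses (msg : measurable_fun setT sg) (sg0 : forall v, 0 <= sg v) (l0 : 0 < l).
Implicit Types (f psi phi : fn R) (z : phase R).
Local Notation mu6 := (@lam6 R).
Local Notation leb := (@lebesgue_measure R).

Lemma lam6_line (H : phase R -> \bar R) (t : R) : measurable_fun setT H ->
  (forall z, 0 <= H z)%E -> (\int[mu6]_z H (line z t) = \int[mu6]_z H z)%E.
Proof.
move=> mH H0.
have ml : measurable_fun setT (fun z : phase R => line z t) by rewrite /line; mfun.
have mHl : measurable_fun setT (fun z => H (line z t)) by mfun.
rewrite (lam6_tonelli_rev mHl (fun=> H0 _)) (lam6_tonelli_rev mH H0).
have key (v : vec R) : (\int[@lam3 R]_x H (line (x, v) t) = \int[@lam3 R]_x H (x, v))%E.
  have mHv : measurable_fun setT (fun x : vec R => H (x, v)).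
    exact: (measurableT_comp mH (pair2_measurable v)).
  exact: (lam3_shift (vscale t v) mHv (fun=> H0 _)).
by apply: eq_integral => v _; exact: key.
Qed.

Let kk v := l + sg v.

Let kk_gt0 v : 0 < kk v. Proof. by rewrite ltr_pwDl. Qed.

Let measurable_kk : measurable_fun setT (fun z : phase R => kk z.2).
Proof. by rewrite /kk; mfun. Qed.

Lemma measurable_expdec : measurable_fun setT (fun p : R * R => expdec p.1 p.2).
Proof.
have m1 : measurable_fun setT (\1_(`[0, +oo[%classic : set R) : R -> R).
  exact: measurable_indic.
by rewrite /expdec; mfun.
Qed.

(** Keeps the value +oo, as Tonelli requires; [resolvent] replaces it by 0, on a null set when [f]
    is nonnegative and integrable. *)
Definition Rbar f z : \bar R := (\int[leb]_t (expdec (kk z.2) t * f (line z (- t)))%:E)%E.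

Definition resolvent f : fn R := fun z => fine (Rbar f z).

Let mline : measurable_fun setT (fun zt : phase R * R => line zt.1 zt.2).
Proof. by rewrite /line; mfun. Qed.

Let mkernel psi : measurable_fun setT psi ->
  measurable_fun setT (fun zt : phase R * R => expdec (kk zt.1.2) zt.2 * psi (line zt.1 zt.2)).
Proof.
move=> mpsi; apply: measurable_funM; last exact: (measurableT_comp mpsi mline).
apply: (measurableT_comp measurable_expdec (g := fun zt : phase R * R => (kk zt.1.2, zt.2))).
by apply: measurable_fun_pair; rewrite /kk; mfun.
Qed.

Let mkernelN f : measurable_fun setT f ->
  measurable_fun setT (fun zt : phase R * R => expdec (kk zt.1.2) zt.2 * f (line zt.1 (- zt.2))).
Proof.
move=> mf; apply: measurable_funM.
  apply: (measurableT_comp measurable_expdec (g := fun zt : phase R * R => (kk zt.1.2, zt.2))).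
  by apply: measurable_fun_pair; rewrite /kk; mfun.
apply: (measurableT_comp mf).
by apply: (measurableT_comp mline (g := fun zt : phase R * R => (zt.1, - zt.2))); mfun.
Qed.

Lemma measurable_Rbar f : measurable_fun setT f -> (forall z, 0 <= f z) ->
  measurable_fun setT (Rbar f).
Proof.
move=> mf f0; apply: (@measurable_fun_integral _ _ _ _ _ leb
  (fun z t => (expdec (kk z.2) t * f (line z (- t)))%:E)).
  by apply/measurable_EFinP; exact: mkernelN.
by move=> z t; rewrite lee_fin mulr_ge0// expdec_ge0.
Qed.

Lemma Rbar_ge0 f z : (forall z, 0 <= f z) -> (0 <= Rbar f z)%E.
Proof.
by move=> f0; apply: integral_ge0 => t _; rewrite lee_fin mulr_ge0// expdec_ge0.
Qed.

(** For each t, translation along the characteristics preserves [lam6] and the velocity, hence also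
    the decay rate: streaming [f] backwards is dual to streaming [psi] forwards. *)
Lemma resolvent_pairing psi f : measurable_fun setT psi -> (forall z, 0 <= psi z) ->
  measurable_fun setT f -> (forall z, 0 <= f z) ->
  (\int[mu6]_z ((psi z)%:E * Rbar f z) =
   \int[mu6]_z ((f z)%:E * \int[leb]_t (expdec (kk z.2) t * psi (line z t))%:E))%E.
Proof.
move=> mpsi psi0 mf f0; have mk1 := mkernelN mf; have mk2 := mkernel mpsi.
have k1 z t : 0 <= expdec (kk z.2) t * f (line z (- t)) by rewrite mulr_ge0// expdec_ge0.
have k2 z t : 0 <= expdec (kk z.2) t * psi (line z t) by rewrite mulr_ge0// expdec_ge0.
have mG1 : measurable_fun setT (fun zt : phase R * R =>
    (fun z t => (psi z * (expdec (kk z.2) t * f (line z (- t))))%:E) zt.1 zt.2).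
  by apply/measurable_EFinP; apply: measurable_funM => //; mfun.
have mG2 : measurable_fun setT (fun zt : phase R * R =>
    (fun z t => (f z * (expdec (kk z.2) t * psi (line z t)))%:E) zt.1 zt.2).
  by apply/measurable_EFinP; apply: measurable_funM => //; mfun.
have G1_0 z t : (0 <= (psi z * (expdec (kk z.2) t * f (line z (- t))))%:E)%E.
  by rewrite lee_fin; exact: mulr_ge0.
have G2_0 z t : (0 <= (f z * (expdec (kk z.2) t * psi (line z t)))%:E)%E.
  by rewrite lee_fin; exact: mulr_ge0.
transitivity (\int[mu6]_z \int[leb]_t (psi z * (expdec (kk z.2) t * f (line z (- t))))%:E)%E.
  apply: eq_integral => z _.
  have mk1z : measurable_fun setT (fun t : R => expdec (kk z.2) t * f (line z (- t))).
    exact: (measurableT_comp mk1 (pair1_measurable z)).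
  exact: (ge0_mule_integral_EFin leb (psi0 z) mk1z (k1 z)).
transitivity (\int[mu6]_z \int[leb]_t (f z * (expdec (kk z.2) t * psi (line z t)))%:E)%E; last first.
  apply: eq_integral => z _.
  have mk2z : measurable_fun setT (fun t : R => expdec (kk z.2) t * psi (line z t)).
    exact: (measurableT_comp mk2 (pair1_measurable z)).
  exact/esym/(ge0_mule_integral_EFin leb (f0 z) mk2z (k2 z)).
etransitivity; first exact: (tonelli_swap mu6 leb mG1 G1_0).
etransitivity; last exact/esym/(tonelli_swap mu6 leb mG2 G2_0).
have key (t : R) : (\int[mu6]_z (psi z * (expdec (kk z.2) t * f (line z (- t))))%:E =
    \int[mu6]_z (f z * (expdec (kk z.2) t * psi (line z t)))%:E)%E.
  have mH : measurable_fun setT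
      (fun z => (psi z * (expdec (kk z.2) t * f (line z (- t))))%:E).
    exact: (measurableT_comp mG1 (pair2_measurable t)).
  rewrite -(lam6_line t mH (fun z => G1_0 z t)); apply: eq_integral => z _.
  rewrite line_add subrr.
  have -> : line z 0 = z.
    rewrite /line /vadd /vscale; case: z => [[[? ?] ?] [[? ?] ?]]/=.
    by rewrite !mul0r !addr0.
  by rewrite mulrCA [RHS]EFinM muleC -EFinM mulrA.
by apply: eq_integral => t _; exact: key.
Qed.

Section nonnegative_integrable.
Variable f : fn R.
Hypotheses (Lf : L1 f) (f0 : forall z, 0 <= f z).

Let mf : measurable_fun setT f. Proof. exact: L1_measurable. Qed.

Let f_lty : (\int[mu6]_z (f z)%:E < +oo)%E.
Proof.
have := L1_lt_pinfty Lf.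
by rewrite (_ : integral _ _ _ = \int[mu6]_z (f z)%:E)%E//; apply: eq_integral => z _;
  rewrite ger0_norm.
Qed.

(** A function of the velocity is constant along characteristics, so only the total mass 1 of the
    density k exp (- k t) is left. *)
Let Rbar_kk (F : vec R -> R) : measurable_fun setT F -> (forall v, 0 <= F v) ->
  (\int[mu6]_z ((F z.2 * kk z.2)%:E * Rbar f z) = \int[mu6]_z (F z.2 * f z)%:E)%E.
Proof.
move=> mF F0; have k0 v := ltW (kk_gt0 v).
have mFk : measurable_fun setT (fun z : phase R => F z.2 * kk z.2).
  by apply: measurable_funM => //; mfun.
have Fk0 (z : phase R) : 0 <= F z.2 * kk z.2 by exact: mulr_ge0.
rewrite (resolvent_pairing mFk Fk0 mf f0); apply: eq_integral => z _.
have me : measurable_fun setT (fun t : R => kk z.2 * expdec (kk z.2) t).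
  apply: measurable_funM; first exact: measurable_cst.
  exact: (measurableT_comp measurable_expdec (pair1_measurable (kk z.2))).
have e0 (t : R) : 0 <= kk z.2 * expdec (kk z.2) t by rewrite mulr_ge0// expdec_ge0.
have -> : (\int[leb]_t (expdec (kk z.2) t * (F (line z t).2 * kk (line z t).2))%:E =
    (F z.2)%:E)%E.
  transitivity ((F z.2)%:E * \int[leb]_t (kk z.2 * expdec (kk z.2) t)%:E)%E.
    etransitivity; last exact/esym/(ge0_mule_integral_EFin leb (F0 z.2) me e0).
    by apply: eq_integral => t _; rewrite mulrC mulrA.
  by rewrite integral_expdec1 ?mule1// kk_gt0.
by rewrite -EFinM mulrC.
Qed.

(** The decay rate is at least [l], so the mass of [Rbar f] is at most 1 / l times that of [f]. *)
Let Rbar_fin : {ae mu6, forall z, Rbar f z \is a fin_num}.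
Proof.
have mR := measurable_Rbar mf f0; have R0 z := Rbar_ge0 z f0.
have iR : mu6.-integrable setT (Rbar f).
  apply/integrableP; split => //.
  rewrite (_ : integral _ _ _ = \int[mu6]_z Rbar f z)%E; last first.
    by apply: eq_integral => z _; rewrite gee0_abs.
  have m1 : measurable_fun setT (fun _ : vec R => 1 : R) by exact: measurable_cst.
  have lR : (l%:E * \int[mu6]_z Rbar f z <= \int[mu6]_z (f z)%:E)%E.
    rewrite (ge0_mule_integral mu6 (ltW l0) mR R0).
    rewrite (_ : (\int[mu6]_z (f z)%:E =
        \int[mu6]_z ((fun=> 1%R) z.2 * f z)%:E)%E); last first.
      by apply: eq_integral => z _; rewrite mul1r.
    rewrite -(Rbar_kk m1 (fun=> ler01)).
    apply: ge0_le_integral; first exact: measurableT.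
    - by move=> z _; rewrite mule_ge0// lee_fin ltW.
    - by apply: emeasurable_funM => //; exact: measurable_cst.
    - apply: emeasurable_funM => //; apply/measurable_EFinP.
      by apply: measurable_funM => //; exact: measurable_cst.
    - by move=> z _; apply: lee_wpmul2r => //; rewrite lee_fin mul1r lerDl.
  rewrite ltey; apply/negP => /eqP Ry; move: lR; rewrite Ry gt0_muley ?lte_fin//.
  by move=> /le_lt_trans /(_ f_lty); rewrite ltxx.
by have := integrable_ae measurableT iR; apply: filterS => z; exact.
Qed.

Lemma resolvent_ge0 z : 0 <= resolvent f z.
Proof. by apply/fine_ge0; exact: Rbar_ge0. Qed.

Lemma measurable_resolvent : measurable_fun setT (resolvent f).
Proof.
apply: (measurableT_comp (@fine_measurable R setT measurableT)).
exact: measurable_Rbar.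
Qed.

Let integral_resolvent psi : measurable_fun setT psi -> (forall z, 0 <= psi z) ->
  (\int[mu6]_z (psi z * resolvent f z)%:E = \int[mu6]_z ((psi z)%:E * Rbar f z))%E.
Proof.
move=> mpsi psi0; have mR := measurable_Rbar mf f0.
apply: ge0_ae_eq_integral; first exact: measurableT.
- by apply/measurable_EFinP; apply: measurable_funM => //; exact: measurable_resolvent.
- by apply: emeasurable_funM => //; exact/measurable_EFinP.
- by move=> z _; rewrite lee_fin mulr_ge0// resolvent_ge0.
- by move=> z _; rewrite mule_ge0 ?lee_fin// Rbar_ge0.
by have := Rbar_fin; apply: filterS => z Rz _; rewrite EFinM /resolvent fineK.
Qed.

Lemma resolvent_weight (F : vec R -> R) : measurable_fun setT F -> (forall v, 0 <= F v) ->
  (\int[mu6]_z (F z.2 * (l + sg z.2) * resolvent f z)%:E = \int[mu6]_z (F z.2 * f z)%:E)%E.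
Proof.
move=> mF F0; have k0 v := ltW (kk_gt0 v).
have mFk : measurable_fun setT (fun z : phase R => F z.2 * kk z.2).
  by apply: measurable_funM => //; mfun.
have Fk0 (z : phase R) : 0 <= F z.2 * kk z.2 by exact: mulr_ge0.
by rewrite -(Rbar_kk mF F0) -(integral_resolvent mFk Fk0).
Qed.

Lemma integral_kk_resolvent :
  (\int[mu6]_z ((l + sg z.2) * resolvent f z)%:E = \int[mu6]_z (f z)%:E)%E.
Proof.
have m1 : measurable_fun setT (fun _ : vec R => 1 : R) by exact: measurable_cst.
have := resolvent_weight m1 (fun=> ler01).
rewrite (_ : (\int[mu6]_z (1 * f z)%:E = \int[mu6]_z (f z)%:E)%E); last first.
  by apply: eq_integral => z _; rewrite mul1r.
by move=> <-; apply: eq_integral => z _; rewrite mul1r.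
Qed.

Lemma L1_kk_resolvent : L1 (fun z => (l + sg z.2) * resolvent f z).
Proof.
apply: L1P.
  by apply: measurable_funM; [exact: measurable_kk|exact: measurable_resolvent].
rewrite (_ : integral _ _ _ = \int[mu6]_z ((l + sg z.2) * resolvent f z)%:E)%E.
  by rewrite integral_kk_resolvent.
apply: eq_integral => z _; rewrite ger0_norm// mulr_ge0 ?resolvent_ge0//.
exact: ltW (kk_gt0 _).
Qed.

Let L1_le (g h : fn R) : measurable_fun setT g -> L1 h ->
  (forall z, `|g z| <= `|h z|) -> L1 g.
Proof.
move=> mg Lh gh; apply: L1P => //; apply: le_lt_trans (L1_lt_pinfty Lh).
apply: ge0_le_integral; first exact: measurableT.
- by move=> z _; rewrite lee_fin.
- by apply/measurable_EFinP; mfun.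
- exact: (L1_emeasurable (L1_normr Lh)).
- by move=> z _; rewrite lee_fin.
Qed.

Lemma L1_resolvent : L1 (resolvent f).
Proof.
apply: (L1_le measurable_resolvent (L1Z l^-1 L1_kk_resolvent)) => z.
have R0 := resolvent_ge0 z; have k0 := kk_gt0 z.2.
rewrite !ger0_norm//; last by rewrite !mulr_ge0// ?invr_ge0 ?ltW.
rewrite mulrA ler_peMl// mulrDr mulVf ?gt_eqF// lerDl mulr_ge0// invr_ge0 ltW//.
Qed.

Lemma L1_sg_resolvent : L1 (fun z => sg z.2 * resolvent f z).
Proof.
have mr := measurable_resolvent.
have ms : measurable_fun setT (fun z : phase R => sg z.2 * resolvent f z) by mfun.
apply: (L1_le ms L1_kk_resolvent) => z.
have R0 := resolvent_ge0 z; have k0 := kk_gt0 z.2.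
rewrite !normrM ler_wpM2r// ger0_norm// ger0_norm ?lerDr ?ltW//.
Qed.

Lemma L1_bounded_mul (g psi : fn R) (M : R) : L1 g -> measurable_fun setT psi ->
  (forall z, `|psi z| <= M) -> L1 (fun z => g z * psi z).
Proof.
move=> Lg mpsi psiM; have mg := L1_measurable Lg.
apply: (L1_le (measurable_funM mg mpsi) (L1Z M Lg)) => z.
rewrite !normrM mulrC ler_wpM2r//; apply: (le_trans (psiM z)); exact: ler_norm.
Qed.

(** The pairing handles only nonnegative functions, so k phi - Dv phi is shifted to [psi] by
    constants before [integral_characteristic] is applied. The shifts are then removed by the
    weighted identity for functions of the velocity. *)
Lemma T0_resolvent : T0 (resolvent f) (fun z => (l + sg z.2) * resolvent f z - f z).
Proof.
have LR := L1_resolvent; have LkR := L1_kk_resolvent.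
split => //; split; first exact: L1B.
move=> phi tphi; have [M [M0 phiM DM]] := test_fn_bounded tphi.
have [_ [cphi [_ cD]]] := tphi.
have mphi := continuous_phase_measurable cphi.
have mD := continuous_phase_measurable cD.
have mk := measurable_kk; have mR := measurable_resolvent.
have mi : measurable_fun setT (fun v => M / kk v).
  rewrite (_ : (fun v => M / kk v) = fun v => M * kk v `^ (-1)); last first.
    by apply/funext => v; rewrite powR_inv1// ltW.
  apply: measurable_funM; first exact: measurable_cst.
  by apply: (measurableT_comp (measurable_powR _)); rewrite /kk; mfun.
have i0 v : 0 <= M / kk v by rewrite divr_ge0// ltW.
have mi2 : measurable_fun setT (fun z : phase R => M / kk z.2).
  exact: (measurableT_comp mi measurable_snd).
pose psi z := kk z.2 * (phi z + M) + (M - Dv phi z).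
have mpsi : measurable_fun setT psi.
  apply: measurable_funD; first apply: measurable_funM => //; by mfun.
have pM z : 0 <= phi z + M.
  by have := phiM z; rewrite ler_norml -lerBlDr sub0r => /andP[].
have psi0 z : 0 <= psi z.
  apply: addr_ge0; first by rewrite mulr_ge0// ltW.
  by rewrite subr_ge0 (le_trans (ler_norm _)).
have E : (\int[mu6]_z (psi z * resolvent f z)%:E =
    \int[mu6]_z (f z * (phi z + M + M / kk z.2))%:E)%E.
  rewrite (integral_resolvent mpsi psi0) (resolvent_pairing mpsi psi0 mf f0).
  apply: eq_integral => z _; rewrite EFinM; congr (_ * _)%E.
  by rewrite -(integral_characteristic z tphi (kk_gt0 z.2) phiM DM).
have L1a := L1_bounded_mul LkR mphi phiM.
have L1b := L1_bounded_mul LR mD DM.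
have L1c := L1Z M LkR; have L1d := L1Z M LR.
have L1e := L1_bounded_mul Lf mphi phiM; have L1f := L1Z M Lf.
have L1g : L1 (fun z => f z * (M / kk z.2)).
  apply: (L1_bounded_mul Lf mi2 (M := M / l)) => z; rewrite ger0_norm//.
  by rewrite ler_pM2l// lef_pV2 ?posrE// lerDl.
(* [E1] and [E2] evaluate the contributions of the two shifts, through the velocity weights [M] and
   [M / kk]. *)
have E1 : \int[mu6]_z (M * ((l + sg z.2) * resolvent f z)) = \int[mu6]_z (M * f z).
  congr fine; rewrite -(resolvent_weight (F := fun=> M)) //; last by move=> v; exact: ltW.
    by apply: eq_integral => z _; rewrite mulrA.
have E2 : \int[mu6]_z (M * resolvent f z) = \int[mu6]_z (f z * (M / kk z.2)).
  congr fine; transitivity (\int[mu6]_z (M / kk z.2 * f z)%:E)%E.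
    rewrite -(resolvent_weight mi i0).
    by apply: eq_integral => z _; rewrite divfK// gt_eqF// kk_gt0.
  by apply: eq_integral => z _; rewrite mulrC.
have E3 : \int[mu6]_z ((l + sg z.2) * resolvent f z * phi z) +
    \int[mu6]_z (M * ((l + sg z.2) * resolvent f z)) +
    (\int[mu6]_z (M * resolvent f z) - \int[mu6]_z (resolvent f z * Dv phi z)) =
    \int[mu6]_z (f z * phi z) + \int[mu6]_z (M * f z) + \int[mu6]_z (f z * (M / kk z.2)).
  rewrite -(RintegralD measurableT L1a L1c) -(RintegralB measurableT L1d L1b).
  rewrite -(RintegralD measurableT (L1D L1a L1c) (L1B L1d L1b)).
  rewrite -(RintegralD measurableT L1e L1f) -(RintegralD measurableT (L1D L1e L1f) L1g).
  congr fine; transitivity (\int[mu6]_z (psi z * resolvent f z)%:E)%E.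
    by apply: eq_integral => z _; rewrite /psi /kk; congr EFin; ring.
  by rewrite E; apply: eq_integral => z _; congr EFin; ring.
rewrite (L1_Rintegral_EFin L1b).
have L1h : L1 (fun z => ((l + sg z.2) * resolvent f z - f z) * phi z).
  by apply: (L1_bounded_mul _ mphi phiM); exact: L1B.
rewrite (L1_Rintegral_EFin L1h); congr EFin.
transitivity (\int[mu6]_z ((l + sg z.2) * resolvent f z * phi z - f z * phi z)).
  by apply: eq_Rintegral => z _; rewrite mulrBl.
rewrite (RintegralB measurableT L1a L1e).
move: E3; rewrite E1 E2; lra.
Qed.

End nonnegative_integrable.

End resolvent.

(** * Density of the range on the domain of [A + K] *)

Section core.
Variables (R : realType) (m m1 eps th1 : R) (u1 : vec R).
Hypotheses (m_gt0 : 0 < m) (m1_gt0 : 0 < m1) (eps_gt0 : 0 < eps)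
  (eps_lt1 : eps < 1) (th1_gt0 : 0 < th1).
Implicit Types (f g p q : fn R).
Local Notation mu6 := (@lam6 R).
Local Notation sigma := (sigma m1 th1 u1).
Local Notation Kop := (Kop m m1 eps th1 u1).
Local Notation AK := (AK m m1 eps th1 u1).

Let cM : R := fine (moment m1 th1 u1).

Let c : R := 6 * dissipation m m1 eps * cM.

Let cM0 : 0 <= cM.
Proof.
apply/fine_ge0/integral_ge0 => p _; rewrite lee_fin; apply: mulr_ge0; first exact: chi_ge0.
by apply: mulr_ge0; [exact: sqr_ge0|exact: M1_ge0].
Qed.

Let c0 : 0 <= c.
Proof. by do 2 apply: mulr_ge0 => //; exact: dissipation_ge0. Qed.

Definition spectral_point : R := c + 1.

Let l := spectral_point.

Lemma spectral_point_gt0 : 0 < l. Proof. by rewrite ltr_wpDl. Qed.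

Let sg0 v : 0 <= sigma v. Proof. exact: sigma_ge0. Qed.
Let msg : measurable_fun setT sigma. Proof. exact: measurable_sigma. Qed.
Let l0 := spectral_point_gt0.

Lemma T0_lin (a b : R) f1 f2 g1 g2 : T0 f1 g1 -> T0 f2 g2 ->
  T0 (fun z => a * f1 z + b * f2 z) (fun z => a * g1 z + b * g2 z).
Proof.
move=> [Lf1 [Lg1 T1]] [Lf2 [Lg2 T2]].
split; first by apply: L1D; exact: L1Z.
split; first by apply: L1D; exact: L1Z.
move=> phi tphi; have [M [_ phiM DM]] := test_fn_bounded tphi.
have [_ [cphi [_ cD]]] := tphi.
have mphi := continuous_phase_measurable cphi.
have mD := continuous_phase_measurable cD.
have lin (h1 h2 psi : fn R) : L1 h1 -> L1 h2 -> measurable_fun setT psi ->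
    (forall z, `|psi z| <= M) ->
    (\int[mu6]_z ((a * h1 z + b * h2 z) * psi z)%:E =
     a%:E * \int[mu6]_z (h1 z * psi z)%:E + b%:E * \int[mu6]_z (h2 z * psi z)%:E)%E.
  move=> Lh1 Lh2 mpsi psiM.
  have L1 := L1_bounded_mul Lh1 mpsi psiM; have L2 := L1_bounded_mul Lh2 mpsi psiM.
  transitivity (\int[mu6]_z ((a * (h1 z * psi z))%:E + (b * (h2 z * psi z))%:E))%E.
    by apply: eq_integral => z _; rewrite -EFinD; congr EFin; ring.
  rewrite (integralD measurableT (L1Z a L1) (L1Z b L2)); congr (_ + _)%E.
  - rewrite -(integralZl measurableT L1); apply: eq_integral => z _; exact: EFinM.
  - rewrite -(integralZl measurableT L2); apply: eq_integral => z _; exact: EFinM.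
by rewrite lin// lin// T1// T2.
Qed.

Lemma AK_lin (a b : R) f1 f2 g1 g2 : AK f1 g1 -> AK f2 g2 ->
  AK (fun z => a * f1 z + b * f2 z) (fun z => a * g1 z + b * g2 z).
Proof.
move=> [[Lf1 [_ Ls1]] [Lg1 [h1 [T1 E1]]]] [[Lf2 [_ Ls2]] [Lg2 [h2 [T2 E2]]]].
have T12 := T0_lin a b T1 T2.
split; last first.
  split; first by apply: L1D; exact: L1Z.
  exists (fun z => a * h1 z + b * h2 z); split; first exact: T12.
  have : aeq (Kop (fun z => a * f1 z + b * f2 z)) (fun z => a * Kop f1 z + b * Kop f2 z).
    exact: Kop_linear.
  move: E1 E2; apply: filterS3 => z -> -> ->; ring.
split; first by apply: L1D; exact: L1Z.
split; first by eexists; exact: T12.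
rewrite (_ : (fun z => _) =
    (fun z => a * (sigma z.2 * f1 z) + b * (sigma z.2 * f2 z))); last first.
  by apply/funext => z; ring.
by apply: L1D; exact: L1Z.
Qed.

(** Membership in the closure of the range; the zero integral of the image is carried along for
    honesty. *)
Definition in_range p := forall e : R, 0 < e -> exists u g, [/\ AK u g,
  \int[mu6]_z g z = 0 & L1norm (fun z => l * u z - g z - p z) < e].

Let Op_L1 u g : AK u g -> L1 u /\ L1 g.
Proof. by move=> [[Lu _] [Lg _]]. Qed.

Lemma in_range_lin (a b : R) p q : L1 p -> L1 q -> in_range p -> in_range q ->
  in_range (fun z => a * p z + b * q z).
Proof.
(* The summand 1 keeps the divisor positive and makes the final inequality strict. *)
move=> Lp Lq rp rq e e0; pose d := e / (`|a| + `|b| + 1).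
have ab0 : 0 < `|a| + `|b| + 1 by rewrite ltr_wpDl// addr_ge0.
have d0 : 0 < d by rewrite divr_gt0.
have [u [g [ug g0 nu]]] := rp d d0; have [v [h [vh h0 nv]]] := rq d d0.
have [Lu Lg] := Op_L1 ug; have [Lv Lh] := Op_L1 vh.
exists (fun z => a * u z + b * v z), (fun z => a * g z + b * h z); split.
- exact: AK_lin.
- rewrite (RintegralD measurableT (L1Z a Lg) (L1Z b Lh)).
  by rewrite (RintegralZl _ measurableT Lg) (RintegralZl _ measurableT Lh) g0 h0 !mulr0 addr0.
have LA : L1 (fun z => l * u z - g z - p z) by apply: L1B => //; apply: L1B => //; exact: L1Z.
have LB : L1 (fun z => l * v z - h z - q z) by apply: L1B => //; apply: L1B => //; exact: L1Z.
rewrite (_ : (fun z => _) = (fun z => a * (l * u z - g z - p z) + b * (l * v z - h z - q z))).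
  apply: (le_lt_trans (L1normD (L1Z a LA) (L1Z b LB))); rewrite !L1normZ//.
  apply: (@le_lt_trans _ _ (`|a| * d + `|b| * d)).
    by apply: lerD; apply: ler_wpM2l => //; exact: ltW.
  by rewrite -mulrDl /d mulrA ltr_pdivrMr// mulrC ltr_pM2l// ltrDl.
by apply/funext => z; ring.
Qed.

Lemma in_range_closed p : L1 p ->
  (forall e : R, 0 < e -> exists q, [/\ L1 q, in_range q & L1dist q p < e]) -> in_range p.
Proof.
move=> Lp H e e0; have e20 : 0 < e / 2 by rewrite divr_gt0.
have [q [Lq rq qp]] := H _ e20; have [u [g [ug g0 nu]]] := rq _ e20.
have [Lu Lg] := Op_L1 ug; exists u, g; split => //.
have Llu := L1Z l Lu.
apply: (@le_lt_trans _ _ (L1norm (fun z => l * u z - g z - q z) + L1dist q p)).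
  apply: L1normDae.
  - by apply: L1B => //; exact: L1B.
  - exact: L1B.
  - by apply: L1B => //; exact: L1B.
  - by apply: aeW => z; ring.
by rewrite [e]splitr ltrD.
Qed.

Definition step f : fn R := Kop (resolvent sigma l f).

Section step_facts.
Variable f : fn R.
Hypotheses (Lf : L1 f) (f0 : forall z, 0 <= f z).

Let mf : measurable_fun setT f. Proof. exact: L1_measurable. Qed.
Let Rf0 z : 0 <= resolvent sigma l f z. Proof. exact: resolvent_ge0. Qed.
Let mRf : measurable_fun setT (resolvent sigma l f).
Proof. exact: (measurable_resolvent _ msg Lf f0). Qed.
Let LsR : L1 (fun z => sigma z.2 * resolvent sigma l f z).
Proof. exact: (L1_sg_resolvent msg sg0 l0 Lf f0). Qed.

Let sRE : (\int[mu6]_z (sigma z.2 * resolvent sigma l f z)%:E < +oo)%E.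
Proof.
have := L1_lt_pinfty LsR.
rewrite (_ : integral _ _ _ = \int[mu6]_z (sigma z.2 * resolvent sigma l f z)%:E)%E//.
by apply: eq_integral => z _; rewrite ger0_norm// mulr_ge0.
Qed.

Lemma step_ge0 z : 0 <= step f z.
Proof. exact: Kop_ge0. Qed.

Let integral_step : (\int[mu6]_z (step f z)%:E =
  \int[mu6]_z (sigma z.2 * resolvent sigma l f z)%:E)%E.
Proof. exact: integral_Kop. Qed.

Let mstep : measurable_fun setT (step f).
Proof. exact: measurable_Kop. Qed.

Lemma L1_step : L1 (step f).
Proof.
apply: L1P => //.
rewrite (_ : integral _ _ _ = \int[mu6]_z (step f z)%:E)%E.
  by rewrite integral_step.
by apply: eq_integral => z _; rewrite ger0_norm// step_ge0.
Qed.

(** Attained exactly, with u the resolvent of f. The image l u - f + K u has integral 0, because f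
    has the mass of (l + sigma) u and K u that of sigma u. *)
Lemma in_range_step : in_range (fun z => f z - step f z).
Proof.
move=> e e0; have LR := L1_resolvent msg sg0 l0 Lf f0.
have LkR := L1_kk_resolvent msg sg0 l0 Lf f0.
have TR := T0_resolvent msg sg0 l0 Lf f0.
have Lst := L1_step.
set u := resolvent sigma l f in LR LkR TR *.
pose g : fn R := fun z => l * u z - f z + step f z.
have LlR := L1Z l LR.
have Lg : L1 g by apply: L1D => //; exact: L1B.
exists u, g; split.
- split; first by split => //; split; [eexists; exact: TR|exact: LsR].
  split => //; eexists; split; first exact: TR.
  by apply: aeW => z; rewrite /g /step -/u; ring.
- rewrite (RintegralD measurableT (L1B LlR Lf) Lst) (RintegralB measurableT LlR Lf).
  have -> : \int[mu6]_z step f z = \int[mu6]_z (sigma z.2 * u z) by congr fine.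
  have -> : \int[mu6]_z f z = \int[mu6]_z ((l + sigma z.2) * u z).
    by congr fine; rewrite (integral_kk_resolvent msg sg0 l0 Lf f0).
  have -> : \int[mu6]_z ((l + sigma z.2) * u z) =
      \int[mu6]_z (l * u z) + \int[mu6]_z (sigma z.2 * u z).
    rewrite -(RintegralD measurableT LlR LsR).
    by apply: eq_Rintegral => z _; rewrite mulrDl.
  by ring.
rewrite (_ : (fun z => _) = (fun z => 0 * f z)).
  by rewrite L1normZ// normr0 mul0r.
by apply/funext => z; rewrite /g; ring.
Qed.

(* The drift inequality K^* W <= (sigma + c) W turns the W-moment into a Lyapunov
   function whose decrease bounds the W-moment of the resolvent. *)
Lemma step_moment :
  (\int[mu6]_z (W z.2 * step f z)%:E + \int[mu6]_z (W z.2 * resolvent sigma l f z)%:E <=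
   \int[mu6]_z (W z.2 * f z)%:E)%E.
Proof.
have mW := @measurable_W R; have W0 := @W_ge0 R.
have mW2 : measurable_fun setT (fun z : phase R => W z.2) by mfun.
have ms : measurable_fun setT (fun z : phase R => sigma z.2).
  exact: (measurableT_comp msg measurable_snd).
have H : (\int[mu6]_z (W z.2 * step f z)%:E <=
    \int[mu6]_z ((sigma z.2 + c) * W z.2 * resolvent sigma l f z)%:E)%E.
  exact: integral_W_Kop_le.
apply: (le_trans (leeD H (lexx _))).
rewrite -(resolvent_weight msg sg0 l0 Lf f0 mW W0) -ge0_integralD//; last 4 first.
- move=> z _; rewrite lee_fin; apply: mulr_ge0 => //; apply: mulr_ge0 => //.
  by apply: addr_ge0.
- by apply/measurable_EFinP; mfun.
- by move=> z _; rewrite lee_fin mulr_ge0.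
- by apply/measurable_EFinP; mfun.
apply: ge0_le_integral; first exact: measurableT.
- move=> z _; rewrite -EFinD lee_fin; apply: addr_ge0; last exact: mulr_ge0.
  by apply: mulr_ge0 => //; apply: mulr_ge0 => //; apply: addr_ge0.
- by apply: emeasurable_funD; apply/measurable_EFinP; mfun.
- by apply/measurable_EFinP; mfun.
(* The two integrands coincide: with l = c + 1, the sum of sigma + c and 1 is sigma + l. *)
- move=> z _; rewrite -EFinD lee_fin /l /spectral_point.
  rewrite le_eqVlt; apply/orP; left; apply/eqP; ring.
Qed.

Lemma L1norm_step_le :
  ((L1norm (step f))%:E <= (6 * cM)%:E * \int[mu6]_z (W z.2 * resolvent sigma l f z)%:E)%E.
Proof.
have mW := @measurable_W R; have W0 := @W_ge0 R.
have mWR : measurable_fun setT (fun z => W z.2 * resolvent sigma l f z) by mfun.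
have WR0 z : 0 <= W z.2 * resolvent sigma l f z by exact: mulr_ge0.
have k0 : 0 <= 6 * cM by exact: mulr_ge0.
rewrite (L1norm_EFin L1_step).
rewrite (_ : integral _ _ _ = \int[mu6]_z (sigma z.2 * resolvent sigma l f z)%:E)%E; last first.
  rewrite -integral_step; apply: eq_integral => z _.
  by rewrite ger0_norm// step_ge0.
rewrite (ge0_mule_integral_EFin mu6 k0 mWR WR0).
apply: ge0_le_integral; first exact: measurableT.
- by move=> z _; rewrite lee_fin mulr_ge0.
- exact: (L1_emeasurable LsR).
- by apply/measurable_EFinP; apply: measurable_funM; [exact: measurable_cst|].
- move=> z _; rewrite lee_fin mulrA; apply: ler_wpM2r => //.
  exact: sigma_le.
Qed.

End step_facts.

Lemma in_range_moment f : L1 f -> (forall z, 0 <= f z) ->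
  (\int[mu6]_z (W z.2 * f z)%:E < +oo)%E -> in_range f.
Proof.
move=> Lf f0 Wf; have W0 := @W_ge0 R.
pose q n := iter n step f.
have q0 n : forall z, 0 <= q n z.
  by elim: n => [|n IH] z; [exact: f0|rewrite /q iterS; exact: step_ge0].
have Lq n : L1 (q n).
  by elim: n => [|n IH]; [exact: Lf|rewrite /q iterS; exact: (L1_step IH (q0 n))].
have rq n : in_range (fun z => f z - q n z).
  elim: n => [|n IH].
    (* The zero function f - f, obtained as a combination with vanishing coefficients. *)
    have := in_range_lin 0 0 (L1B Lf (L1_step Lf f0)) (L1B Lf (L1_step Lf f0))
      (in_range_step Lf f0) (in_range_step Lf f0).
    rewrite (_ : (fun z => 0 * _ + _) = (fun z => f z - q 0%N z))//.
    by apply/funext => z; rewrite /q/=; ring.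
  have := in_range_lin 1 1 (L1B Lf (Lq n)) (L1B (Lq n) (L1_step (Lq n) (q0 n)))
    IH (in_range_step (Lq n) (q0 n)).
  rewrite (_ : (fun z => 1 * _ + _) = (fun z => f z - q n.+1 z))//.
  by apply/funext => z; rewrite /q iterS -/(q n); ring.
pose EE n := (\int[mu6]_z (W z.2 * q n z)%:E)%E.
pose DD n := (\int[mu6]_z (W z.2 * resolvent sigma l (q n) z)%:E)%E.
have EE0 n : (0 <= EE n)%E by apply: integral_ge0 => z _; rewrite lee_fin mulr_ge0.
have DD0 n : (0 <= DD n)%E.
  by apply: integral_ge0 => z _; rewrite lee_fin mulr_ge0// resolvent_ge0.
have ED n : (EE n.+1 + DD n <= EE n)%E.
  by have := step_moment (Lq n) (q0 n); rewrite /EE /q iterS.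
have EEfin n : EE n \is a fin_num.
  elim: n => [|n IH]; first by rewrite ge0_fin_numE.
  rewrite ge0_fin_numE//; apply: (@le_lt_trans _ _ (EE n)).
    by apply: le_trans (ED n); rewrite leeDl.
  by rewrite ltey_eq IH.
have DDfin n : DD n \is a fin_num.
  rewrite ge0_fin_numE//; apply: (@le_lt_trans _ _ (EE n)).
    by apply: le_trans (ED n); rewrite leeDr.
  by rewrite ltey_eq EEfin.
have k0 : 0 <= 6 * cM by exact: mulr_ge0.
have qE n : L1norm (q n.+1) <= 6 * cM * (fine (EE n) - fine (EE n.+1)).
  have := L1norm_step_le (Lq n) (q0 n); rewrite -/(DD n) -(fineK (DDfin n)) -EFinM lee_fin.
  rewrite /q iterS => /le_trans; apply; apply: ler_wpM2l => //.
  have := ED n; rewrite -(fineK (DDfin n)) -(fineK (EEfin n)) -(fineK (EEfin n.+1)).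
  by rewrite -EFinD lee_fin lerBrDl.
apply: in_range_closed => // e e0.
(* A single small decrement is enough, since it bounds the norm of [q n.+1]. If all were at least
   [e], telescoping would keep [e *+ n] below a fixed multiple of the initial moment for every n. *)
have [n ne] : exists n, 6 * cM * (fine (EE n) - fine (EE n.+1)) < e.
  apply: contrapT => /forallNP H.
  have {}H n : e *+ n <= 6 * cM * (fine (EE 0%N) - fine (EE n)).
    elim: n => [|n IH]; first by rewrite subrr mulr0 mulr0n.
    have /negP := H n; rewrite -leNgt mulrS => Hn.
    have := lerD Hn IH; rewrite -mulrDr; congr (_ <= _ * _); ring.
  have [n] : exists n, 6 * cM * fine (EE 0%N) / e < n%:R.
    exists (Num.bound (6 * cM * fine (EE 0%N) / e)); apply: archi_boundP.
    by rewrite divr_ge0 ?(ltW e0)// mulr_ge0// fine_ge0.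
  rewrite ltr_pdivrMr// => nE; have Hn := H n; rewrite -[e *+ n]mulr_natl in Hn.
  by have := lt_le_trans nE Hn; rewrite ltNge ler_wpM2l// gerBl fine_ge0.
exists (fun z => f z - q n.+1 z); split => //.
  by apply: L1B.
rewrite /L1dist (_ : integral _ _ _ = \int[mu6]_z `|q n.+1 z|%:E)%E.
  exact: le_lt_trans (qE n) ne.
by apply: eq_integral => z _; rewrite addrAC subrr sub0r normrN.
Qed.

(** Restricting f to W <= k gives a W-moment of at most k ||f||, and these restrictions converge to
    f by dominated convergence. *)
Lemma in_range_ge0 f : L1 f -> (forall z, 0 <= f z) -> in_range f.
Proof.
move=> Lf f0; apply: in_range_closed => // e e0.
have mf := L1_measurable Lf; have mW := @measurable_W R; have W0 := @W_ge0 R.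
pose A k := [set v : vec R | W v <= k%:R].
have mA k : measurable_fun setT (\1_(A k) : vec R -> R).
  apply/measurable_indicP; rewrite (_ : A k = (@W R) @^-1` `]-oo, k%:R]%classic).
    by rewrite -[X in measurable X]setTI; apply: mW.
  by apply/seteqP; split => v /=; rewrite in_itv.
pose fk k : fn R := fun z => f z * \1_(A k) z.2.
have mA2 k : measurable_fun setT (fun z : phase R => \1_(A k) z.2 : R).
  exact: (measurableT_comp (mA k) measurable_snd).
have A1 k (z : phase R) : `|\1_(A k) z.2 : R| <= 1.
  by rewrite indicE; case: (_ \in _); rewrite ?normr1 ?normr0.
have Lfk k : L1 (fk k) by exact: (L1_bounded_mul Lf (mA2 k) (A1 k)).
have fk0 k z : 0 <= fk k z by rewrite mulr_ge0// indicE ler0n.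
have rfk k : in_range (fk k).
  apply: in_range_moment => //.
  have Lkf := L1Z k%:R Lf; apply: le_lt_trans (L1_lt_pinfty Lkf).
  apply: ge0_le_integral; first exact: measurableT.
  - by move=> z _; rewrite lee_fin mulr_ge0.
  - apply/measurable_EFinP; apply: measurable_funM; first by mfun.
    exact: L1_measurable.
  - exact: L1_emeasurable (L1_normr Lkf).
  - move=> z _; rewrite lee_fin ger0_norm; last by rewrite mulr_ge0.
    rewrite /fk indicE; case: (boolP (_ \in _)) => [/set_mem Az|_].
      by rewrite mulr1 ler_wpM2r.
    by rewrite !mulr0 mulr_ge0.
have [_ + _] : [/\ mu6.-integrable setT (EFin \o f),
    (fun k => \int[mu6]_z `|(fk k z)%:E - (f z)%:E|)%E @ \oo --> 0%E &
    (fun k => \int[mu6]_z (fk k z)%:E)%E @ \oo --> (\int[mu6]_z (f z)%:E)%E].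
  apply: (@dominated_convergence _ _ _ mu6 setT measurableT
    (fun k z => (fk k z)%:E) (EFin \o f) (EFin \o f)) => //.
  - by move=> k; exact: (L1_emeasurable (Lfk k)).
  - exact: (L1_emeasurable Lf).
  - apply: aeW => z _; apply: cvg_near_cst.
    exists (Num.bound (W z.2)) => // k /= bk; rewrite /fk indicE mem_set ?mulr1//.
    apply/ltW/(lt_le_trans (archi_boundP (W0 z.2))).
    by rewrite ler_nat.
  - apply: aeW => z k _ /=; rewrite lee_fin ger0_norm//.
    by rewrite /fk indicE; case: (_ \in _); rewrite ?mulr1 ?mulr0.
move=> /fine_cvg /cvgr0Pnorm_lt /(_ e e0) /filter_ex[k fke].
exists (fk k); split => //; move: fke; rewrite ger0_norm//.
by apply/fine_ge0/integral_ge0 => z _; exact: abse_ge0.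
Qed.

(** Positive and negative parts, in the form (|p| + p) / 2 and (|p| - p) / 2, reduce to the
    nonnegative case by linearity. *)
Lemma in_range_L1 p : L1 p -> in_range p.
Proof.
move=> Lp; have Ln := L1_normr Lp.
have Lpos : L1 (fun z => 2^-1 * (`|p z| + p z)) by apply/L1Z/L1D.
have Lneg : L1 (fun z => 2^-1 * (`|p z| - p z)) by apply/L1Z/L1B.
have h2 : 0 <= 2^-1 :> R by rewrite invr_ge0.
have pos0 z : 0 <= 2^-1 * (`|p z| + p z).
  by rewrite mulr_ge0// -lerBlDr sub0r -normrN ler_norm.
have neg0 z : 0 <= 2^-1 * (`|p z| - p z) by rewrite mulr_ge0// subr_ge0 ler_norm.
have := in_range_lin 1 (-1) Lpos Lneg (in_range_ge0 Lpos pos0) (in_range_ge0 Lneg neg0).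
rewrite (_ : (fun z => 1 * _ + _) = p)//.
by apply/funext => z; field.
Qed.

End core.

(** * The generator as the closure of [A + K], and conservation of mass *)

Unset Implicit Arguments.

Theorem theorem4p4 (R : realType) (m m1 eps th1 : R) (u1 : vec R)
  (hm : 0 < m) (hm1 : 0 < m1) (heps0 : 0 < eps) (heps1 : eps < 1)
  (hth1 : 0 < th1)
  (Z : sgroup R)
  (hZC0 : C0_semigroup Z) (hZpos : positive_sg Z) (hZcontr : contraction_sg Z)
  (hZext : gen_extends Z (AK m m1 eps th1 u1))
  (hZmin : minimal_sg Z (AK m m1 eps th1 u1)) :
  (forall f g : fn R, generator Z f g <-> AK_closure m m1 eps th1 u1 f g) /\
  (forall (t : R) (f : fn R), 0 <= t -> L1 f ->
     (\int[@lam6 R]_z (Z t f z)%:E = \int[@lam6 R]_z (f z)%:E)%E).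
Proof.
have l0 : 0 < spectral_point m m1 eps th1 u1 by exact: spectral_point_gt0.
have dense p : L1 p -> in_range m m1 eps th1 u1 p by exact: in_range_L1.
split=> [f g|t f t0 Lf].
  split=> [fg|[Lf [Lg [fs [gs [fsgs [fsf gsg]]]]]]].
    have [Lf [Lg _]] := fg; split => //; split => //.
    exact: (generator_closure hZC0 hZcontr l0 hZext dense fg).
  exact: (generator_closed hZC0 hZcontr (fun n => hZext _ _ (fsgs n)) Lf Lg fsf gsg).
rewrite (L1_Rintegral_EFin (sg_L1 hZC0 t0 Lf)) (L1_Rintegral_EFin Lf).
by rewrite (honest hZC0 hZcontr l0 hZext dense t0 Lf).
Qed.
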